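(* Let $(\mathbf{T},h)$ be a cyclic commuting $d$-tuple on a Hilbert space $\mathcal{H}$. Let $L_{\mathbf{T},h}=\sum_k\lambda_kf_k\otimes f_k$ be the spectral decomposition of $L_{\mathbf{T},h}$ on the Fock space $F^2$, let $F_{\mathbf{T},h}(z,w)=\sum_k\lambda_kf_k(z)\overline{f_k(w)}$, and let $\mathcal{H}(F_{\mathbf{T},h})$ be the reproducing kernel Hilbert space on $\mathbb{C}^d$ defined by $F_{\mathbf{T},h}$. Then the following hold. (1) $\mathcal{H}(F_{\mathbf{T},h})\subset F^2$ as sets of functions on $\mathbb{C}^d$. (2) The functions $\{\sqrt{\lambda_k}f_k\}$ form an orthonormal basis for $\mathcal{H}(F_{\mathbf{T},h})$. (3) The differentiation operators $\partial_i:\mathcal{H}(F_{\mathbf{T},h})\to\mathcal{H}(F_{\mathbf{T},h})$, $f\mapsto\frac{\partial f}{\partial z_i}$, $i=1,\dots,d$, are (well-defined and) bounded on $\mathcal{H}(F_{\mathbf{T},h})$. (4) There is a unitary operator $U:\mathcal{H}\to\mathcal{H}(F_{\mathbf{T},h})$ such that $T_i^*=U^*\partial_iU$ for $i=1,\dots,d$.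
   Context: A cyclic commuting $d$-tuple $(\mathbf{T},h)$ on a Hilbert space $\mathcal{H}$ is a tuple $\mathbf{T}=(T_1,\dots,T_d)$ of pairwise commuting bounded operators on $\mathcal{H}$ with a vector $h\in\mathcal{H}$ such that $\{p(\mathbf{T})h: p\in\mathbb{C}[z_1,\dots,z_d]\}$ is dense in $\mathcal{H}$. The Fock space $F^2$ is the space of entire functions $f$ on $\mathbb{C}^d$ with $\|f\|_{F^2}^2=\int|f|^2\,\pi^{-d}e^{-|z|^2}\,dm(z)<\infty$, where $m$ is Lebesgue measure; its reproducing kernel is $K_w^{F^2}(z)=e^{\langle z,w\rangle}$ with $\langle z,w\rangle=\sum_iz_i\overline{w_i}$. For entire $f=\sum_\alpha a_\alpha z^\alpha$, $f(\mathbf{T})=\sum_\alpha a_\alpha\mathbf{T}^\alpha$. Define $\iota:F^2\to\mathcal{H}$, $\iota f=f(\mathbf{T})h$; this is a compact operator, and $L_{\mathbf{T},h}=\iota^*\iota$ is a positive compact operator on $F^2$. In its spectral decomposition $L_{\mathbf{T},h}=\sum_k\lambda_kf_k\otimes f_k$, $\{\lambda_k\}$ is the sequence of nonzero eigenvalues counted with multiplicity in non-increasing order, $\{f_k\}$ is a (fixed) corresponding orthonormal sequence of eigenvectors in $F^2$, and $(f\otimes g)(r)=\langle r,g\rangle_{F^2}f$. One has $F_{\mathbf{T},h}(z,w)=\langle L_{\mathbf{T},h}K_w^{F^2},K_z^{F^2}\rangle_{F^2}$, a positive semi-definite kernel on $\mathbb{C}^d$. *)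

(* Defs.v *)
(* mpoly has to be imported before mathcomp-analysis: in the other order their
   notations clash. *)
From HB Require Import structures.
From mathcomp Require Import all_boot all_order all_algebra complex finmap.
From mathcomp Require Import mpoly.
From mathcomp Require Import all_classical all_reals all_analysis.
From mathcomp Require Import showcase.summability.

Set Implicit Arguments.
Unset Strict Implicit.
Unset Printing Implicit Defensive.
Import Order.TTheory GRing.Theory Num.Theory Num.Def.
Import numFieldNormedType.Exports.

Local Open Scope classical_set_scope.
Local Open Scope ring_scope.

(* The library equips abstract numFieldTypes with their usual topology; these
   instances do the same for the concrete field R[i], viewed as a normed space
   over itself, so that derivatives below are complex derivatives. *)
HB.instance Definition _ (R : realType) :=
  PseudoPointedMetric.copy R[i] R[i]^o.
HB.instance Definition _ (R : realType) := NormedModule.copy R[i] R[i]^o.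

(* A subspace of V together with an inner product; the values of [ip] outside
   the carrier are meaningless.  Spaces of functions such as the Fock space and
   reproducing kernel Hilbert spaces are of this form, with V a space of
   functions. *)
Record hspace (K : numFieldType) (V : lmodType K) := HSpace {
  carrier : set V;
  ip : V -> V -> K
}.
Arguments HSpace {K V}.

HB.instance Definition _ (K : numFieldType) (V : lmodType K) :=
  gen_eqMixin (hspace V).
HB.instance Definition _ (K : numFieldType) (V : lmodType K) :=
  gen_choiceMixin (hspace V).

Section Hilbert.
Variable R : realType.
Local Notation C := R[i].

Definition hfull (V : lmodType C) (dot : V -> V -> C) : hspace V :=
  HSpace setT dot.

Definition hnorm (V : lmodType C) (S : hspace V) (x : V) : R :=
  Num.sqrt (complex.Re (ip S x x)).

Definition hcvg (V : lmodType C) (S : hspace V) (u : nat -> V) (x : V) : Prop :=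
  (fun n => hnorm S (u n - x)) @ \oo --> (0 : R).

Record is_hilbert (V : lmodType C) (S : hspace V) : Prop := IsHilbert {
  hilbert0 : carrier S 0;
  hilbertP : forall (a : C) x y,
    carrier S x -> carrier S y -> carrier S (a *: x + y);
  ip_linearl : forall (a : C) x y z,
    carrier S x -> carrier S y -> carrier S z ->
    ip S (a *: x + y) z = a * ip S x z + ip S y z;
  ip_herm : forall x y, carrier S x -> carrier S y -> ip S y x = (ip S x y)^*;
  ip_gt0 : forall x, carrier S x -> x <> 0 -> 0 < ip S x x;
  hilbert_complete : forall u : nat -> V,
    (forall n, carrier S (u n)) ->
    (forall e : R, 0 < e -> exists N, forall m n,
       (N <= m)%N -> (N <= n)%N -> hnorm S (u m - u n) < e) ->
    exists2 x, carrier S x & hcvg S u x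
}.

Definition orthonormal_on (V : lmodType C) (S : hspace V)
    (I : set nat) (e : nat -> V) : Prop :=
  (forall k, I k -> carrier S (e k)) /\
  (forall k l, I k -> I l -> ip S (e k) (e l) = (k == l)%:R).

Definition is_onb (V : lmodType C) (S : hspace V)
    (I : set nat) (e : nat -> V) : Prop :=
  orthonormal_on S I e /\
  (forall x, carrier S x -> forall eps : R, 0 < eps ->
    exists (s : seq nat) (c : nat -> C),
      (forall k, k \in s -> I k) /\
      hnorm S (x - \sum_(k <- s) c k *: e k) < eps).

Definition rank_one (V : lmodType C) (S : hspace V) (f g r : V) : V :=
  ip S r g *: f.

Definition bounded_operator (V W : lmodType C) (S : hspace V) (S' : hspace W)
    (A : V -> W) : Prop :=
  [/\ forall x, carrier S x -> carrier S' (A x),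
      forall (a : C) x y, carrier S x -> carrier S y ->
        A (a *: x + y) = a *: A x + A y &
      exists M : R, forall x, carrier S x -> hnorm S' (A x) <= M * hnorm S x].

Definition is_adjoint (V W : lmodType C) (S : hspace V) (S' : hspace W)
    (A : V -> W) (B : W -> V) : Prop :=
  (forall y, carrier S' y -> carrier S (B y)) /\
  (forall x y, carrier S x -> carrier S' y -> ip S' (A x) y = ip S x (B y)).

(* A^*, determined on the carrier of S'. *)
Definition adjoint (V W : lmodType C) (S : hspace V) (S' : hspace W)
    (A : V -> W) : W -> V :=
  xget (fun=> 0) [set B | is_adjoint S S' A B].

Definition unitary_operator (V W : lmodType C) (S : hspace V) (S' : hspace W)
    (U : V -> W) : Prop :=
  [/\ forall x, carrier S x -> carrier S' (U x),
      forall (a : C) x y, carrier S x -> carrier S y ->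
        U (a *: x + y) = a *: U x + U y,
      forall x y, carrier S x -> carrier S y -> ip S' (U x) (U y) = ip S x y &
      forall y, carrier S' y -> exists2 x, carrier S x & U x = y].

(* L = \sum_k lam k f_k (x) f_k.  A finite list of nonzero eigenvalues is
   padded with zeros: the index set of the decomposition is
   {k | lam k != 0}, an initial segment of nat since lam is nonnegative and
   non-increasing; the f_k outside of it are irrelevant.  As the series
   represents all of L, lam lists all the nonzero eigenvalues, with
   multiplicity. *)
Record spectral_decomposition (V : lmodType C) (S : hspace V) (L : V -> V)
    (lam : nat -> R) (f : nat -> V) : Prop := SpectralDecomposition {
  spectral_ge0 : forall k, 0 <= lam k;
  spectral_mono : forall k l, (k <= l)%N -> lam l <= lam k;
  spectral_orthonormal : orthonormal_on S [set k | lam k != 0] f;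
  spectral_eigen : forall k, lam k != 0 -> L (f k) = (lam k)%:C%C *: f k;
  spectral_sum : forall g, carrier S g ->
    hcvg S (fun n => \sum_(k < n | lam k != 0)
                       (lam k)%:C%C *: rank_one S (f k) (f k) g)
         (L g)
}.

Record is_rkhs (X : Type) (K : X -> X -> C) (S : hspace (X -> C)) : Prop :=
  IsRkhs {
  rkhs_hilbert : is_hilbert S;
  rkhs_kernel : forall w, carrier S (fun z => K z w);
  rkhs_reproducing : forall f w,
    carrier S f -> f w = ip S f (fun z => K z w)
}.

(* By the Moore-Aronszajn theorem, for K positive semi-definite, is_rkhs K has
   a solution whose carrier, and inner product on it, are unique. *)
Definition rkhs (X : Type) (K : X -> X -> C) : hspace (X -> C) :=
  xget (HSpace set0 (fun _ _ => 0)) [set S | is_rkhs K S].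

Definition spectral_kernel (X : Type) (lam : nat -> R) (f : nat -> X -> C)
    (z w : X) : C :=
  lim (series (fun k => (lam k)%:C%C * f k z * (f k w)^*) @ \oo).

End Hilbert.

Section Fock.
Variables (R : realType) (d : nat).
Local Notation C := R[i].
Local Notation Cd := 'rV[C]_d.

Definition partial (i : 'I_d) (f : Cd -> C) : Cd -> C :=
  fun z => 'D_(delta_mx 0 i) f z.

Definition monomial (z : Cd) (alpha : 'X_{1..d}) : C :=
  \prod_(i < d) z 0 i ^+ alpha i.

(* [totally] is the filter of large finite sets of indices: the multiple power
   series converges unconditionally, i.e., absolutely. *)
Definition power_series (f : Cd -> C) (a : 'X_{1..d} -> C) : Prop :=
  forall z : Cd,
    partial_sum (fun alpha => a alpha * monomial z alpha) @ totally --> f z.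

Definition entire (f : Cd -> C) : Prop := exists a, power_series f a.

Definition taylor (f : Cd -> C) : 'X_{1..d} -> C :=
  xget (fun=> 0) [set a | power_series f a].

End Fock.

Section FockSpace.
Variable R : realType.
Local Notation C := R[i].
Local Notation cplane := (measurableTypeR R * measurableTypeR R)%type.

(* Lebesgue measure on C^d = (R^2)^d, as an iterated product measure. *)
Fixpoint lebesgueC (d : nat) : set (d.-tuple cplane) -> \bar R :=
  match d with
  | 0 => dirac [tuple]
  | d'.+1 => pushforward
      ((@lebesgue_measure R \x @lebesgue_measure R) \x @lebesgueC d')%E
      (fun x : cplane * d'.-tuple cplane => [tuple of x.1 :: x.2])
  end.

Variable d : nat.
Local Notation Cd := 'rV[C]_d.

Definition cvec (p : d.-tuple cplane) : Cd :=
  \row_(i < d) ((tnth p i).1 +i* (tnth p i).2)%C.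

Definition sqnormC (z : C) : R := complex.Re z ^+ 2 + complex.Im z ^+ 2.

Definition gauss_density (z : Cd) : R :=
  (pi ^+ d)^-1 * expR (- \sum_(i < d) sqnormC (z 0 i)).

Definition fock_ip (f g : Cd -> C) : C :=
  (fine (\int[@lebesgueC d]_p
     (complex.Re (f (cvec p) * (g (cvec p))^*) * gauss_density (cvec p))%:E)
   +i*
   fine (\int[@lebesgueC d]_p
     (complex.Im (f (cvec p) * (g (cvec p))^*) * gauss_density (cvec p))%:E))%C.

Definition fock : hspace (Cd -> C) :=
  HSpace
    [set f | entire f /\
      (\int[@lebesgueC d]_p
         (sqnormC (f (cvec p)) * gauss_density (cvec p))%:E < +oo)%E]
    fock_ip.

End FockSpace.

Section Tuples.
Variables (R : realType) (d : nat) (H : completeNormedModType R[i]).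
Variable T : 'I_d -> {linear H -> H}.
Local Notation C := R[i].
Local Notation Cd := 'rV[C]_d.

(* The order of the factors is immaterial for commuting operators. *)
Definition op_monomial (alpha : 'X_{1..d}) (x : H) : H :=
  foldr (fun i y => iter (alpha i) (T i) y) x (enum 'I_d).

Definition op_poly (p : {mpoly C[d]}) (x : H) : H :=
  \sum_(alpha <- msupp p) p@_alpha *: op_monomial alpha x.

Definition op_entire (f : Cd -> C) (x : H) : H :=
  summability.sum (fun alpha => taylor f alpha *: op_monomial alpha x).

Record cyclic_commuting_tuple (h : H) : Prop := CyclicCommutingTuple {
  tuple_bounded : forall i, continuous (T i);
  tuple_commute : forall i j x, T i (T j x) = T j (T i x);
  tuple_cyclic : dense [set op_poly p h | p in [set: {mpoly C[d]}]]
}.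

Definition iota_op (h : H) (f : Cd -> C) : H := op_entire f h.

Definition L_op (dot : H -> H -> C) (h : H) (f : Cd -> C) : Cd -> C :=
  adjoint (fock R d) (hfull dot) (iota_op h) (iota_op h f).

End Tuples.

(* Main.v *)
(* Put k_z = exp(conj(z) . T) h.  The model map (U x)(z) = <x, k_z> =
   sum_al <x, T^al h> / al! z^al is the adjoint of iota, because the monomials
   are orthogonal in the Fock space with |z^al|^2 = al!.  Hence L = U iota and
   F(z, w) = <k_w, k_z>, so that H(F) is the range of U with the norm of H, U
   being injective by cyclicity; and d_i (U x) = U (T_i^* x) since both have
   Taylor coefficients <x, T_i T^al h> / al!.  Orthogonality of the monomials
   comes from invariance of planar Lebesgue measure under one rotation of
   infinite order, itself a product of three shears. *)
Require Import Defs.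
From HB Require Import structures.
From mathcomp Require Import all_boot all_order all_algebra complex finmap.
From mathcomp Require Import mpoly.
From mathcomp Require Import all_classical all_reals all_analysis.
From mathcomp Require Import measurable_realfun showcase.summability.
From mathcomp Require Import ring lra zify.
Set Implicit Arguments.
Unset Strict Implicit.
Unset Printing Implicit Defensive.
Import Order.TTheory GRing.Theory Num.Theory Num.Def.
Import numFieldNormedType.Exports.
Local Open Scope classical_set_scope.
Local Open Scope ring_scope.

(** * Convergence and unconditional summability over R[i] *)

(** Adjoints and the reproducing kernel space are chosen from their defining properties, so the
    explicit candidates ([U], its inverse, [range_space]) have to be identified with the chosen
    objects. For the kernel space this takes the uniqueness half of Moore-Aronszajn, which is
    derived from Riesz representation. Orthogonality of z^m and z^n for m different from n only asks
    for a number [omega] of modulus 1 with omega^m conj(omega)^n different from 1. A single [omega]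
    of infinite order serves all such m and n, and since (3 + 4i) / 5 has rational coordinates its
    infinite order is a statement of arithmetic modulo 5. The partial sums of the Taylor series of a
    Fock function come with no integrable bound on C^d, which stands in the way of integrating term
    by term against the Gaussian. The Gaussian is therefore cut off to a polydisc, where convergence
    is uniform, and the cut-off is removed afterwards. In the pairing of f with g it is g that is
    expanded, and g is always of exponential type: this covers the monomials, the kernel functions
    and every [U x]. *)

Section ComplexNorm.
Variable R : realType.
Local Notation C := R[i].

(** The norm of a normed module over [R[i]] is itself an element of [R[i]]; taking its real part
    lets the estimates run in the ordered field [R]. *)
Definition rnorm (V : normedModType C) (x : V) : R := complex.Re `|x|.

Lemma conjCE (z : C) : z^* = (complex.Re z -i* complex.Im z)%C.
Proof. by case: z. Qed.

Lemma ReC_le (x y : C) : x <= y -> complex.Re x <= complex.Re y.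
Proof. by rewrite lecE => /andP[]. Qed.

Section Rnorm.
Variable V : normedModType C.
Implicit Types x y : V.

Lemma normE x : `|x| = (rnorm x)%:C%C.
Proof.
rewrite /rnorm; have := normr_ge0 x; case: `|x| => a b.
by rewrite lecE /= => /andP[/eqP -> _].
Qed.

Lemma rnorm_ge0 x : 0 <= rnorm x.
Proof. by rewrite -lecR -normE normr_ge0. Qed.

Lemma rnorm0 : rnorm (0 : V) = 0.
Proof. by rewrite /rnorm normr0. Qed.

Lemma rnormN x : rnorm (- x) = rnorm x.
Proof. by rewrite /rnorm normrN. Qed.

Lemma rnormB x y : rnorm (x - y) = rnorm (y - x).
Proof. by rewrite -rnormN opprB. Qed.

Lemma rnormD x y : rnorm (x + y) <= rnorm x + rnorm y.
Proof. by rewrite -lecR rmorphD /= -!normE ler_normD. Qed.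

Lemma rnormZ (a : C) x : rnorm (a *: x) = rnorm (a) * rnorm x.
Proof. by apply: complexI; rewrite rmorphM /= -!normE (normrZ a x). Qed.

Lemma rnorm_eq0 x : rnorm x = 0 -> x = 0.
Proof. by move=> x0; apply: normr0_eq0; rewrite normE x0. Qed.

Lemma rnorm_sum (I : Type) (s : seq I) (P : pred I) (F : I -> V) :
  rnorm (\sum_(i <- s | P i) F i) <= \sum_(i <- s | P i) rnorm (F i).
Proof.
elim/big_rec2: _ => [|i a b _]; first by rewrite rnorm0.
by move=> h; apply: le_trans (rnormD _ _) _; rewrite lerD2l.
Qed.

Lemma cvg_rnormP (T : Type) (F : set_system T) {FF : Filter F} (u : T -> V) (l : V) :
  (u @ F --> l) <-> forall e : R, 0 < e -> \forall t \near F, rnorm (u t - l) < e.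
Proof.
split=> [/cvgrPdist_lt h e e0|h].
  have e0' : 0 < e%:C%C by rewrite ltcR.
  by near do rewrite rnormB -ltcR -normE; exact: h.
apply/cvgrPdist_lt => e; rewrite ltcE /= => /andP[/eqP e1 e2].
have -> : e = (complex.Re e)%:C%C by case: e e1 {e2} => a b /= ->.
by near do rewrite normE ltcR rnormB; exact: h.
Unshelve. all: by end_near.
Qed.

Lemma cvg_rnorm0P (T : Type) (F : set_system T) {FF : Filter F} (u : T -> V) (l : V) :
  (u @ F --> l) <-> ((fun t => rnorm (u t - l)) @ F --> (0 : R)).
Proof.
split=> [/cvg_rnormP h|/cvgrPdist_lt h].
  apply/cvgrPdist_lt => e e0; near do rewrite sub0r normrN ger0_norm ?rnorm_ge0//.
  exact: h.
apply/cvg_rnormP => e e0; near do rewrite -(ger0_norm (rnorm_ge0 _)) -normrN -sub0r.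
exact: h.
Unshelve. all: by end_near.
Qed.

End Rnorm.

Lemma rnormCE (z : C) : rnorm (z) = Num.sqrt (complex.Re z ^+ 2 + complex.Im z ^+ 2).
Proof. by case: z. Qed.

Lemma rnormC2 (z : C) : rnorm (z) ^+ 2 = sqnormC z.
Proof. by rewrite rnormCE sqr_sqrtr// addr_ge0// sqr_ge0. Qed.

Lemma rnormCM (z w : C) : rnorm (z * w) = rnorm (z) * rnorm (w).
Proof. exact: rnormZ. Qed.

Lemma rnormCX (z : C) n : rnorm (z ^+ n) = rnorm (z) ^+ n.
Proof.
elim: n => [|n ih]; last by rewrite !exprS rnormCM ih.
by rewrite !expr0 rnormCE /= expr1n expr0n /= addr0 sqrtr1.
Qed.

Lemma rnorm_conj (z : C) : rnorm (z^*) = rnorm (z).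
Proof. by rewrite !rnormCE conjCE /= sqrrN. Qed.

Lemma rnorm_real (x : R) : rnorm (x%:C%C) = `|x|.
Proof. by rewrite rnormCE /= expr0n addr0 sqrtr_sqr. Qed.

Lemma Re_le_rnorm (z : C) : `|complex.Re z| <= rnorm (z).
Proof. by rewrite rnormCE -sqrtr_sqr ler_wsqrtr// lerDl sqr_ge0. Qed.

Lemma Im_le_rnorm (z : C) : `|complex.Im z| <= rnorm (z).
Proof. by rewrite rnormCE -sqrtr_sqr ler_wsqrtr// lerDr sqr_ge0. Qed.

Lemma rnorm_le_ReIm (z : C) : rnorm (z) <= `|complex.Re z| + `|complex.Im z|.
Proof.
rewrite -(@ler_pXn2r _ 2)// ?nnegrE ?rnorm_ge0 ?addr_ge0// rnormC2 /sqnormC.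
by rewrite sqrrD !real_normK ?num_real// lerD2r lerDl mulrn_wge0// mulr_ge0.
Qed.

Lemma cvg_complexP (T : Type) (F : set_system T) {FF : Filter F} (u : T -> C) (l : C) :
  (u @ F --> l) <->
  ((fun t => complex.Re (u t)) @ F --> complex.Re l) /\
  ((fun t => complex.Im (u t)) @ F --> complex.Im l).
Proof.
split=> [/(@cvg_rnormP C) h|[/cvgrPdist_lt hr /cvgrPdist_lt hi]].
  split; apply/cvgrPdist_lt => e e0; near=> t; rewrite distrC.
    by apply: le_lt_trans (_ : rnorm (u t - l) < e); [rewrite -raddfB; exact: Re_le_rnorm|near: t; exact: h].
  by apply: le_lt_trans (_ : rnorm (u t - l) < e); [rewrite -raddfB; exact: Im_le_rnorm|near: t; exact: h].
apply/(@cvg_rnormP C) => e e0; near=> t.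
apply: le_lt_trans (rnorm_le_ReIm _) _; rewrite !raddfB /= [e]splitr ltrD// distrC.
  by near: t; apply: hr; rewrite divr_gt0.
by near: t; apply: hi; rewrite divr_gt0.
Unshelve. all: by end_near.
Qed.

End ComplexNorm.

Section ReIm.
Variable R : realType.
Local Notation C := R[i].

Lemma Re_add (x y : C) : complex.Re (x + y) = complex.Re x + complex.Re y.
Proof. by case: x y => [? ?] []. Qed.

Lemma Im_add (x y : C) : complex.Im (x + y) = complex.Im x + complex.Im y.
Proof. by case: x y => [? ?] []. Qed.

Lemma Re_sum (I : Type) (s : seq I) (P : pred I) (F : I -> C) :
  complex.Re (\sum_(i <- s | P i) F i) = \sum_(i <- s | P i) complex.Re (F i).
Proof. exact: (big_morph _ Re_add erefl). Qed.

Lemma Im_sum (I : Type) (s : seq I) (P : pred I) (F : I -> C) :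
  complex.Im (\sum_(i <- s | P i) F i) = \sum_(i <- s | P i) complex.Im (F i).
Proof. exact: (big_morph _ Im_add erefl). Qed.

End ReIm.

Section Complete.
Variable R : realType.
Local Notation C := R[i].

(** Real and imaginary parts are 1-Lipschitz, hence map a Cauchy filter to Cauchy filters of [R].
    With the resulting instance, scalar series and series in [H] fall under the same lemmas. *)
Lemma complex_complete (F : set_system C) : ProperFilter F -> cauchy F -> cvg F.
Proof.
move=> FF Fc.
have key (f : C -> R) : (forall x y, `|f x - f y| <= rnorm (x - y)) -> cvg (f @ F).
  move=> fl; apply/cauchy_cvgP/cauchy_exP => e e0.
  have /(cauchyP F)/(_ e%:C%C) [|x] := Fc; first by rewrite ltcR.
  rewrite /ball /= => hx; exists (f x) => /=.
  apply: filterS hx => y /=; rewrite /ball /= (normE (x - y)) ltcR => h.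
  by apply: le_lt_trans h; exact: fl.
have /cvg_ex [a ha] := key (@complex.Re R) (fun x y => ltac:(rewrite -raddfB; exact: Re_le_rnorm)).
have /cvg_ex [b hb] := key (@complex.Im R) (fun x y => ltac:(rewrite -raddfB; exact: Im_le_rnorm)).
apply/cvg_ex; exists (a +i* b)%C.
by apply/(@cvg_complexP R C F _ id); split.
Qed.

End Complete.

HB.instance Definition _ (R : realType) :=
  Uniform_isComplete.Build R[i] (@complex_complete R).

#[local] Existing Instance totally_filter.

Section Summability.
Variable R : realType.
Local Notation C := R[i].
Variable I : choiceType.

Lemma partial_sumE (V : zmodType) (x : I -> V) (A : {fset I}) :
  partial_sum x A = \sum_(i <- A) x i.
Proof. by rewrite /partial_sum (big_seq_fsetE _ _ xpredT). Qed.

Lemma eq_big_fset_cond (V : zmodType) (x : I -> V) (A B : {fset I}) (P Q : pred I) :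
  (forall i, (i \in A) && P i = (i \in B) && Q i) ->
  \sum_(i <- A | P i) x i = \sum_(i <- B | Q i) x i.
Proof.
move=> PQ; rewrite big_fset_condE [RHS]big_fset_condE.
by congr (\sum_(i <- enum_fset _) _); apply/fsetP => i; rewrite !inE /=.
Qed.

Lemma big_fset_sub (V : zmodType) (x : I -> V) (A B : {fset I}) :
  (A `<=` B)%fset ->
  \sum_(i <- B) x i = \sum_(i <- A) x i + \sum_(i <- B | i \notin A) x i.
Proof.
move=> AB; rewrite (bigID (fun i => i \in A)) /=; congr (_ + _).
by apply: eq_big_fset_cond => i; rewrite andbT andb_idl// => /(fsubsetP AB).
Qed.

(** Absolute summability with its bound kept explicit, because [M] is reused: it bounds the limit
    and serves to build dominating functions. *)
Definition abs_le (V : normedModType C) (x : I -> V) (M : R) :=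
  forall A : {fset I}, \sum_(i <- A) rnorm (x i) <= M.

(** The finite sums of norms have a supremum. A finite set [A0] whose sum is within [e] of it leaves
    less than [e] to any finite set disjoint from [A0]. *)
Lemma abs_le_tail (V : normedModType C) (x : I -> V) M : abs_le x M ->
  forall e, 0 < e -> exists A0 : {fset I}, forall A : {fset I},
    \sum_(i <- A | i \notin A0) rnorm (x i) < e.
Proof.
move=> xM e e0; pose E := range (fun A : {fset I} => \sum_(i <- A) rnorm (x i)).
have hE : has_sup E.
  split; first by exists (\sum_(i <- fset0) rnorm (x i)), fset0.
  by exists M => _ [A _ <-]; exact: xM.
have [_ [A0 _ <-] hA0] := sup_adherent e0 hE.
exists A0 => A; have /(big_fset_sub (fun i => rnorm (x i))) := fsubsetUl A0 A.
set t := \sum_(_ <- _ | _ \notin _) _ => h.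
have le1 : \sum_(i <- (A0 `|` A)%fset) rnorm (x i) <= sup E.
  by apply: ub_le_sup; [case: hE|exists (A0 `|` A)%fset].
have : \sum_(i <- A | i \notin A0) rnorm (x i) <= t.
  rewrite /t le_eqVlt; apply/orP; left; apply/eqP; apply: eq_big_fset_cond => i.
  by rewrite in_fsetU; case: (i \in A0); rewrite ?andbF.
by move/le_lt_trans; apply; move: h le1 hA0; set a := \sum_(_ <- _) _; lra.
Qed.

Lemma abs_le_cvg (V : completeNormedModType C) (x : I -> V) M : abs_le x M ->
  exists l : V, partial_sum x @ totally --> l.
Proof.
move=> xM; apply/(@cvg_ex V)/cauchy_cvgP/cauchy_exP => e; rewrite ltcE /= => /andP[/eqP e1 e0].
have -> : e = (complex.Re e)%:C%C by case: e e1 {e0} => a b /= ->.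
have [A0 hA0] := abs_le_tail xM e0.
exists (partial_sum x A0); exists A0 => //= A A0A.
rewrite -ball_normE /ball_ /= normE ltcR !partial_sumE (big_fset_sub x A0A) opprD addNKr rnormN.
by apply: le_lt_trans (hA0 A); exact: rnorm_sum.
Qed.

Lemma abs_le_lim (V : normedModType C) (x : I -> V) M (l : V) : abs_le x M ->
  partial_sum x @ totally --> l -> rnorm l <= M.
Proof.
move=> xM /cvg_rnormP h; apply/ler_addgt0Pl => e e0.
have [A /= _ hA] := h _ e0.
have {}hA := hA A (fsubset_refl _).
rewrite -[l](subKr (partial_sum x A)).
apply: le_trans (rnormD _ _) _; rewrite addrC lerD ?rnormN//; first exact: ltW.
by rewrite partial_sumE; apply: le_trans (rnorm_sum _ _ _) _; exact: xM.
Qed.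

(** Beyond some finite [A0] every finite sum is at most 2 in absolute value, being the difference of
    two sums within 1 of the limit. Applying this to the nonnegative and to the negative terms
    separately bounds the sum of absolute values outside [A0] by 4. *)
Lemma cvg_abs_le_R (x : I -> R) (l : R) : partial_sum x @ totally --> l ->
  exists M, forall A : {fset I}, \sum_(i <- A) `|x i| <= M.
Proof.
move=> /cvgrPdist_lt /(_ _ ltr01) [A0 /= _ hA0].
have sub (A : {fset I}) : `|\sum_(i <- A | i \notin A0) x i| <= 2.
  have h0 := hA0 A0 (fsubset_refl _).
  have h1 := hA0 (A0 `|` A)%fset (fsubsetUl _ _).
  rewrite !partial_sumE in h0 h1.
  move: h1; rewrite (big_fset_sub x (fsubsetUl A0 A)).
  have -> : \sum_(i <- (A0 `|` A)%fset | i \notin A0) x i = \sum_(i <- A | i \notin A0) x i.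
    by apply: eq_big_fset_cond => i; rewrite in_fsetU; case: (i \in A0); rewrite ?andbF.
  move: h0; set a := \sum_(_ <- A0) _; set b := \sum_(_ <- A | _) _.
  by rewrite !ltr_norml ler_norml; lra.
exists (\sum_(i <- A0) `|x i| + 4) => A.
rewrite (bigID (fun i => i \in A0)) /= lerD//.
  rewrite big_fset_condE.
  have /(big_fset_sub (fun i => `|x i|)) -> : ([fset i in A | i \in A0] `<=` A0)%fset.
    by apply/fsubsetP => i; rewrite !inE /= => /andP[].
  by rewrite lerDl sumr_ge0.
rewrite (bigID (fun i => 0 <= x i)) /=.
have part (Q : pred I) : `|\sum_(i <- A | (i \notin A0) && Q i) x i| <= 2.
  have := sub [fset i in A | Q i]%fset; congr (`|_| <= 2).
  by apply: eq_big_fset_cond => i; rewrite !inE /= -andbA (andbC (Q i)).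
have -> : (4 : R) = 2 + 2 by ring.
apply: lerD; last first.
  under eq_bigr => i /andP[_] do rewrite -ltNge => /ltr0_norm ->.
  by rewrite sumrN; apply: le_trans (ler_norm _) _; rewrite normrN part.
under eq_bigr => i /andP[_] /ger0_norm -> do idtac.
by apply: le_trans (ler_norm _) _; rewrite part.
Qed.

Lemma cvg_abs_le (x : I -> C) (l : C) : partial_sum x @ totally --> l ->
  exists M, abs_le x M.
Proof.
move=> /cvg_complexP[hr hi].
have [|Mr hMr] := @cvg_abs_le_R (fun i => complex.Re (x i)) (complex.Re l).
  suff -> : partial_sum (fun i => complex.Re (x i)) =
    (fun A => complex.Re (partial_sum x A)) by exact: hr.
  by apply/funext => A; rewrite !partial_sumE Re_sum.
have [|Mi hMi] := @cvg_abs_le_R (fun i => complex.Im (x i)) (complex.Im l).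
  suff -> : partial_sum (fun i => complex.Im (x i)) =
    (fun A => complex.Im (partial_sum x A)) by exact: hi.
  by apply/funext => A; rewrite !partial_sumE Im_sum.
exists (Mr + Mi) => A; apply: le_trans (lerD (hMr A) (hMi A)).
by rewrite -big_split /=; apply: ler_sum => i _; exact: rnorm_le_ReIm.
Qed.

(** Passes from the filter of finite sets to a sequence of them, as dominated convergence speaks of
    sequences. *)
Lemma cvg_exhaust (V : normedModType C) (x : I -> V) (l : V) (b : nat -> {fset I}) :
  (forall A : {fset I}, \forall n \near \oo, (A `<=` b n)%fset) ->
  partial_sum x @ totally --> l ->
  (fun n => \sum_(i <- b n) x i) @ \oo --> l.
Proof.
move=> hb /cvg_rnormP xl; apply/cvg_rnormP => e e0.
have [A _ hA] := xl e e0; near=> n; rewrite -partial_sumE; apply: hA => /=.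
by near: n; exact: hb.
Unshelve. all: by end_near.
Qed.

End Summability.

(** * Pre-Hilbert spaces, Riesz representation, uniqueness of the RKHS *)

Lemma cvg_dist_le (R : realType) (u w : nat -> R) (l K : R) :
  w @ \oo --> 0 -> (forall n, `|u n - l| <= K * w n) -> u @ \oo --> l.
Proof.
move=> w0 h; apply/cvgrPdist_lt => e e0.
have : (fun n => K * w n) @ \oo --> 0 by rewrite -(mulr0 K); exact: cvgMr.
move/cvgrPdist_lt => /(_ e e0) Kw; near=> n; rewrite distrC.
apply: le_lt_trans (h n) _; apply: le_lt_trans (ler_norm _) _.
by rewrite -normrN -sub0r; near: n; exact: Kw.
Unshelve. all: by end_near.
Qed.

Section PreHilbert.
Variable R : realType.
Local Notation C := R[i].
Variables (V : lmodType C).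

(** What [is_hilbert] says apart from definiteness and completeness. The algebra of inner products
    and the Cauchy-Schwarz inequality thus apply alike to the Fock space, to [H] and to reproducing
    kernel spaces. *)
Record is_prehilbert (S : hspace V) : Prop := IsPrehilbert {
  pre0 : carrier S 0;
  preP : forall (a : C) x y, carrier S x -> carrier S y -> carrier S (a *: x + y);
  pre_linearl : forall (a : C) x y z,
    carrier S x -> carrier S y -> carrier S z ->
    ip S (a *: x + y) z = a * ip S x z + ip S y z;
  pre_herm : forall x y, carrier S x -> carrier S y -> ip S y x = (ip S x y)^*;
  pre_ge0 : forall x, carrier S x -> 0 <= complex.Re (ip S x x)
}.

Variable S : hspace V.

Lemma hilbert_pre : is_hilbert S -> is_prehilbert S.
Proof.
case=> h0 hP hl hh hgt _; split=> // x cx.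
have [->|/hgt h] := EM (x = 0).
  by have := hl (-1) 0 0 0 h0 h0 h0; rewrite scaler0 addr0 mulN1r addNr => ->.
by have /ltW /ReC_le := h cx.
Qed.

Hypothesis pS : is_prehilbert S.
Local Notation car := (carrier S).
Local Notation ip := (ip S).
Local Notation hn := (hnorm S).

Lemma carZ a x : car x -> car (a *: x).
Proof. by move=> cx; rewrite -[_ *: _]addr0; apply: (preP pS) => //; exact: pre0. Qed.

Lemma carD x y : car x -> car y -> car (x + y).
Proof. by move=> cx cy; rewrite -[x]scale1r; exact: (preP pS). Qed.

Lemma carN x : car x -> car (- x).
Proof. by rewrite -scaleN1r; exact: carZ. Qed.

Lemma carB x y : car x -> car y -> car (x - y).
Proof. by move=> cx cy; apply: carD => //; exact: carN. Qed.

Lemma car_sum (I : Type) (s : seq I) (P : pred I) (F : I -> V) :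
  (forall i, P i -> car (F i)) -> car (\sum_(i <- s | P i) F i).
Proof.
by move=> h; elim/big_ind : _ => //; [exact: (pre0 pS)|exact: carD].
Qed.

Lemma ipDl x y z : car x -> car y -> car z -> ip (x + y) z = ip x z + ip y z.
Proof.
by move=> cx cy cz; rewrite -{1}[x]scale1r (pre_linearl pS)// mul1r.
Qed.

Lemma ip0l z : car z -> ip 0 z = 0.
Proof.
move=> cz; have c0 := pre0 pS.
by have := ipDl c0 c0 cz; rewrite addr0 -[X in X = _]addr0 => /addrI ->.
Qed.

Lemma ipZl a x z : car x -> car z -> ip (a *: x) z = a * ip x z.
Proof.
move=> cx cz; have := pre_linearl pS a cx (pre0 pS) cz.
by rewrite addr0 ip0l// addr0.
Qed.

Lemma ipNl x z : car x -> car z -> ip (- x) z = - ip x z.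
Proof. by move=> cx cz; rewrite -scaleN1r ipZl// mulN1r. Qed.

Lemma ipBl x y z : car x -> car y -> car z -> ip (x - y) z = ip x z - ip y z.
Proof. by move=> cx cy cz; rewrite ipDl ?ipNl//; exact: carN. Qed.

Lemma ip_suml (I : Type) (s : seq I) (P : pred I) (F : I -> V) z :
  (forall i, P i -> car (F i)) -> car z ->
  ip (\sum_(i <- s | P i) F i) z = \sum_(i <- s | P i) ip (F i) z.
Proof.
move=> h cz.
(* Membership in the carrier travels with the induction, since [ip] is additive only there. *)
pose K x y := car x /\ ip x z = y; 
suff [] : K (\sum_(i <- s | P i) F i) (\sum_(i <- s | P i) ip (F i) z) by [].
elim/big_ind2 : _ => [|x1 x2 y1 y2 [? <-] [? <-]|i Pi].
- by split; [exact: (pre0 pS)|exact: ip0l].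
- by split; [exact: carD|exact: ipDl].
- by split; [exact: h|].
Qed.

Lemma ipC x y : car x -> car y -> ip y x = (ip x y)^*.
Proof. exact: (pre_herm pS). Qed.

Lemma ipDr x y z : car x -> car y -> car z -> ip z (x + y) = ip z x + ip z y.
Proof.
by move=> cx cy cz; rewrite (ipC (carD cx cy) cz) ipDl// rmorphD /= (ipC cx cz) (ipC cy cz).
Qed.

Lemma ipZr a x z : car x -> car z -> ip z (a *: x) = a^* * ip z x.
Proof. by move=> cx cz; rewrite (ipC (carZ a cx) cz) ipZl// rmorphM /= (ipC cx cz). Qed.

Lemma ip0r z : car z -> ip z 0 = 0.
Proof. by move=> cz; rewrite (ipC (pre0 pS) cz) ip0l// rmorph0. Qed.

Lemma ip_sumr (I : Type) (s : seq I) (P : pred I) (F : I -> V) z :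
  (forall i, P i -> car (F i)) -> car z ->
  ip z (\sum_(i <- s | P i) F i) = \sum_(i <- s | P i) ip z (F i).
Proof.
move=> h cz; rewrite (ipC (car_sum s h) cz) ip_suml// rmorph_sum /=.
by apply: eq_bigr => i Pi; rewrite -(ipC (h i Pi) cz).
Qed.

Lemma hnorm_ge0 x : 0 <= hn x.
Proof. exact: sqrtr_ge0. Qed.

Lemma hnorm2 x : car x -> hn x ^+ 2 = complex.Re (ip x x).
Proof. by move=> cx; rewrite sqr_sqrtr// (pre_ge0 pS). Qed.

Lemma ipxx x : car x -> ip x x = (hn x ^+ 2)%:C%C.
Proof.
move=> cx; rewrite hnorm2//; have := ipC cx cx; rewrite conjCE.
by case: (ip x x) => a b /= [] b0; congr Complex; lra.
Qed.

Lemma hnorm2_lin c x y : car x -> car y ->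
  hn (x + c *: y) ^+ 2 = hn x ^+ 2 + 2 * complex.Re (c^* * ip x y) + rnorm c ^+ 2 * hn y ^+ 2.
Proof.
move=> cx cy; have cc := carZ c cy; have cl := carD cx cc.
rewrite hnorm2// (ipDl cx cc cl) (ipDr cx cc cx) (ipDr cx cc cc).
rewrite (ipZl c cy cx) (ipZl c cy cc) (ipZr c cy cx) (ipZr c cy cy) (ipC cx cy).
rewrite (ipxx cx) (ipxx cy) rnormC2 !conjCE /sqnormC.
by case: (ip x y) c {cc cl} => a b [c1 c2] /=; ring.
Qed.

Lemma ip_cauchy x y : car x -> car y -> rnorm (ip x y) <= hn x * hn y.
Proof.
move=> cx cy; set a := ip x y.
have key (t : R) : 0 <= hn x ^+ 2 - 2 * t * rnorm a ^+ 2 + t ^+ 2 * rnorm a ^+ 2 * hn y ^+ 2.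
  suff <- : hn (x + (- t%:C%C * a) *: y) ^+ 2 =
    hn x ^+ 2 - 2 * t * rnorm a ^+ 2 + t ^+ 2 * rnorm a ^+ 2 * hn y ^+ 2.
    exact: sqr_ge0.
  rewrite hnorm2_lin// -/a rnormCM rnormN rnorm_real exprMn real_normK ?num_real//.
  rewrite rnormC2 !conjCE /sqnormC.
  by case: (a) => a1 a2 /=; ring.
rewrite -(@ler_pXn2r _ 2)// ?nnegrE ?mulr_ge0 ?hnorm_ge0 ?rnorm_ge0// exprMn.
have [y0|y0] := eqVneq (hn y ^+ 2) 0.
  have [->|a0] := eqVneq (rnorm a ^+ 2) 0; first by rewrite mulr_ge0// sqr_ge0.
  (* When [hn y = 0] the expression in [key] is affine in [t]; this [t] makes it equal to -1. *)
  have := key ((hn x ^+ 2 + 1) / (2 * rnorm a ^+ 2)); rewrite y0 mulr0 addr0.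
  have -> : 2 * ((hn x ^+ 2 + 1) / (2 * rnorm a ^+ 2)) * rnorm a ^+ 2 = hn x ^+ 2 + 1.
    by field; move: a0; rewrite sqrf_eq0.
  by lra.
(* The minimizer of the quadratic in [key]. *)
have := key (hn y ^+ 2)^-1.
have -> : hn x ^+ 2 - 2 * (hn y ^+ 2)^-1 * rnorm a ^+ 2 +
   (hn y ^+ 2)^-1 ^+ 2 * rnorm a ^+ 2 * hn y ^+ 2 = hn x ^+ 2 - rnorm a ^+ 2 / hn y ^+ 2.
  by field; move: y0; rewrite sqrf_eq0.
by rewrite subr_ge0 ler_pdivrMr// lt0r y0 sqr_ge0.
Qed.

Lemma hnormZ a x : car x -> hn (a *: x) = rnorm a * hn x.
Proof.
move=> cx; apply/eqP; rewrite -(@eqrXn2 _ 2)// ?mulr_ge0 ?hnorm_ge0 ?rnorm_ge0//.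
apply/eqP; have := hnorm2_lin a (pre0 pS) cx; rewrite add0r ip0l// mulr0 /= => ->.
by rewrite hnorm2 ?ip0l ?exprMn /= ?mulr0 ?addr0 ?add0r//; exact: (pre0 pS).
Qed.

Lemma hnormN x : car x -> hn (- x) = hn x.
Proof.
move=> cx; rewrite -scaleN1r hnormZ// rnormN.
by have := rnorm_real (1 : R); rewrite normr1 => ->; rewrite mul1r.
Qed.

Lemma hnormBC x y : car x -> car y -> hn (x - y) = hn (y - x).
Proof. by move=> cx cy; rewrite -opprB hnormN//; exact: carB. Qed.

Lemma hnormD x y : car x -> car y -> hn (x + y) <= hn x + hn y.
Proof.
move=> cx cy; rewrite -(@ler_pXn2r _ 2)// ?nnegrE ?addr_ge0 ?hnorm_ge0//.
rewrite -{1}[y]scale1r hnorm2_lin//.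
have -> : rnorm (1 : C) = 1 by have := rnorm_real (1 : R); rewrite normr1.
rewrite rmorph1 mul1r.
have := le_trans (ler_norm _) (le_trans (Re_le_rnorm _) (ip_cauchy cx cy)).
by move: (hn x) (hn y) (complex.Re _) => a b c; nra.
Qed.

Lemma hnorm_dist x y : car x -> car y -> `|hn x - hn y| <= hn (x - y).
Proof.
move=> cx cy; have := hnormD (carB cx cy) cy; have := hnormD (carB cy cx) cx.
by rewrite !subrK hnormBC// ler_norml; lra.
Qed.

Lemma hcvg_ip u x y : (forall n, car (u n)) -> car x -> car y ->
  hcvg S u x -> (fun n => ip (u n) y) @ \oo --> ip x y.
Proof.
move=> cu cx cy h; apply/cvg_rnorm0P.
apply: (@cvg_dist_le _ _ _ _ (hn y) h) => n.
rewrite subr0 ger0_norm ?rnorm_ge0// -ipBl// mulrC.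
by apply: ip_cauchy => //; exact: carB.
Qed.

Lemma hcvg_hnorm u x : (forall n, car (u n)) -> car x ->
  hcvg S u x -> (fun n => hn (u n)) @ \oo --> hn x.
Proof.
move=> cu cx h; apply: (@cvg_dist_le _ _ _ _ 1 h) => n.
by rewrite mul1r; exact: hnorm_dist.
Qed.

(** Two norms suffice, one for the real and one for the imaginary part. The formula turns equality
    of norms into equality of inner products in the uniqueness of the kernel space. *)
Lemma ip_polar x y : car x -> car y ->
  ip x y = ((hn (x + y) ^+ 2 - hn x ^+ 2 - hn y ^+ 2) / 2
    +i* ((hn (x + 'i%C *: y) ^+ 2 - hn x ^+ 2 - hn y ^+ 2) / 2))%C.
Proof.
move=> cx cy; have := hnorm2_lin 1 cx cy; rewrite scale1r => ->.
rewrite hnorm2_lin// !rnormC2 !conjCE /sqnormC /=.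
by case: (ip x y) => a b /=; congr Complex; field.
Qed.

End PreHilbert.

Lemma cvg_ge (R : realType) (u : nat -> R) (l x : R) :
  u @ \oo --> l -> (forall n, x <= u n) -> x <= l.
Proof.
move=> ul h; rewrite -(cvg_lim _ ul)//; apply: limr_ge; first by apply/cvg_ex; exists l.
exact: nearW.
Qed.

Section Riesz.
Variable R : realType.
Local Notation C := R[i].
Variables (V : lmodType C) (S : hspace V).
Hypothesis hS : is_hilbert S.
Let pS := hilbert_pre hS.
Local Notation car := (carrier S).
Local Notation ip := (ip S).
Local Notation hn := (hnorm S).
(** The functional lives on a subspace [D] that need not be closed: the span of the kernel functions
    for the uniqueness of the kernel space, the whole of [H] for adjoints. *)
Variables (D : set V) (phi : V -> C) (M : R).
Hypothesis D0 : D 0.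
Hypothesis DP : forall (a : C) x y, D x -> D y -> D (a *: x + y).
Hypothesis Dcar : D `<=` car.
Hypothesis phiP : forall (a : C) x y, D x -> D y -> phi (a *: x + y) = a * phi x + phi y.
Hypothesis M0 : 0 <= M.
Hypothesis phiM : forall x, D x -> rnorm (phi x) <= M * hn x.

Let DZ a x : D x -> D (a *: x).
Proof. by move=> dx; rewrite -[_ *: _]addr0; exact: DP. Qed.
Let DD x y : D x -> D y -> D (x + y).
Proof. by move=> dx dy; rewrite -[x]scale1r; exact: DP. Qed.
Let phi0 : phi 0 = 0.
Proof.
have := phiP 1 D0 D0; rewrite scale1r addr0 mul1r.
by rewrite -{1}[phi 0]addr0 => /addrI <-.
Qed.
Let phiZ a x : D x -> phi (a *: x) = a * phi x.
Proof. by move=> dx; rewrite -[_ *: _]addr0 phiP// phi0 addr0. Qed.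
Let phiD x y : D x -> D y -> phi (x + y) = phi x + phi y.
Proof. by move=> dx dy; rewrite -{1}[x]scale1r phiP// mul1r. Qed.

(** If [y] represents [phi], then [J x] is the squared distance from [x] to [y] minus [hn y ^+ 2],
    so minimizing [J] means approaching [y]. *)
Let J x := hn x ^+ 2 - 2 * complex.Re (phi x).
Let E := [set J x | x in D].

Let J_ge x : D x -> - M ^+ 2 <= J x.
Proof.
move=> dx; have := le_trans (ler_norm _) (le_trans (Re_le_rnorm _) (phiM dx)).
rewrite /J; move: (hn x) (complex.Re _) => a b; have := sqr_ge0 (a - M); nra.
Qed.

Let infE : has_inf E.
Proof.
split; first by exists (J 0), 0.
by exists (- M ^+ 2) => _ [x dx <-]; exact: J_ge.
Qed.

Let le_inf x : D x -> inf E <= J x.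
Proof. by move=> dx; apply: ge_inf; [case: infE|exists x]. Qed.

Let half : C := (2^-1 : R)%:C%C.

(** The parallelogram identity, combined with the fact that the midpoint of [x] and [y] lies in [D],
    so that [J] is at least [inf E] there. *)
Let dist_min x y : D x -> D y -> hn (x - y) ^+ 2 <= 2 * (J x - inf E) + 2 * (J y - inf E).
Proof.
move=> dx dy; have [cx cy] := (Dcar dx, Dcar dy).
have := le_inf (DZ half (DD dx dy)); rewrite /J (hnormZ pS _ (carD pS cx cy)).
rewrite (phiZ _ (DD dx dy)) phiD// rnorm_real ger0_norm ?invr_ge0//.
have -> : complex.Re (half * (phi x + phi y)) =
    2^-1 * (complex.Re (phi x) + complex.Re (phi y)).
  by case: (phi x) (phi y) => [a b] [a' b'] /=; ring.
have := hnorm2_lin pS 1 cx cy; have := hnorm2_lin pS (-1) cx cy.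
rewrite scale1r scaleN1r rnormN rmorphN /= !conjC1 mul1r mulN1r.
have -> : rnorm (1 : C) = 1 by have := rnorm_real (1 : R); rewrite normr1.
have -> : complex.Re (- ip x y) = - complex.Re (ip x y) by case: (ip x y).
rewrite exprMn; move: (inf E) (complex.Re _) (complex.Re _) (complex.Re _).
by move=> a b c e -> ->; lra.
Qed.

(* The representing vector is the limit of a minimizing sequence of [J]; the
   parallelogram identity makes this sequence Cauchy. *)
Lemma riesz_on_subspace :
  exists y, [/\ car y, (forall x, D x -> phi x = ip x y) & hn y <= M].
Proof.
have /choice [u hu] : forall n : nat, exists x, D x /\ J x < inf E + n.+1%:R^-1.
  move=> n; have n0 : 0 < n.+1%:R^-1 :> R by rewrite invr_gt0.
  by have [_ [x dx <-] hx] := inf_adherent n0 infE; exists x.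
have du n : D (u n) by case: (hu n).
have cu n : car (u n) by exact: Dcar.
have Ju n : J (u n) < inf E + n.+1%:R^-1 by case: (hu n).
have inv0 : (fun n => n.+1%:R^-1 : R) @ \oo --> (0 : R) := @cvg_harmonic R.
have [y cy uy] : exists2 y, car y & hcvg S u y.
  apply: (hilbert_complete hS) => // e e0.
  have e4 : 0 < e ^+ 2 / 4 by rewrite divr_gt0// exprn_gt0.
  have /cvgrPdist_lt /(_ _ e4) [N _ hN] := inv0; exists N => m n Nm Nn.
  rewrite -(@ltr_pXn2r _ 2)// ?nnegrE ?(ltW e0) ?hnorm_ge0//.
  apply: le_lt_trans (dist_min (du m) (du n)) _.
  have := hN m Nm; have := hN n Nn; rewrite /= !sub0r !normrN !ger0_norm ?invr_ge0//.
  have := Ju m; have := Ju n.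
  by move: (n.+1%:R^-1) (m.+1%:R^-1) (J _) (J _) (inf E) => *; lra.
exists y; have reE v : D v -> complex.Re (phi v) = complex.Re (ip y v).
  move=> dv; have cv := Dcar dv.
  set r := complex.Re (ip y v) - complex.Re (phi v).
  (* First variation: [J] at [u n] plus [s] times [v] is at least [inf E]. In the limit, a quadratic
     in the real [s] without constant term is nonnegative, which forces its linear coefficient, and
     so [r], to vanish. The test value of [s] has [hn v ^+ 2 + 1] as denominator to cover
     [hn v = 0]. *)
  suff key (s : R) : 0 <= 2 * s * r + s ^+ 2 * hn v ^+ 2.
    suff : r = 0 by move/eqP; rewrite subr_eq0 => /eqP.
    have q0 : 0 < hn v ^+ 2 + 1 by rewrite ltr_wpDl// sqr_ge0.
    have := key (- r / (hn v ^+ 2 + 1)); rewrite -(@pmulr_rge0 _ ((hn v ^+ 2 + 1) ^+ 2)) ?exprn_gt0//.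
    have -> : (hn v ^+ 2 + 1) ^+ 2 *
      (2 * (- r / (hn v ^+ 2 + 1)) * r + (- r / (hn v ^+ 2 + 1)) ^+ 2 * hn v ^+ 2) =
      - (r ^+ 2 * (hn v ^+ 2 + 2)) by field; rewrite gt_eqF.
    rewrite oppr_ge0 pmulr_lle0; last by rewrite ltr_wpDl// sqr_ge0.
    by move=> r2; apply/eqP; rewrite -sqrf_eq0 eq_le r2 sqr_ge0.
  have hc : (fun n => n.+1%:R^-1 + 2 * s * (complex.Re (ip (u n) v) - complex.Re (phi v))
      + s ^+ 2 * hn v ^+ 2) @ \oo --> 0 + 2 * s * r + s ^+ 2 * hn v ^+ 2.
    apply: cvgD; last exact: cvg_cst.
    apply: cvgD; first exact: inv0.
    apply: cvgMr; apply: cvgB; last exact: cvg_cst.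
    by have /cvg_complexP[] := hcvg_ip pS cu cy cv uy.
  rewrite -[2 * s * r]add0r; apply: (cvg_ge hc) => n.
  have := le_inf (DP s%:C%C dv (du n)); rewrite addrC /J (hnorm2_lin pS _ (cu n) cv).
  rewrite addrC phiP//= rnorm_real real_normK ?num_real//.
  have -> : complex.Re ((s%:C%C)^* * ip (u n) v) = s * complex.Re (ip (u n) v).
    by rewrite conjCE; case: (ip (u n) v) => a b /=; ring.
  have -> : complex.Re (s%:C%C * phi v + phi (u n)) =
      s * complex.Re (phi v) + complex.Re (phi (u n)).
    by case: (phi v) (phi (u n)) => [a b] [a' b'] /=; ring.
  have := Ju n; rewrite /J.
  move: (n.+1%:R^-1) (inf E) (complex.Re _) (complex.Re _) (complex.Re _) => ? ? ? ? ?.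
  by lra.
(* The identity of real parts, tested on [v] multiplied by the imaginary unit, yields the imaginary
   parts. *)
have phiE v : D v -> phi v = ip v y.
  move=> dv; have cv := Dcar dv; rewrite (ipC pS cy cv) conjCE.
  have := reE _ dv; have := reE _ (DZ 'i%C dv); rewrite phiZ// (ipZr pS _ cv cy) conjCE.
  case: (phi v) (ip y v) => a b [a' b'] /=.
  by rewrite !mul0r !sub0r !mul1r => h1 h2; congr Complex; lra.
(* The vector [y] is only a limit of points of [D], so the bound on [phi] is used along [u] and
   passed to the limit. *)
split=> //; have : hn y ^+ 2 <= M * hn y.
  have h1 : (fun n => M * hn (u n) - complex.Re (ip (u n) y)) @ \oo -->
      M * hn y - complex.Re (ip y y).
    apply: cvgB; first by apply: cvgMr; exact: (hcvg_hnorm pS).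
    by have /cvg_complexP[] := hcvg_ip pS cu cy cy uy.
  rewrite (hnorm2 pS cy) -subr_ge0; apply: (cvg_ge h1) => n.
  rewrite subr_ge0 -phiE//.
  exact: le_trans (ler_norm _) (le_trans (Re_le_rnorm _) (phiM (du n))).
have := hnorm_ge0 S y; rewrite le_eqVlt => /predU1P[<-//|y0].
by rewrite expr2 ler_pM2r.
Qed.

End Riesz.

Section RkhsUnique.
Variable R : realType.
Local Notation C := R[i].
Variables (X : Type) (K : X -> X -> C).

Let kspan (v : X -> C) := exists s : seq (C * X), v = \sum_(p <- s) p.1 *: (fun z => K z p.2).

Let kspan0 : kspan 0.
Proof. by exists [::]; rewrite big_nil. Qed.

Let kspanP (a : C) x y : kspan x -> kspan y -> kspan (a *: x + y).
Proof.
move=> [s ->] [t ->]; exists ([seq (a * p.1, p.2) | p <- s] ++ t).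
rewrite big_cat big_map /= scaler_sumr; congr (_ + _).
by apply: eq_bigr => p _; rewrite scalerA.
Qed.

Let kspan_car S : is_rkhs K S -> kspan `<=` carrier S.
Proof.
move=> rS _ [s ->]; have pS := hilbert_pre (rkhs_hilbert rS).
apply: (car_sum pS) => p _; apply: (carZ pS); exact: rkhs_kernel.
Qed.

Let kspan_ip S v s : is_rkhs K S -> carrier S v ->
  ip S v (\sum_(p <- s) p.1 *: (fun z => K z p.2)) = \sum_(p <- s) p.1^* * v p.2.
Proof.
move=> rS cv; have pS := hilbert_pre (rkhs_hilbert rS).
rewrite (ip_sumr pS)//; last by move=> p _; apply: (carZ pS); exact: rkhs_kernel.
apply: eq_bigr => p _; rewrite (ipZr pS)//; last exact: rkhs_kernel.
by rewrite -(rkhs_reproducing rS).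
Qed.

(* Riesz representation in [S2] of v |-> <v, g> computed in [S1], on the span
   of the kernel functions, where the two inner products agree. *)
Lemma rkhs_sub S1 S2 g : is_rkhs K S1 -> is_rkhs K S2 -> carrier S1 g ->
  carrier S2 g /\ hnorm S2 g <= hnorm S1 g.
Proof.
move=> r1 r2 cg.
have p1 := hilbert_pre (rkhs_hilbert r1); have p2 := hilbert_pre (rkhs_hilbert r2).
have c1 := kspan_car r1; have c2 := kspan_car r2.
have n12 v : kspan v -> hnorm S1 v = hnorm S2 v.
  move=> kv; have [s vE] := kv; have cv1 := c1 _ kv; have cv2 := c2 _ kv.
  by rewrite /hnorm {2}vE (kspan_ip _ r1)// {3}vE (kspan_ip _ r2).
have [||x kx|y [cy hy yM]] := @riesz_on_subspace R _ S2 (rkhs_hilbert r2) kspan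
    (fun v => ip S1 v g) (hnorm S1 g) kspan0 kspanP c2.
- by move=> a x y kx ky; rewrite (pre_linearl p1)//; exact: c1.
- exact: hnorm_ge0.
- by rewrite mulrC -n12//; apply: (ip_cauchy p1) => //; exact: c1.
suff gy : g = y by split; [rewrite gy|rewrite {1}gy].
apply/funext => w; rewrite (rkhs_reproducing r1)// (rkhs_reproducing r2)//.
have kw : kspan (fun z => K z w).
  by exists [:: (1, w)]; rewrite big_seq1 scale1r.
have ck1 := rkhs_kernel r1 w; have ck2 := rkhs_kernel r2 w.
by rewrite (ipC p1 ck1 cg) hy// -(ipC p2 ck2 cy).
Qed.

Lemma rkhs_carrier_unique S1 S2 : is_rkhs K S1 -> is_rkhs K S2 ->
  carrier S1 = carrier S2.
Proof.
by move=> r1 r2; apply/seteqP; split=> g cg; [have [] := rkhs_sub r1 r2 cg|have [] := rkhs_sub r2 r1 cg].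
Qed.

Lemma rkhs_ip_unique S1 S2 g k : is_rkhs K S1 -> is_rkhs K S2 ->
  carrier S1 g -> carrier S1 k -> ip S1 g k = ip S2 g k.
Proof.
move=> r1 r2 cg ck; have p1 := hilbert_pre (rkhs_hilbert r1).
have p2 := hilbert_pre (rkhs_hilbert r2).
have n12 u : carrier S1 u -> hnorm S1 u = hnorm S2 u.
  move=> cu; have [cu2 h] := rkhs_sub r1 r2 cu.
  by apply/eqP; rewrite eq_le h andbT; have [] := rkhs_sub r2 r1 cu2.
rewrite (ip_polar p1)// (ip_polar p2) -?(rkhs_carrier_unique r1 r2)//.
by rewrite -(n12 _ cg) -(n12 _ ck) -(n12 _ (carD p1 cg ck))
  -(n12 _ (carD p1 cg (carZ p1 _ ck))).
Qed.

End RkhsUnique.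

(** * Rotation invariance of the planar Lebesgue measure *)

Section PlaneLebesgue.
Variable R : realType.
Local Notation leb := (@lebesgue_measure R).
Local Notation RT := (measurableTypeR R).
Local Notation plane := (RT * RT)%type.
Local Notation leb2 := (leb \x leb)%E.

Lemma lebesgue_shift (a : R) (A : set RT) : measurable A ->
  leb ((fun x : RT => x + a : RT) @^-1` A) = leb A.
Proof.
have mf : measurable_fun setT (fun x : RT => x + a : RT) by exact: measurable_funD.
pose f : {mfun RT >-> RT} := HB.pack (fun x : RT => x + a : RT) (isMeasurableFun.Build _ _ _ _ _ mf).
move=> mA; have := @lebesgue_measure_unique R (pushforward leb f) _ A mA => -> //.
move=> _ [[b c]] _ <-; change (leb `]b, c]%classic = leb ((fun x : RT => x + a : RT) @^-1` `]b, c]%classic)).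
rewrite (_ : _ @^-1` _ = `]b - a, c - a]%classic); last first.
  by apply/seteqP; split=> x /=; rewrite !in_itv /=; lra.
rewrite !lebesgue_measure_itv /= !lte_fin ltrD2r; case: ifP => // _.
by rewrite -!EFinB; congr EFin; ring.
Qed.

Definition shearR (t : R) (z : plane) : plane := (z.1, z.2 + t * z.1).
Definition shearL (t : R) (z : plane) : plane := (z.1 + t * z.2, z.2).

Lemma measurable_shearR t : measurable_fun setT (shearR t).
Proof.
apply/measurable_fun_pair => //=.
by apply: measurable_funD => //; exact: measurable_funM.
Qed.

Lemma measurable_shearL t : measurable_fun setT (shearL t).
Proof.
apply/measurable_fun_pair => //=.
by apply: measurable_funD => //; exact: measurable_funM.
Qed.

(** Each section of the sheared set at a fixed first coordinate is a translate of the section of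
    [A], so translation invariance on the line can be integrated. *)
Lemma leb2_shearR t (A : set plane) : measurable A -> leb2 (shearR t @^-1` A) = leb2 A.
Proof.
move=> mA; rewrite /product_measure1; apply: eq_integral => x _ /=.
rewrite -(lebesgue_shift (t * x) (measurable_xsection x mA)).
by rewrite !xsectionE.
Qed.

Lemma leb2_swap (A : set plane) : measurable A -> leb2 A = (leb \x^ leb)%E A.
Proof.
by move=> mA; apply: product_measure_unique => //= *; rewrite product_measure2E.
Qed.

(** Here the translated sections are those at a fixed second coordinate, hence the exchange of the
    order of integration. *)
Lemma leb2_shearL t (A : set plane) : measurable A -> leb2 (shearL t @^-1` A) = leb2 A.
Proof.
move=> mA; rewrite !leb2_swap//; last first.
  by rewrite -[X in measurable X]setTI; exact: measurable_shearL.
rewrite /product_measure2; apply: eq_integral => x _ /=.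
rewrite -(lebesgue_shift (t * x) (measurable_ysection x mA)).
by rewrite !ysectionE.
Qed.

(* The rotation by the argument of (3 + 4i) / 5, which is not a root of unity. *)
Definition plane_rot (z : plane) : plane :=
  (3 / 5 * z.1 - 4 / 5 * z.2, 4 / 5 * z.1 + 3 / 5 * z.2).

(** The usual factorization of the rotation by an angle u, with outer parameter - tan (u / 2) and
    inner parameter sin u; here sin u = 4 / 5, cos u = 3 / 5 and tan (u / 2) = sin u / (1 + cos u) =
    1 / 2. *)
Lemma rot_shear : plane_rot = shearL (- 2^-1) \o shearR (4 / 5) \o shearL (- 2^-1).
Proof.
by apply/funext => -[x y]; rewrite /plane_rot /shearL /shearR /=; congr pair; field.
Qed.

Lemma measurable_rot : measurable_fun setT plane_rot.
Proof.
rewrite rot_shear; apply: measurableT_comp; last exact: measurable_shearL.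
by apply: measurableT_comp; [exact: measurable_shearL|exact: measurable_shearR].
Qed.

Lemma leb2_rot (A : set plane) : measurable A -> leb2 (plane_rot @^-1` A) = leb2 A.
Proof.
move=> mA; rewrite rot_shear !comp_preimage leb2_shearL ?leb2_shearR ?leb2_shearL//.
  by rewrite -[X in measurable X]setTI; exact: measurable_shearL.
rewrite -[X in measurable X]setTI; apply: measurable_shearR => //.
by rewrite -[X in measurable X]setTI; exact: measurable_shearL.
Qed.

Lemma integral_rot (f : plane -> \bar R) : measurable_fun setT f ->
  (\int[leb2]_z f (plane_rot z) = \int[leb2]_z f z)%E.
Proof.
have key (g : plane -> \bar R) : measurable_fun setT g -> (forall z, 0 <= g z)%E ->
    (\int[leb2]_z g (plane_rot z) = \int[leb2]_z g z)%E.
  move=> mg g0.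
  pose r : {mfun plane >-> plane} := HB.pack plane_rot
    (isMeasurableFun.Build _ _ _ _ _ measurable_rot).
  transitivity (\int[pushforward leb2 r]_(z in setT) g z)%E.
    by apply/esym; exact: (@ge0_integral_pushforward _ _ _ _ R plane_rot measurable_rot leb2 setT g).
  apply: eq_measure_integral => //= A mA _.
  by rewrite -leb2_rot.
move=> mf; rewrite integralE [RHS]integralE; congr (_ - _)%E.
  rewrite -(key _ (measurable_funepos mf))//; apply: eq_integral => z _.
  by rewrite (funepos_comp f plane_rot).
rewrite -(key _ (measurable_funeneg mf))//; apply: eq_integral => z _.
by rewrite (funeneg_comp f plane_rot).
Qed.

End PlaneLebesgue.

(** * Integration of complex functions *)

Section ComplexMeasurable.
Variables (R : realType) (d : measure_display) (T : measurableType d).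
Local Notation C := R[i].

(** Measurability by real and imaginary parts, in step with the componentwise integral of [fock_ip]
    and [cint]. *)
Definition mcomplex (f : T -> C) :=
  measurable_fun setT (fun t => complex.Re (f t)) /\
  measurable_fun setT (fun t => complex.Im (f t)).

Lemma mcomplex_cst (c : C) : mcomplex (fun=> c).
Proof. by split; exact: measurable_cst. Qed.

Lemma mcomplexD f g : mcomplex f -> mcomplex g -> mcomplex (fun t => f t + g t).
Proof.
move=> [f1 f2] [g1 g2]; split.
  by under eq_fun do rewrite Re_add; exact: measurable_funD.
by under eq_fun do rewrite Im_add; exact: measurable_funD.
Qed.

Lemma Re_mul (x y : C) : complex.Re (x * y) =
  complex.Re x * complex.Re y - complex.Im x * complex.Im y.
Proof. by case: x y => [? ?] []. Qed.

Lemma Im_mul (x y : C) : complex.Im (x * y) =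
  complex.Re x * complex.Im y + complex.Im x * complex.Re y.
Proof. by case: x y => [? ?] []. Qed.

Lemma mcomplexM f g : mcomplex f -> mcomplex g -> mcomplex (fun t => f t * g t).
Proof.
move=> [f1 f2] [g1 g2]; split.
  under eq_fun do rewrite Re_mul.
  by apply: measurable_funB; exact: measurable_funM.
under eq_fun do rewrite Im_mul.
by apply: measurable_funD; exact: measurable_funM.
Qed.

Lemma mcomplex_conj f : mcomplex f -> mcomplex (fun t => (f t)^*).
Proof.
move=> [f1 f2]; split; under eq_fun do rewrite conjCE /=; first exact: f1.
exact: measurable_funN.
Qed.

Lemma mcomplex_real (f : T -> R) : measurable_fun setT f ->
  mcomplex (fun t => (f t)%:C%C).
Proof. by move=> mf; split => //=; exact: measurable_cst. Qed.

Lemma mcomplexX f n : mcomplex f -> mcomplex (fun t => f t ^+ n).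
Proof.
move=> mf; elim: n => [|n ih]; first exact: mcomplex_cst.
by under eq_fun do rewrite exprS; exact: mcomplexM.
Qed.

Lemma mcomplex_sum (I : Type) (s : seq I) (f : I -> T -> C) :
  (forall i, mcomplex (f i)) -> mcomplex (fun t => \sum_(i <- s) f i t).
Proof.
move=> mf; elim: s => [|i s ih].
  by under eq_fun do rewrite big_nil; exact: mcomplex_cst.
by under eq_fun do rewrite big_cons; exact: mcomplexD.
Qed.

Lemma mcomplex_prod (I : Type) (s : seq I) (f : I -> T -> C) :
  (forall i, mcomplex (f i)) -> mcomplex (fun t => \prod_(i <- s) f i t).
Proof.
move=> mf; elim: s => [|i s ih].
  by under eq_fun do rewrite big_nil; exact: mcomplex_cst.
by under eq_fun do rewrite big_cons; exact: mcomplexM.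
Qed.

Lemma mcomplex_lim (f : nat -> T -> C) (g : T -> C) : (forall n, mcomplex (f n)) ->
  (forall t, (fun n => f n t) @ \oo --> g t) -> mcomplex g.
Proof.
move=> mf fg; split.
  apply: (@measurable_fun_cvg _ _ _ setT (fun n t => complex.Re (f n t))) => [n|t _].
    by case: (mf n).
  by have /cvg_complexP[] := fg t.
apply: (@measurable_fun_cvg _ _ _ setT (fun n t => complex.Im (f n t))) => [n|t _].
  by case: (mf n).
by have /cvg_complexP[] := fg t.
Qed.

Lemma measurable_rnorm f : mcomplex f -> measurable_fun setT (fun t => rnorm (f t)).
Proof.
move=> [f1 f2]; under eq_fun do rewrite rnormCE.
apply: measurableT_comp; first exact: (continuous_measurable_fun (@sqrt_continuous R)).
by apply: measurable_funD; apply: measurable_funX.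
Qed.

Variable m : {measure set T -> \bar R}.

Definition cint (f : T -> C) : C :=
  (fine (\int[m]_t (complex.Re (f t))%:E) +i* fine (\int[m]_t (complex.Im (f t))%:E))%C.

Definition rintegrable (f : T -> R) := m.-integrable setT (fun t => (f t)%:E).

Definition cintegrable (f : T -> C) :=
  rintegrable (fun t => complex.Re (f t)) /\ rintegrable (fun t => complex.Im (f t)).

Lemma rintegrable_le (f g : T -> R) : measurable_fun setT f -> rintegrable g ->
  (forall t, `|f t| <= g t) -> rintegrable f.
Proof.
move=> mf ig fg; apply: (le_integrable measurableT _ _ ig).
  exact/measurable_EFinP.
by move=> t _; rewrite !abse_EFin lee_fin (le_trans (fg t))// ler_norm.
Qed.

Lemma rintegrableD f g : rintegrable f -> rintegrable g -> rintegrable (fun t => f t + g t).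
Proof.
by move=> hf hg; have := integrableD measurableT hf hg; rewrite /rintegrable; under eq_fun do rewrite -EFinD.
Qed.

Lemma rintegrableZ k f : rintegrable f -> rintegrable (fun t => k * f t).
Proof. by move=> hf; have := integrableZl measurableT k hf. Qed.

Lemma rintegrable_abs f : rintegrable f -> rintegrable (fun t => `|f t|).
Proof. by move=> hf; have := integrable_abse hf. Qed.

Lemma cintegrable_mcomplex f : cintegrable f -> mcomplex f.
Proof.
by move=> [/measurable_int h1 /measurable_int h2]; split; apply/measurable_EFinP.
Qed.

Lemma cintegrable_le f g : mcomplex f -> rintegrable g ->
  (forall t, rnorm (f t) <= g t) -> cintegrable f.
Proof.
move=> [f1 f2] ig fg; split; apply: rintegrable_le ig _ => // t.
  exact: le_trans (Re_le_rnorm _) (fg t).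
exact: le_trans (Im_le_rnorm _) (fg t).
Qed.

Lemma cintegrable_rnorm f : cintegrable f -> rintegrable (fun t => rnorm (f t)).
Proof.
move=> hf; have mf := cintegrable_mcomplex hf; case: hf => h1 h2.
apply: (rintegrable_le (measurable_rnorm mf) (rintegrableD (rintegrable_abs h1) (rintegrable_abs h2))).
by move=> t; rewrite ger0_norm ?rnorm_ge0// rnorm_le_ReIm.
Qed.

Lemma rint_lin (k : R) (f g : T -> R) : rintegrable f -> rintegrable g ->
  fine (\int[m]_t (k * f t + g t)%:E) =
  k * fine (\int[m]_t (f t)%:E) + fine (\int[m]_t (g t)%:E).
Proof.
move=> hf hg; under eq_integral do rewrite EFinD EFinM.
rewrite integralD//; last exact: (rintegrableZ k hf).
rewrite integralZl// fineD; [by rewrite fineM//; exact: integrable_fin_num| |exact: integrable_fin_num].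
by rewrite fin_numM//; exact: integrable_fin_num.
Qed.

Lemma cintegrable_lin a f g : cintegrable f -> cintegrable g ->
  cintegrable (fun t => a * f t + g t).
Proof.
move=> hf hg; have [mf mg] := (cintegrable_mcomplex hf, cintegrable_mcomplex hg).
apply: (@cintegrable_le _ (fun t => rnorm a * rnorm (f t) + rnorm (g t))).
- by apply: mcomplexD => //; apply: mcomplexM => //; exact: mcomplex_cst.
- by apply: rintegrableD; [apply: rintegrableZ|]; exact: cintegrable_rnorm.
- by move=> t; rewrite -rnormCM; exact: rnormD.
Qed.

Lemma cint_lin a f g : cintegrable f -> cintegrable g ->
  cint (fun t => a * f t + g t) = a * cint f + cint g.
Proof.
move=> [f1 f2] [g1 g2]; case: a => a b; rewrite /cint /=.
have -> : (fun t => (complex.Re ((a +i* b)%C * f t + g t))%:E) =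
    (fun t => (a * complex.Re (f t) + (- b * complex.Im (f t) + complex.Re (g t)))%:E).
  by apply/funext => t; rewrite Re_add Re_mul /=; congr EFin; ring.
have -> : (fun t => (complex.Im ((a +i* b)%C * f t + g t))%:E) =
    (fun t => (a * complex.Im (f t) + (b * complex.Re (f t) + complex.Im (g t)))%:E).
  by apply/funext => t; rewrite Im_add Im_mul /=; congr EFin; ring.
rewrite !rint_lin//; try by apply: rintegrableD => //; exact: rintegrableZ.
by congr Complex; ring.
Qed.

Lemma cint0 : cint (fun=> 0) = 0.
Proof. by rewrite /cint /= !integral0. Qed.

Lemma cintegrable0 : cintegrable (fun=> 0).
Proof. by split; exact: integrable0. Qed.

Lemma cintegrableZ a f : cintegrable f -> cintegrable (fun t => a * f t).
Proof.
move=> hf; have := cintegrable_lin a hf cintegrable0.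
by under eq_fun do rewrite addr0.
Qed.

Lemma cintZ a f : cintegrable f -> cint (fun t => a * f t) = a * cint f.
Proof.
move=> hf; have := cint_lin a hf cintegrable0.
by rewrite cint0 addr0; under eq_fun do rewrite addr0.
Qed.

Lemma cintegrable_sum (I : Type) (s : seq I) (f : I -> T -> C) :
  (forall i, cintegrable (f i)) -> cintegrable (fun t => \sum_(i <- s) f i t).
Proof.
move=> hf; elim: s => [|i s ih].
  by under eq_fun do rewrite big_nil; exact: cintegrable0.
under eq_fun do rewrite big_cons -[f i _]mul1r.
exact: cintegrable_lin.
Qed.

Lemma cint_sum (I : Type) (s : seq I) (f : I -> T -> C) :
  (forall i, cintegrable (f i)) ->
  cint (fun t => \sum_(i <- s) f i t) = \sum_(i <- s) cint (f i).
Proof.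
move=> hf; elim: s => [|i s ih].
  by under eq_fun do rewrite big_nil; rewrite big_nil cint0.
under eq_fun do rewrite big_cons -[f i _]mul1r.
by rewrite cint_lin ?mul1r ?ih ?big_cons//; exact: cintegrable_sum.
Qed.

Lemma cint_dct (f : nat -> T -> C) (f' : T -> C) (g : T -> R) :
  (forall n, mcomplex (f n)) -> (forall t, (fun n => f n t) @ \oo --> f' t) ->
  rintegrable g -> (forall n t, rnorm (f n t) <= g t) ->
  cintegrable f' /\ (fun n => cint (f n)) @ \oo --> cint f'.
Proof.
move=> mf ff ig fg.
have key (P : C -> R) : (forall z, `|P z| <= rnorm z) ->
    (forall n, measurable_fun setT (fun t => P (f n t))) ->
    (forall t, (fun n => P (f n t)) @ \oo --> P (f' t)) ->
    rintegrable (fun t => P (f' t)) /\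
    (fun n => fine (\int[m]_t (P (f n t))%:E)) @ \oo --> fine (\int[m]_t (P (f' t))%:E).
  move=> Pr mP cP.
  have mP' : measurable_fun setT (fun t => P (f' t)).
    by apply: (@measurable_fun_cvg _ _ _ setT (fun n t => P (f n t))) => // t _; exact: cP.
  have [||||h1 _ h3] := @dominated_convergence _ T R m setT measurableT
      (fun n t => (P (f n t))%:E) (fun t => (P (f' t))%:E) (fun t => (g t)%:E) _ _ _ ig.
  - by move=> n; apply/measurable_EFinP.
  - by apply/measurable_EFinP.
  - by apply: aeW => t _; apply: cvg_EFin; [exact: nearW|exact: cP].
  - by apply: aeW => t n _; rewrite abse_EFin lee_fin; exact: le_trans (fg n t).
  by split=> //; apply: fine_cvg; rewrite fineK//; exact: integrable_fin_num.
have [r1 r2] := key _ (@Re_le_rnorm R) (fun n => (mf n).1)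
  (fun t => ((cvg_complexP _ _).1 (ff t)).1).
have [i1 i2] := key _ (@Im_le_rnorm R) (fun n => (mf n).2)
  (fun t => ((cvg_complexP _ _).1 (ff t)).2).
by split=> //; apply/cvg_complexP; split.
Qed.

End ComplexMeasurable.

(** * Sigma-finiteness of the Lebesgue measure on C^d *)

Section SigmaFinitePushforward.
Variables (d1 d2 : measure_display) (X : measurableType d1) (Y : measurableType d2).
Variable R : realType.

(** The preimages under the left inverse [g] of a covering of [X] are measurable and cover [Y];
    pulled back along [f] they give the original sets again, of finite measure. *)
Lemma sigma_finite_pushforward (m : {sigma_finite_measure set X -> \bar R})
    (f : X -> Y) (g : Y -> X) : measurable_fun setT g -> cancel f g ->
  sigma_finite setT (pushforward m f).
Proof.
move=> mg fg; have [F TF Foo] := sigma_finiteT m.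
exists (fun n => g @^-1` F n); first by rewrite -preimage_bigcup -TF preimage_setT.
move=> n; have [mF F_fin] := Foo n; split.
  by rewrite -[X in measurable X]setTI; exact: mg.
rewrite /pushforward (_ : f @^-1` _ = F n)//.
by apply/seteqP; split => x /=; rewrite fg.
Qed.

End SigmaFinitePushforward.

Section SigmaFiniteProduct.
Variables (d1 d2 : measure_display) (X : measurableType d1) (Y : measurableType d2).
Variable R : realType.
Variables (m1 : {sigma_finite_measure set X -> \bar R}).
Variables (m2 : {sigma_finite_measure set Y -> \bar R}).

Lemma sigma_finite_product : sigma_finite setT (m1 \x m2)%E.
Proof.
have /sigma_finiteP[F [TF ndF Foo]] := sigma_finiteT m1.
have /sigma_finiteP[G [TG ndG Goo]] := sigma_finiteT m2.
exists (fun n => F n `*` G n).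
  apply/esym/seteqP; split=> // -[x y] _.
  have [n _ Fx] : (\bigcup_i F i) x by rewrite -TF.
  have [k _ Gy] : (\bigcup_i G i) y by rewrite -TG.
  exists (maxn n k) => //; split => /=.
    by move: Fx; exact/subsetPset/ndF/leq_maxl.
  by move: Gy; exact/subsetPset/ndG/leq_maxr.
move=> n; have [mF finF] := Foo n; have [mG finG] := Goo n.
split; first exact: measurableX.
by rewrite product_measure1E// lte_mul_pinfty// ge0_fin_numE.
Qed.

Definition prod_sigma_finite : {sigma_finite_measure set (X * Y)%type -> \bar R} :=
  HB.pack (m1 \x m2)%E (Measure_isSigmaFinite.Build _ _ _ (m1 \x m2)%E sigma_finite_product).

End SigmaFiniteProduct.

Section LebesgueC.
Variable R : realType.
Local Notation leb := (@lebesgue_measure R).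
Local Notation RT := (measurableTypeR R).
Local Notation plane := (RT * RT)%type.
Local Notation leb2 := (leb \x leb)%E.
Local Notation C := R[i].

Definition tuple_cons (n : nat) (x : plane * n.-tuple plane) : n.+1.-tuple plane :=
  [tuple of x.1 :: x.2].
Definition tuple_uncons (n : nat) (p : n.+1.-tuple plane) : plane * n.-tuple plane :=
  (tnth p ord0, [tuple tnth p (lift ord0 i) | i < n]).

Lemma tuple_consK n : cancel (@tuple_cons n) (@tuple_uncons n).
Proof.
move=> [x t]; rewrite /tuple_uncons /=; congr pair.
by apply: eq_from_tnth => i; rewrite tnth_mktuple tnthS.
Qed.

Lemma measurable_tuple_cons n : measurable_fun setT (@tuple_cons n).
Proof. exact: measurable_cons. Qed.

Lemma measurable_tuple_uncons n : measurable_fun setT (@tuple_uncons n).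
Proof.
apply/measurable_fun_pair; first exact: measurable_tnth.
apply/measurable_fun_tnthP => i /=.
rewrite (_ : _ \o _ = fun p : n.+1.-tuple plane => tnth p (lift ord0 i)); last first.
  by apply/funext => p /=; rewrite tnth_mktuple.
exact: measurable_tnth.
Qed.

(** [lebesgueC] is a bare set function given by recursion, so a sigma-finite measure equal to it is
    built by induction. Rewriting with that equality later transfers each measure axiom to
    [lebesgueC] itself. *)
Lemma lebesgueC_sigma_finite n :
  exists m : {sigma_finite_measure set (n.-tuple plane) -> \bar R},
    @lebesgueC R n = m :> (set _ -> \bar R).
Proof.
elim: n => [|n [m mE]].
  by exists (dirac [tuple] : {sigma_finite_measure set _ -> \bar R}).
pose M := prod_sigma_finite (prod_sigma_finite leb leb) m.
pose P := measure_function_pushforward__canonical__measure_function_Measure M (@measurable_tuple_cons n).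
have sP : sigma_finite setT P.
  exact: (sigma_finite_pushforward M (@measurable_tuple_uncons n) (@tuple_consK n)).
pose mix := Measure_isSigmaFinite.Build _ _ _ P sP.
pose Q : {sigma_finite_measure set _ -> \bar R} := HB.pack (P : set _ -> \bar R) mix P.
by exists Q; rewrite /= mE.
Qed.

End LebesgueC.

(** * Integrals of products of functions of separate variables *)

Section CintProduct.
Variables (d1 d2 : measure_display) (X : measurableType d1) (Y : measurableType d2).
Variable R : realType.
Local Notation C := R[i].
Variables (m1 : {sigma_finite_measure set X -> \bar R}).
Variables (m2 : {sigma_finite_measure set Y -> \bar R}).
Local Notation m12 := (prod_sigma_finite m1 m2).

Lemma rint_prod (u : X -> R) (v : Y -> R) : rintegrable m1 u -> rintegrable m2 v ->
  rintegrable m12 (fun z => u z.1 * v z.2) /\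
  fine (\int[m12]_z (u z.1 * v z.2)%:E) =
  fine (\int[m1]_x (u x)%:E) * fine (\int[m2]_y (v y)%:E).
Proof.
move=> iu iv.
have mu : measurable_fun setT u by apply/measurable_EFinP; exact: measurable_int iu.
have mv : measurable_fun setT v by apply/measurable_EFinP; exact: measurable_int iv.
have iuv : rintegrable m12 (fun z => u z.1 * v z.2).
  apply/(@integrable12ltyP _ _ _ _ R m1 m2).
    apply/measurable_EFinP; apply: measurable_funM.
      by apply: measurableT_comp mu _.
    by apply: measurableT_comp mv _.
  under eq_integral => x _.
    under eq_integral => y _ do rewrite /= normrM EFinM.
    rewrite ge0_integralZl//; last by apply/measurable_EFinP; exact: measurableT_comp.
    over.
  have fv : (\int[m2]_y `|v y|%:E)%E \is a fin_num.
    by apply: integrable_fin_num => //; exact: rintegrable_abs.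
  rewrite ge0_integralZr//.
  - rewrite lte_mul_pinfty// ?integral_ge0//.
      by apply: integrable_fin_num => //; exact: rintegrable_abs.
    by rewrite ltey_eq fv.
  - by apply/measurable_EFinP; exact: measurableT_comp.
  - exact: integral_ge0.
split=> //; rewrite -(@integral12_prod_meas1 _ _ _ _ R m1 m2)//.
have fv : (\int[m2]_y (v y)%:E)%E \is a fin_num by exact: integrable_fin_num.
have fu : (\int[m1]_y (u y)%:E)%E \is a fin_num by exact: integrable_fin_num.
rewrite -fineM//; congr fine.
rewrite /fubini_F; under eq_integral => x _.
  under eq_integral => y _ do rewrite /= EFinM.
  rewrite integralZl//. over.
by rewrite -{1}(fineK fv) integralZr// fineK.
Qed.

Lemma cint_prod (f : X -> C) (g : Y -> C) : cintegrable m1 f -> cintegrable m2 g ->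
  cintegrable m12 (fun z => f z.1 * g z.2) /\
  cint m12 (fun z => f z.1 * g z.2) = cint m1 f * cint m2 g.
Proof.
move=> [f1 f2] [g1 g2].
have [i11 e11] := rint_prod f1 g1; have [i12 e12] := rint_prod f1 g2.
have [i21 e21] := rint_prod f2 g1; have [i22 e22] := rint_prod f2 g2.
have reE : (fun z => complex.Re (f z.1 * g z.2)) = (fun z =>
   -1 * (complex.Im (f z.1) * complex.Im (g z.2)) + complex.Re (f z.1) * complex.Re (g z.2)).
  by apply/funext => z; rewrite Re_mul; ring.
have imE : (fun z => complex.Im (f z.1 * g z.2)) = (fun z =>
   1 * (complex.Re (f z.1) * complex.Im (g z.2)) + complex.Im (f z.1) * complex.Re (g z.2)).
  by apply/funext => z; rewrite Im_mul; ring.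
split; first by split; rewrite ?reE ?imE; apply: rintegrableD => //; exact: rintegrableZ.
rewrite /cint.
have -> : (fun z => (complex.Re (f z.1 * g z.2))%:E) = EFin \o (fun z => complex.Re (f z.1 * g z.2)) by [].
have -> : (fun z => (complex.Im (f z.1 * g z.2))%:E) = EFin \o (fun z => complex.Im (f z.1 * g z.2)) by [].
rewrite reE imE /comp !rint_lin// e11 e12 e21 e22.
by apply/eqP; rewrite eq_complex /=; apply/andP; split; apply/eqP; ring.
Qed.

End CintProduct.

Section LebesgueCProduct.
Variable R : realType.
Local Notation leb := (@lebesgue_measure R).
Local Notation RT := (measurableTypeR R).
Local Notation plane := (RT * RT)%type.
Local Notation leb2 := (prod_sigma_finite leb leb).
Local Notation C := R[i].

Section Instance.
Variable n : nat.
Let lebesgueC0 : @lebesgueC R n set0 = 0%E.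
Proof. by have [m ->] := @lebesgueC_sigma_finite R n; exact: measure0. Qed.
Let lebesgueC_ge0 A : (0 <= @lebesgueC R n A)%E.
Proof. by have [m ->] := @lebesgueC_sigma_finite R n; exact: measure_ge0. Qed.
Let lebesgueC_sigma_additive : semi_sigma_additive (@lebesgueC R n).
Proof.
by have [m ->] := @lebesgueC_sigma_finite R n; exact: measure_semi_sigma_additive.
Qed.
HB.instance Definition _ := isMeasure.Build _ _ _ (@lebesgueC R n)
  lebesgueC0 lebesgueC_ge0 lebesgueC_sigma_additive.
Let lebesgueC_sfin : sigma_finite setT (@lebesgueC R n).
Proof. by have [m ->] := @lebesgueC_sigma_finite R n; exact: sigma_finiteT. Qed.
HB.instance Definition _ := Measure_isSigmaFinite.Build _ _ _ (@lebesgueC R n) lebesgueC_sfin.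
End Instance.

Lemma rint_lebesgueC0 (f : 0.-tuple plane -> R) :
  rintegrable (@lebesgueC R 0) f /\
  fine (\int[@lebesgueC R 0]_p (f p)%:E) = f [tuple].
Proof.
have mf : measurable_fun setT f.
  have -> : f = cst (f [tuple]) by apply/funext => p; rewrite /= (tuple0 p).
  exact: measurable_cst.
split; last by rewrite integral_dirac ?diracT ?mul1e//; exact/measurable_EFinP.
apply/integrableP; split; first exact/measurable_EFinP.
rewrite integral_dirac ?diracT ?mul1e ?ltry//.
by apply: measurableT_comp => //; exact/measurable_EFinP.
Qed.

Lemma rint_lebesgueCS n (f : n.+1.-tuple plane -> R) :
  measurable_fun setT f ->
  rintegrable (prod_sigma_finite leb2 (@lebesgueC R n)) (f \o @tuple_cons R n) ->
  rintegrable (@lebesgueC R n.+1) f /\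
  fine (\int[@lebesgueC R n.+1]_p (f p)%:E) =
  fine (\int[prod_sigma_finite leb2 (@lebesgueC R n)]_z (f (tuple_cons z))%:E).
Proof.
move=> mf hf; have mf' : measurable_fun setT (EFin \o f) by exact/measurable_EFinP.
have := @integrable_pushforward _ _ _ _ R _ (@measurable_tuple_cons R n)
  (prod_sigma_finite leb2 (@lebesgueC R n)) setT (EFin \o f) mf' hf measurableT.
have := @integral_pushforward _ _ _ _ R _ (@measurable_tuple_cons R n)
  (prod_sigma_finite leb2 (@lebesgueC R n)) setT (EFin \o f) mf' hf measurableT.
rewrite preimage_setT => h1 h2; split=> //.
by congr fine.
Qed.

(** Monomials, the Gaussian weight and its cut-offs are all products over the coordinates, so their
    integrals on C^d reduce to planar ones. *)
Lemma cint_lebesgueC_prod n (f : 'I_n -> plane -> C) :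
  (forall i, cintegrable leb2 (f i)) ->
  cintegrable (@lebesgueC R n) (fun p => \prod_(i < n) f i (tnth p i)) /\
  cint (@lebesgueC R n) (fun p => \prod_(i < n) f i (tnth p i)) = \prod_(i < n) cint leb2 (f i).
Proof.
elim: n f => [|n ih] f hf.
  have [i1 e1] := rint_lebesgueC0 (fun p => complex.Re (\prod_(i < 0) f i (tnth p i))).
  have [i2 e2] := rint_lebesgueC0 (fun p => complex.Im (\prod_(i < 0) f i (tnth p i))).
  by split=> //; rewrite /cint e1 e2 !big_ord0.
have [ic ec] := ih (fun i => f (lift ord0 i)) (fun i => hf _).
have [ip ep] := cint_prod (hf ord0) ic.
have fE (z : plane * n.-tuple plane) : \prod_(i < n.+1) f i (tnth (tuple_cons z) i) =
    f ord0 z.1 * \prod_(i < n) f (lift ord0 i) (tnth z.2 i).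
  by rewrite big_ord_recl; congr (_ * _); apply: eq_bigr => i _; rewrite tnthS.
have [m1 m2] : mcomplex (fun p : n.+1.-tuple plane => \prod_(i < n.+1) f i (tnth p i)).
  apply: mcomplex_prod => i; have [h1 h2] := cintegrable_mcomplex (hf i).
  by split; [apply: measurableT_comp h1 _|apply: measurableT_comp h2 _]; exact: measurable_tnth.
have [|i1 e1] := rint_lebesgueCS m1.
  by move: ip.1; congr rintegrable; apply/funext => z; rewrite /= fE.
have [|i2 e2] := rint_lebesgueCS m2.
  by move: ip.2; congr rintegrable; apply/funext => z; rewrite /= fE.
split=> //; rewrite big_ord_recl -ec -ep /cint e1 e2.
by congr Complex; congr fine; apply: eq_integral => z _; rewrite fE.
Qed.

End LebesgueCProduct.

(** * Gaussian moments and orthogonality of monomials *)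

Lemma rint_le (R : realType) (d : measure_display) (T : measurableType d)
    (m : {measure set T -> \bar R}) (f g : T -> R) :
  rintegrable m f -> rintegrable m g -> (forall t, f t <= g t) ->
  fine (\int[m]_t (f t)%:E) <= fine (\int[m]_t (g t)%:E).
Proof. by move=> hf hg fg; exact: le_Rintegral. Qed.

Section GaussMoments.
Variable R : realType.
Local Notation leb := (@lebesgue_measure R).
Local Notation RT := (measurableTypeR R).
Local Notation plane := (RT * RT)%type.
Local Notation leb2 := (prod_sigma_finite leb leb).
Local Notation C := R[i].

Lemma gauss1 (t : R) : 0 < t ->
  rintegrable leb (fun x => expR (- t * x ^+ 2)) /\
  fine (\int[leb]_x (expR (- t * x ^+ 2))%:E) = Num.sqrt (pi / t).
Proof.
(* Up to its peak value, the integrand is the centred normal density of variance [(2 * t)^-1]. *)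
move=> t0; pose s := Num.sqrt (2 * t)^-1.
have t20 : 0 < (2 * t)^-1 by rewrite invr_gt0 mulr_gt0.
have s0 : s != 0 by rewrite gt_eqF// sqrtr_gt0.
have s2 : s ^+ 2 = (2 * t)^-1 by rewrite sqr_sqrtr// ltW.
have peakE : (normal_peak s)^-1 = Num.sqrt (pi / t).
  rewrite /normal_peak invrK s2; congr Num.sqrt; rewrite -mulr_natr; field.
  by rewrite gt_eqF.
have fE x : expR (- t * x ^+ 2) = (normal_peak s)^-1 * normal_pdf 0 s x.
  rewrite normal_pdfE// mulrA mulVf ?mul1r; last by rewrite gt_eqF// normal_peak_gt0.
  rewrite /normal_fun subr0 s2 -mulr_natr; congr expR; field.
  by rewrite gt_eqF.
have ip : rintegrable leb (normal_pdf 0 s) by exact: integrable_normal_pdf.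
have -> : (fun x => expR (- t * x ^+ 2)) = (fun x => (normal_peak s)^-1 * normal_pdf 0 s x).
  by apply/funext => x; exact: fE.
split; first exact: rintegrableZ.
under eq_integral do rewrite fE EFinM.
by rewrite integralZl// integral_normal_pdf mule1.
Qed.

Definition sqnorm (z : plane) : R := z.1 ^+ 2 + z.2 ^+ 2.

Lemma sqnorm_ge0 z : 0 <= sqnorm z.
Proof. by rewrite addr_ge0// sqr_ge0. Qed.

Lemma measurable_sqnorm : measurable_fun setT sqnorm.
Proof. by apply: measurable_funD; apply: measurable_funX. Qed.

Lemma gauss2 (t : R) : 0 < t ->
  rintegrable leb2 (fun z => expR (- t * sqnorm z)) /\
  fine (\int[leb2]_z (expR (- t * sqnorm z))%:E) = pi / t.
Proof.
move=> t0; have [i1 e1] := gauss1 t0.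
have -> : (fun z : plane => expR (- t * sqnorm z)) =
    (fun z : plane => expR (- t * z.1 ^+ 2) * expR (- t * z.2 ^+ 2)).
  by apply/funext => z; rewrite -expRD mulrDr.
have [i2 e2] := rint_prod i1 i1; split=> //.
under eq_integral => z _.
  rewrite /sqnorm mulrDr expRD. over.
by rewrite e2 e1 -expr2 sqr_sqrtr// divr_ge0 ?pi_ge0// ltW.
Qed.

Lemma exp_ge_pow (x : R) n : 0 <= x -> x ^+ n <= n`!%:R * expR x.
Proof.
move=> x0; case: n => [|n]; first by rewrite expr0 fact0 mul1r -expR0 ler_expR.
rewrite mulrC -ler_pdivrMr ?ltr0n ?fact_gt0//.
by apply: le_trans (expR_ge1Dxn n x0); rewrite lerDr.
Qed.

Lemma rintegrable_moment (t : R) n : 0 < t ->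
  rintegrable leb2 (fun z => sqnorm z ^+ n * expR (- t * sqnorm z)).
Proof.
move=> t0; have t20 : 0 < t / 2 by rewrite divr_gt0.
have [i _] := gauss2 t20.
(* Half of the exponent absorbs the power: x^n is at most n! exp x, taken at x = t / 2 times
   [sqnorm z]. *)
apply: rintegrable_le (rintegrableZ (n`!%:R / (t / 2) ^+ n) i) _.
  apply: measurable_funM; first by apply: measurable_funX; exact: measurable_sqnorm.
  apply: measurableT_comp; first exact: measurable_expR.
  by apply: measurable_funM => //; exact: measurable_sqnorm.
move=> z; have z0 := sqnorm_ge0 z.
rewrite ger0_norm; last by rewrite mulr_ge0 ?exprn_ge0 ?expR_ge0.
have -> : - t * sqnorm z = t / 2 * - sqnorm z + - (t / 2) * sqnorm z by field.
rewrite expRD mulrA ler_wpM2r ?expR_ge0//.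
rewrite mulrN expRN ler_pdivrMr ?expR_gt0// mulrAC ler_pdivlMr ?exprn_gt0//.
rewrite -exprMn mulrC; apply: exp_ge_pow; rewrite mulr_ge0//.
exact: ltW.
Qed.

Definition moment n t := fine (\int[leb2]_z (sqnorm z ^+ n * expR (- t * sqnorm z))%:E).

(** The tangent bound 1 - x <= exp (- x) at x = [h * sqnorm z], multiplied by the integrand of
    [moment n t] and integrated; [h] may be negative. *)
Lemma moment_convex n t h : 0 < t -> 0 < t + h ->
  moment n t <= moment n (t + h) + h * moment n.+1 t.
Proof.
move=> t0 th0; have i0 := rintegrable_moment n t0.
have i1 := rintegrable_moment n th0; have i2 := rintegrable_moment n.+1 t0.
rewrite addrC /moment -rint_lin//; apply: rint_le => //.
  by apply: rintegrableD => //; exact: rintegrableZ.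
move=> z; rewrite exprSr -[X in _ * X + _]mulrA mulrCA -mulrDr.
apply: ler_wpM2l; first by rewrite exprn_ge0 ?sqnorm_ge0.
have := expR_ge1Dx (- (h * sqnorm z)).
have -> : - (t + h) * sqnorm z = - (h * sqnorm z) + - t * sqnorm z by ring.
rewrite expRD; have := expR_ge0 (- t * sqnorm z).
move: (expR (- t * sqnorm z)) (expR (- (h * sqnorm z))) => a b a0; rewrite mulrA => hb; nra.
Qed.

(* By [moment_convex], s |-> moment n s + moment n.+1 t * s has a minimum at t,
   which gives moment n.+1 t as minus the derivative of [moment n]. *)
Lemma momentE n t : 0 < t -> moment n t = pi * n`!%:R * t^-1 ^+ n.+1.
Proof.
elim: n t => [|n ih] t t0.
  rewrite /moment fact0 mulr1 expr1 -(gauss2 t0).2.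
  by congr fine; apply: eq_integral => z _; rewrite expr0 mul1r.
set A := moment n.+1 t.
pose inv (s : R) : R := s^-1.
pose g : R -> R := (pi * n`!%:R : R) *: (inv ^+ n.+1) + A *: (id : R -> R).
have gE s : g s = pi * n`!%:R * s^-1 ^+ n.+1 + A * s.
  by rewrite /g [LHS]/= exprfctE.
have dg (s : R) : 0 < s -> is_derive s 1 g
    ((pi * n`!%:R) *: ((n.+1%:R * inv s ^+ n) *: (- s ^- 2 *: (1 : R))) + A *: (1 : R)).
  move=> s0; have sn0 : id s != 0 by rewrite gt_eqF.
  have dinv : is_derive s 1 inv (- s ^- 2 *: (1 : R)).
    exact: (@is_deriveV R id s 1 1).
  by apply: is_deriveD; apply: is_deriveZ; exact: (is_deriveX n.+1 dinv).
have t2 : t \in `]0, t * 2[ by rewrite in_itv /= t0 mulr_natr mulr2n ltrDr.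
have [|s|s|_] := @derive1_at_min R g 0 (t * 2) t _ _ t2.
- by rewrite mulr_ge0// ltW.
- by rewrite in_itv /= => /andP[s0 _]; case: (dg s s0).
- rewrite in_itv /= => /andP[s0 _]; rewrite !gE -!ih//.
  have := @moment_convex n t (s - t) t0; rewrite addrC subrK => /(_ s0).
  by rewrite -/A mulrC; lra.
have [_ ->] := dg t t0; rewrite /inv /GRing.scale /= !mulr1.
move/eqP; rewrite addrC addr_eq0 => /eqP ->.
by rewrite factS natrM !exprS !mulrN opprK expr0 mulr1 invfM; ring.
Qed.

End GaussMoments.

Section PlaneOrthogonality.
Variable R : realType.
Local Notation leb := (@lebesgue_measure R).
Local Notation RT := (measurableTypeR R).
Local Notation plane := (RT * RT)%type.
Local Notation leb2 := (prod_sigma_finite leb leb).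
Local Notation C := R[i].

Definition zc (z : plane) : C := (z.1 +i* z.2)%C.
Definition omega : C := ((3 / 5 : R) +i* (4 / 5))%C.

Lemma zc_rot z : zc (plane_rot z) = omega * zc z.
Proof.
rewrite /zc /plane_rot /omega; apply/eqP; rewrite eq_complex /=.
by apply/andP; split; apply/eqP; ring.
Qed.

Lemma mcomplex_zc : mcomplex zc.
Proof. by split; [exact: measurable_fst|exact: measurable_snd]. Qed.

(* The powers of 3 + 4i are congruent to 3 + 4i modulo 5. *)
Lemma omega_expS k : exists a b : int,
  omega ^+ k.+1 = (((3 + 5 * a)%:~R / 5 ^+ k.+1) +i* ((4 + 5 * b)%:~R / 5 ^+ k.+1))%C.
Proof.
elim: k => [|k [a [b e]]].
  by exists 0, 0; rewrite !expr1 !mulr0 !addr0.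
exists (-2 + 3 * a - 4 * b), (4 + 4 * a + 3 * b); rewrite exprS e /omega.
have n0 : 5 ^+ k.+1 != 0 :> R by rewrite expf_neq0.
apply/eqP; rewrite eq_complex /= !(rmorphD, rmorphB, rmorphM, rmorphN) /= (exprS 5 k.+1).
by apply/andP; split; apply/eqP; field.
Qed.

(** Equality would give [3 + 5 * a = 5 ^+ k.+1], absurd modulo 5. *)
Lemma omega_exp_neq1 k : omega ^+ k.+1 != 1.
Proof.
have [a [b ->]] := omega_expS k; apply/negP => /eqP [h _].
have n0 : 5 ^+ k.+1 != 0 :> R by rewrite expf_neq0.
have {}h : ((3 + 5 * a)%:~R : R) = (5 ^+ k.+1)%:~R.
  by rewrite rmorphXn /=; move/eqP: h; rewrite (can2_eq (divfK n0) (mulfK n0)) mul1r => /eqP.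
have {}h : 3 + 5 * a = 5 ^+ k.+1 by apply: (@intr_inj R).
move: h; rewrite exprS; set x := _ ^+ k; lia.
Qed.

Lemma omegaK : omega * omega^* = 1.
Proof.
by rewrite conjCE /omega; apply/eqP; rewrite eq_complex /=; apply/andP; split; apply/eqP; field.
Qed.

(** As [omega] has modulus 1, the common powers cancel and a positive power of [omega] remains, up
    to conjugation when [m] is the smaller exponent. *)
Lemma omega_expM_neq1 m n : m != n -> omega ^+ m * omega^* ^+ n != 1.
Proof.
have key k j : omega ^+ (k.+1 + j) * omega^* ^+ j != 1.
  by rewrite exprD -mulrA -exprMn omegaK expr1n mulr1 omega_exp_neq1.
rewrite neq_ltn => /orP[mn|nm].
  have := key (n - m).-1 m; rewrite prednK ?subn_gt0// subnK 1?ltnW//.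
  apply: contraNN => /eqP/(congr1 conjC); rewrite rmorphM /= !rmorphXn /= conjCK.
  by rewrite conjC1 mulrC => ->.
by have := key (m - n).-1 n; rewrite prednK ?subn_gt0// subnK 1?ltnW.
Qed.

Lemma cint_rot (F : plane -> C) : mcomplex F ->
  cint leb2 (fun z => F (plane_rot z)) = cint leb2 F.
Proof.
move=> [h1 h2]; rewrite /cint; congr (fine _ +i* fine _)%C.
  exact: (@integral_rot R (fun z => (complex.Re (F z))%:E) ltac:(exact/measurable_EFinP)).
exact: (@integral_rot R (fun z => (complex.Im (F z))%:E) ltac:(exact/measurable_EFinP)).
Qed.

Definition zmon m n (w : plane -> R) (z : plane) : C :=
  zc z ^+ m * (zc z)^* ^+ n * (w z)%:C%C.

Lemma mcomplex_zmon m n (w : plane -> R) : measurable_fun setT w -> mcomplex (zmon m n w).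
Proof.
move=> mw; apply: mcomplexM; last exact: mcomplex_real.
by apply: mcomplexM; apply: mcomplexX; [|apply: mcomplex_conj]; exact: mcomplex_zc.
Qed.

(** Composing with the rotation leaves the integral unchanged, yet multiplies the integrand by a
    constant different from 1. *)
Lemma cint_zmon0 m n (w : plane -> R) : measurable_fun setT w -> (forall z, w (plane_rot z) = w z) ->
  cintegrable leb2 (zmon m n w) -> m != n -> cint leb2 (zmon m n w) = 0.
Proof.
move=> mw wr ic mn; have := cint_rot (mcomplex_zmon m n mw).
have -> : (fun z => zmon m n w (plane_rot z)) =
    (fun z => omega ^+ m * omega^* ^+ n * zmon m n w z).
  by apply/funext => z; rewrite /zmon wr zc_rot rmorphM /= !exprMn; ring.
rewrite cintZ// => /eqP; rewrite -subr_eq0 -{2}[cint _ _]mul1r -mulrBl mulf_eq0.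
by rewrite subr_eq0 (negbTE (omega_expM_neq1 mn)) => /eqP.
Qed.

Lemma rnorm_zc (z : plane) : rnorm (zc z) = Num.sqrt (sqnorm z).
Proof. by rewrite rnormCE. Qed.

Lemma sqnorm_rot (z : plane) : sqnorm (plane_rot z) = sqnorm z.
Proof. by rewrite /sqnorm /plane_rot /=; field. Qed.

Definition gamma (z : plane) : R := pi^-1 * expR (- sqnorm z).

Lemma gamma_ge0 z : 0 <= gamma z.
Proof. by rewrite mulr_ge0 ?expR_ge0// invr_ge0 pi_ge0. Qed.

Lemma measurable_gamma : measurable_fun setT gamma.
Proof.
apply: measurable_funM => //; apply: measurableT_comp; first exact: measurable_expR.
by apply: measurable_funN; exact: measurable_sqnorm.
Qed.

(** The cut-off depends on [sqnorm z] alone, so the weight stays rotation invariant, and on its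
    support a power series converges uniformly. *)
Definition gauss_trunc (r : R) (z : plane) : R := gamma z * (if sqnorm z <= r then 1 else 0).

Lemma measurable_gauss_trunc r : measurable_fun setT (gauss_trunc r).
Proof.
apply: measurable_funM; first exact: measurable_gamma.
pose A : set plane := [set z | sqnorm z <= r].
rewrite (_ : (fun z => _) = \1_A); last first.
  apply/funext => z; rewrite indicE; case: ifPn => h; first by rewrite mem_set.
  by rewrite memNset//; exact/negP.
apply: measurable_indic.
rewrite (_ : A = setT `&` @sqnorm R @^-1` `]-oo, r]%classic); last first.
  by rewrite setTI; apply/seteqP; split => z; rewrite /A /= in_itv.
by apply: measurable_sqnorm => //; exact: measurable_itv.
Qed.

Lemma rintegrable_exp (c : R) :
  rintegrable leb2 (fun z => expR (c * rnorm (zc z)) * gamma z).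
Proof.
have [i _] := @gauss2 R 2^-1 ltac:(by rewrite invr_gt0).
(* From c x <= c^2 / 2 + x^2 / 2: half of the Gaussian exponent absorbs the exponential at the price
   of the constant exp (c^2 / 2). *)
apply: rintegrable_le (rintegrableZ (pi^-1 * expR (c ^+ 2 / 2)) i) _.
  apply: measurable_funM; last exact: measurable_gamma.
  apply: measurableT_comp; first exact: measurable_expR.
  by apply: measurable_funM => //; apply: measurable_rnorm; exact: mcomplex_zc.
move=> z; have := rnormC2 (zc z); rewrite -/(sqnorm z) => e.
have g0 : 0 <= expR (c * rnorm (zc z)) * gamma z by rewrite mulr_ge0 ?expR_ge0 ?gamma_ge0.
rewrite ger0_norm// /gamma mulrCA -mulrA.
apply: ler_wpM2l; first by rewrite invr_ge0 pi_ge0.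
have -> : sqnorm z = rnorm (zc z) ^+ 2 by rewrite e.
by rewrite -!expRD ler_expR; move: (rnorm _) => x; have := sqr_ge0 (c - x); lra.
Qed.

Lemma rnorm_zmon m n (w : plane -> R) z : rnorm (zmon m n w z) = rnorm (zc z) ^+ (m + n) * `|w z|.
Proof. by rewrite /zmon !rnormCM !rnormCX rnorm_conj rnorm_real exprD. Qed.

Lemma cintegrable_zmon m n (w : plane -> R) : measurable_fun setT w -> (forall z, `|w z| <= gamma z) ->
  cintegrable leb2 (zmon m n w).
Proof.
move=> mw wg; apply: (cintegrable_le _ (rintegrableZ (m + n)`!%:R (rintegrable_exp 1))).
  exact: mcomplex_zmon.
move=> z; rewrite rnorm_zmon mulrA; apply: ler_pM => //; rewrite ?exprn_ge0 ?rnorm_ge0//.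
by rewrite mul1r; apply: exp_ge_pow; exact: rnorm_ge0.
Qed.

Lemma cint_zmon n : cint leb2 (zmon n n gamma) = n`!%:R.
Proof.
have zE z : zmon n n gamma z = (pi^-1 * (sqnorm z ^+ n * expR (- 1 * sqnorm z)))%:C%C.
  rewrite /zmon -exprMn.
  have -> : zc z * (zc z)^* = (sqnorm z)%:C%C.
    by rewrite conjCE; apply/eqP; rewrite eq_complex /=; apply/andP; split; apply/eqP; rewrite /sqnorm; ring.
  by rewrite -rmorphXn -rmorphM /gamma mulN1r; congr (_%:C%C); ring.
rewrite /cint; under eq_integral do rewrite zE.
under [in X in (_ +i* X)%C]eq_integral do rewrite zE.
rewrite /= integral0 /=; under eq_integral do rewrite EFinM.
rewrite integralZl//; last exact: (rintegrable_moment n ltr01).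
rewrite fineM//; last by apply: integrable_fin_num => //; exact: (rintegrable_moment n ltr01).
rewrite -/(moment n 1) momentE// invr1 expr1n mulr1 /= mulKf ?gt_eqF ?pi_gt0//.
by rewrite -(rmorph_nat (real_complex R)).
Qed.

End PlaneOrthogonality.

(** * Boxes of multi-indices and the multivariate exponential bound *)

Section Boxes.
Variable d : nat.

Definition mnm_of_ffun (N : nat) (g : {ffun 'I_d -> 'I_N}) : 'X_{1..d} :=
  [multinom (g i : nat) | i < d].

(** Over such cubes a sum of products over the coordinates factors, and the cubes exhaust the finite
    sets of multi-indices, as [cvg_exhaust] requires. *)
Definition mnm_box (N : nat) : {fset 'X_{1..d}} :=
  [fset mnm_of_ffun g | g in {: {ffun 'I_d -> 'I_N}}]%fset.

Lemma mem_mnm_box N (al : 'X_{1..d}) : (al \in mnm_box N) = [forall i, (al i < N)%N].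
Proof.
apply/imfsetP/forallP => [[g _ ->] i|h]; first by rewrite mnmE.
exists [ffun i => Ordinal (h i)] => //=.
by apply/mnmP => i; rewrite mnmE ffunE.
Qed.

Lemma mnm_box_sum (K : comPzRingType) N (F : 'I_d -> nat -> K) :
  \sum_(al <- mnm_box N) \prod_(i < d) F i (al i) = \prod_(i < d) \sum_(k < N) F i k.
Proof.
rewrite bigA_distr_bigA big_imfset /=; last first.
  move=> g1 g2 _ _ /mnmP e; apply/ffunP => i; apply/val_inj.
  by have := e i; rewrite !mnmE.
rewrite big_enum /=; apply: eq_bigr => g _.
by apply: eq_bigr => i _; rewrite mnmE.
Qed.

Lemma mnm_box_exhaust (A : {fset 'X_{1..d}}) :
  \forall n \near \oo, (A `<=` mnm_box n)%fset.
Proof.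
exists (\max_(al <- A) \max_(i < d) al i).+1 => // n /= hn.
apply/fsubsetP => al Aal; rewrite mem_mnm_box; apply/forallP => i.
apply: leq_trans hn; rewrite ltnS.
apply: leq_trans (@leq_bigmax_seq _ _ _ (fun al : 'X_{1..d} => \max_(i < d) al i) al Aal _) => //.
exact: (leq_bigmax (F := fun i => al i)).
Qed.

Definition mnm_fact (al : 'X_{1..d}) : nat := \prod_(i < d) (al i)`!.

Lemma mnm_fact_gt0 al : (0 < mnm_fact al)%N.
Proof. by rewrite prodn_gt0// => i; exact: fact_gt0. Qed.

End Boxes.

Section ExpBound.
Variables (R : realType) (d : nat).

Lemma sum_exp_le (x : R) N : 0 <= x -> \sum_(k < N) (x ^+ k / k`!%:R) <= expR x.
Proof.
move=> x0; have -> : \sum_(k < N) (x ^+ k / k`!%:R) = series (exp_coeff x) N.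
  by rewrite /series /= big_mkord.
apply: nondecreasing_cvgn_le; last exact: is_cvg_series_exp_coeff.
by apply: nondecreasing_series => n _ _; exact: exp_coeff_ge0.
Qed.

(** The terms are nonnegative, so [A] may be enlarged to a box. There the sum is a product of
    partial sums of one-variable exponential series. *)
Lemma sum_mnm_exp_le (x : 'I_d -> R) (A : {fset 'X_{1..d}}) : (forall i, 0 <= x i) ->
  \sum_(al <- A) ((\prod_(i < d) x i ^+ al i) / (mnm_fact al)%:R) <= expR (\sum_(i < d) x i).
Proof.
move=> x0; have [n _ /(_ n (leqnn n)) /= An] := mnm_box_exhaust A.
pose F (al : 'X_{1..d}) := (\prod_(i < d) x i ^+ al i) / (mnm_fact al)%:R.
have FE al : F al = \prod_(i < d) (x i ^+ al i / (al i)`!%:R).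
  by rewrite /F /mnm_fact big_split /= natr_prod prodfV.
have F0 al : 0 <= F al.
  by rewrite FE prodr_ge0// => i _; rewrite divr_ge0// exprn_ge0.
apply: (@le_trans _ _ (\sum_(al <- mnm_box d n) F al)).
  by rewrite (big_fset_sub F An) lerDl sumr_ge0.
rewrite (eq_bigr _ (fun al _ => FE al)).
rewrite (mnm_box_sum n (fun i k => x i ^+ k / k`!%:R)) expR_sum.
apply: ler_prod => i _; rewrite sum_exp_le// andbT.
by rewrite sumr_ge0// => k _; rewrite divr_ge0// exprn_ge0.
Qed.

End ExpBound.

(** * Gaussian integrals of monomials on C^d *)

Section GaussTuple.
Variables (R : realType) (d : nat).
Local Notation RT := (measurableTypeR R).
Local Notation plane := (RT * RT)%type.
Local Notation C := R[i].
Local Notation T := (d.-tuple plane).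
Local Notation lebd := (@lebesgueC R d).
Implicit Types (al be : 'X_{1..d}).

Lemma cvecE (p : T) i : cvec p 0 i = zc (tnth p i).
Proof. by rewrite mxE. Qed.

Lemma gauss_densityE (p : T) : gauss_density (cvec p) = \prod_(i < d) gamma (tnth p i).
Proof.
rewrite /gauss_density /gamma [RHS]big_split /= prodr_const card_ord exprVn; congr (_ * _).
rewrite -sumrN expR_sum; apply: eq_bigr => i _; congr expR.
by rewrite cvecE.
Qed.

Lemma gauss_density_ge0 (p : T) : 0 <= gauss_density (cvec p).
Proof. by rewrite gauss_densityE prodr_ge0// => i _; exact: gamma_ge0. Qed.

(** The Gaussian is cut off to a polydisc rather than a ball, so that the weight remains a product
    over the coordinates. *)
Definition truncd (r : R) (p : T) : R := \prod_(i < d) gauss_trunc r (tnth p i).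

Lemma gauss_trunc_le r (z : plane) : 0 <= gauss_trunc r z <= gamma z.
Proof.
by rewrite /gauss_trunc; case: ifP => _; rewrite ?mulr1 ?mulr0 ?lexx gamma_ge0.
Qed.

Lemma truncd_le r p : 0 <= truncd r p <= gauss_density (cvec p).
Proof.
rewrite gauss_densityE /truncd; apply/andP; split.
  by apply: prodr_ge0 => i _; case/andP: (gauss_trunc_le r (tnth p i)).
by apply: ler_prod => i _; exact: gauss_trunc_le.
Qed.

Lemma truncd_neq0 r p i : truncd r p != 0 -> sqnorm (tnth p i) <= r.
Proof.
move=> /prodf_neq0/(_ i isT); rewrite /gauss_trunc; case: ifP => //.
by rewrite mulr0 eqxx.
Qed.

(** For a fixed point the sequence is constant as soon as the polydisc contains it. *)
Lemma cvg_truncd p : (fun n => truncd n%:R p) @ \oo --> gauss_density (cvec p).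
Proof.
rewrite gauss_densityE; apply: cvg_near_cst.
suff : \forall n \near \oo, forall i : 'I_d, sqnorm (tnth p i) <= n%:R.
  apply: filterS => n h; apply: eq_bigr => i _.
  by rewrite /gauss_trunc h mulr1.
apply: filter_forall => i; exact: nbhs_infty_ger.
Qed.

Lemma monomial_cvec al (p : T) : monomial (cvec p) al = \prod_(i < d) zc (tnth p i) ^+ al i.
Proof. by apply: eq_bigr => i _; rewrite cvecE. Qed.

Definition mpair al be (W : T -> R) (p : T) : C :=
  monomial (cvec p) al * (monomial (cvec p) be)^* * (W p)%:C%C.

Lemma mpairE al be (w : plane -> R) (W : T -> R) :
  (forall p, W p = \prod_(i < d) w (tnth p i)) ->
  mpair al be W = (fun p => \prod_(i < d) zmon (al i) (be i) w (tnth p i)).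
Proof.
move=> WE; apply/funext => p; rewrite /mpair WE !monomial_cvec !rmorph_prod /=.
rewrite -!big_split /=; apply: eq_bigr => i _.
by rewrite /zmon rmorphXn.
Qed.

Local Notation leb2 := (prod_sigma_finite (@lebesgue_measure R) (@lebesgue_measure R)).

Lemma zmon_gamma_int m n : cintegrable leb2 (zmon m n (@gamma R)).
Proof.
apply: cintegrable_zmon; first exact: measurable_gamma.
by move=> z; rewrite ger0_norm ?gamma_ge0.
Qed.

Lemma mpair_gauss al : cint lebd (mpair al al (@gauss_density R d \o @cvec R d)) = (mnm_fact al)%:R.
Proof.
rewrite (@mpairE _ _ (@gamma R)) => [|p]; last exact: gauss_densityE.
rewrite (cint_lebesgueC_prod (fun i => zmon_gamma_int (al i) (al i))).2.
by rewrite natr_prod; apply: eq_bigr => i _; exact: cint_zmon.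
Qed.

Lemma zmon_trunc_int m n r : cintegrable leb2 (zmon m n (gauss_trunc r)).
Proof.
apply: cintegrable_zmon; first exact: measurable_gauss_trunc.
by move=> z; have /andP[h0 h] := gauss_trunc_le r z; rewrite ger0_norm.
Qed.

Lemma mpair_trunc_int al be r : cintegrable lebd (mpair al be (truncd r)).
Proof.
rewrite (@mpairE _ _ (gauss_trunc r)) => [|p//].
exact: (cint_lebesgueC_prod (fun i => zmon_trunc_int (al i) (be i) r)).1.
Qed.

Lemma mpair_trunc0 al be r : al != be -> cint lebd (mpair al be (truncd r)) = 0.
Proof.
move=> ab; rewrite (@mpairE _ _ (gauss_trunc r)) => [|p//].
rewrite (cint_lebesgueC_prod (fun i => zmon_trunc_int (al i) (be i) r)).2.
have [i abi] : exists i, al i != be i.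
  apply/existsP; apply: contraR ab => /existsPn h; apply/eqP/mnmP => i.
  by apply/eqP; have := h i; rewrite negbK.
rewrite (bigD1 i)//= cint_zmon0 ?mul0r//; first exact: measurable_gauss_trunc.
  by move=> z; rewrite /gauss_trunc /gamma sqnorm_rot.
exact: zmon_trunc_int.
Qed.

Lemma rintegrable_exp_gauss (c : R) :
  rintegrable lebd (fun p => expR (c * \sum_(i < d) rnorm (cvec p 0 i)) * gauss_density (cvec p)).
Proof.
pose f (i : 'I_d) (z : plane) : C := (expR (c * rnorm (zc z)) * gamma z)%:C%C.
have hf i : cintegrable leb2 (f i).
  by split; [exact: rintegrable_exp|exact: integrable0].
have := (cint_lebesgueC_prod hf).1.1; congr rintegrable; apply/funext => p.
rewrite -rmorph_prod /= gauss_densityE mulr_sumr expR_sum -big_split /=.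
by apply: eq_bigr => i _; rewrite cvecE.
Qed.

End GaussTuple.

(** * Power series and the Fock space pairing *)

Section PowerSeries.
Variables (R : realType) (d : nat).
Local Notation C := R[i].
Local Notation Cd := 'rV[C]_d.
Implicit Types (f g : Cd -> C) (a b : 'X_{1..d} -> C) (al be : 'X_{1..d}).

Lemma rnorm_prod (I : Type) (s : seq I) (F : I -> C) :
  rnorm (\prod_(i <- s) F i) = \prod_(i <- s) rnorm (F i).
Proof.
elim/big_rec2: _ => [|i x y _ <-]; last by rewrite rnormCM.
by have := rnorm_real (1 : R); rewrite normr1.
Qed.

Lemma rnorm_monomial (z : Cd) al : rnorm (monomial z al) = \prod_(i < d) rnorm (z 0 i) ^+ al i.
Proof. by rewrite /monomial rnorm_prod; apply: eq_bigr => i _; rewrite rnormCX. Qed.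

Lemma monomial0 (z : Cd) : monomial z 0%MM = 1.
Proof. by rewrite /monomial big1// => i _; rewrite mnm0E expr0. Qed.

Definition mpartial a (N : nat) (z : Cd) : C :=
  \sum_(be <- mnm_box d N) a be * monomial z be.

Lemma cvg_mpartial f a z : power_series f a -> (fun N => mpartial a N z) @ \oo --> f z.
Proof.
move=> fa; exact: (@cvg_exhaust R _ C (fun be => a be * monomial z be) (f z) _ (@mnm_box_exhaust d) (fa z)).
Qed.

Lemma power_series_lin f g a b c : power_series f a -> power_series g b ->
  power_series (c *: f + g) (fun al => c * a al + b al).
Proof.
move=> fa gb z.
rewrite (_ : partial_sum _ = fun A => c * partial_sum (fun al => a al * monomial z al) A +
   partial_sum (fun al => b al * monomial z al) A).
  by apply: cvgD; [apply: cvgMr; exact: fa|exact: gb].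
apply/funext => A; rewrite !partial_sumE mulr_sumr -big_split /=.
by apply: eq_bigr => be _; rewrite mulrDl mulrA.
Qed.

Definition cst_vec (c : R) : Cd := \row_(i < d) c%:C%C.

Lemma rnorm_monomial_cst (c : R) al : 0 <= c -> rnorm (monomial (cst_vec c) al) = c ^+ mdeg al.
Proof.
move=> c0; rewrite rnorm_monomial mdegE -prodrXr; apply: eq_bigr => i _.
by rewrite mxE rnorm_real ger0_norm.
Qed.

(** Unconditional convergence at the point with all coordinates [c] is absolute, and there the
    monomial [al] has modulus [c ^+ mdeg al]. *)
Lemma power_series_bound f a (c : R) : 0 <= c -> power_series f a ->
  exists M, abs_le (fun al => a al * (c ^+ mdeg al)%:C%C) M.
Proof.
move=> c0 fa; have [M hM] := cvg_abs_le (fa (cst_vec c)); exists M => A.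
apply: le_trans (hM A); apply: ler_sum => al _.
by rewrite !rnormCM rnorm_real rnorm_monomial_cst// ger0_norm ?exprn_ge0.
Qed.

(** Taylor coefficients of a function of exponential type, dominated by [M] times the exponential of
    [c] times the sum of the moduli of the coordinates. Such functions lie in the Fock space;
    monomials, kernel functions and the functions [U x] are of this type. *)
Definition exp_bound b (M c : R) :=
  0 <= c /\ forall be, rnorm (b be) <= M * c ^+ mdeg be / (mnm_fact be)%:R.

Lemma exp_bound_ge0 b M c : exp_bound b M c -> 0 <= M.
Proof.
move=> [_ /(_ 0%MM)]; rewrite mdeg0 expr0 mulr1 /mnm_fact big1 ?divr1 => [|i _].
  exact: le_trans (rnorm_ge0 _).
by rewrite mnm0E.
Qed.

Lemma exp_bound_abs_le b M c z : exp_bound b M c ->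
  abs_le (fun be => b be * monomial z be) (M * expR (c * \sum_(i < d) rnorm (z 0 i))).
Proof.
move=> hb; have M0 := exp_bound_ge0 hb; have [c0 bM] := hb => A.
pose x (i : 'I_d) := c * rnorm (z 0 i).
have x0 i : 0 <= x i by rewrite mulr_ge0// rnorm_ge0.
apply: (@le_trans _ _ (M * \sum_(be <- A) ((\prod_(i < d) x i ^+ be i) / (mnm_fact be)%:R))).
  rewrite mulr_sumr; apply: ler_sum => be _; rewrite rnormCM.
  have -> : \prod_(i < d) x i ^+ be i = c ^+ mdeg be * rnorm (monomial z be).
    rewrite rnorm_monomial mdegE -prodrXr -big_split /=.
    by apply: eq_bigr => i _; rewrite exprMn.
  rewrite (_ : M * _ = M * c ^+ mdeg be / (mnm_fact be)%:R * rnorm (monomial z be)).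
    by rewrite ler_wpM2r ?rnorm_ge0.
  by ring.
rewrite [c * _]mulr_sumr.
by apply: ler_wpM2l => //; exact: sum_mnm_exp_le.
Qed.

Lemma exp_bound_entire b M c : exp_bound b M c -> exists g, power_series g b.
Proof.
move=> hb; have /choice [g hg] : forall z : Cd, exists l : C,
    partial_sum (fun be => b be * monomial z be) @ totally --> l.
  by move=> z; exact: abs_le_cvg (exp_bound_abs_le z hb).
by exists g.
Qed.

Lemma exp_bound_le g b M c z : exp_bound b M c -> power_series g b ->
  rnorm (g z) <= M * expR (c * \sum_(i < d) rnorm (z 0 i)).
Proof. by move=> hb gb; exact: abs_le_lim (exp_bound_abs_le z hb) (gb z). Qed.

Lemma exp_bound_mpartial b M c z N : exp_bound b M c ->
  rnorm (mpartial b N z) <= M * expR (c * \sum_(i < d) rnorm (z 0 i)).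
Proof.
by move=> hb; apply: le_trans (rnorm_sum _ _ _) _; exact: exp_bound_abs_le.
Qed.

End PowerSeries.

Lemma cvg_conjC (R : realType) (T : Type) (F : set_system T) {FF : Filter F}
    (u : T -> R[i]) (l : R[i]) :
  u @ F --> l -> (fun t => (u t)^*) @ F --> l^*.
Proof.
move=> /cvg_rnormP h; apply/cvg_rnormP => e e0.
by near do rewrite -rmorphB /= rnorm_conj; exact: h.
Unshelve. all: by end_near.
Qed.

Section FockPairing.
Variables (R : realType) (d : nat).
Local Notation C := R[i].
Local Notation Cd := 'rV[C]_d.
Local Notation plane := (measurableTypeR R * measurableTypeR R)%type.
Local Notation T := (d.-tuple plane).
Local Notation lebd := (@lebesgueC R d).
Local Notation gd := (@gauss_density R d).
Local Notation fock := (fock R d).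
Implicit Types (f g : Cd -> C) (a b : 'X_{1..d} -> C) (al be : 'X_{1..d}).

Definition gpair (W : T -> R) f g (p : T) : C := f (cvec p) * (g (cvec p))^* * (W p)%:C%C.

Lemma fock_ipE f g : fock_ip f g = cint lebd (gpair (gd \o @cvec R d) f g).
Proof.
rewrite /fock_ip /cint; congr Complex; congr fine; apply: eq_integral => p _; congr EFin.
  by rewrite [RHS]Re_mul /= mulr0 subr0.
by rewrite [RHS]Im_mul /= mulr0 add0r.
Qed.

Lemma measurable_gauss_density : measurable_fun setT (fun p : T => gd (cvec p)).
Proof.
have /integrableP[/measurable_EFinP + _] := @rintegrable_exp_gauss R d 0.
by under eq_fun do rewrite mul0r expR0 mul1r.
Qed.

Lemma measurable_truncd r : measurable_fun setT (@truncd R d r).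
Proof.
have [h _] := cintegrable_mcomplex (mpair_trunc_int (0%MM : 'X_{1..d}) 0%MM r).
by move: h; under eq_fun do rewrite /mpair !monomial0 conjC1 !mul1r.
Qed.

Lemma mcomplex_monomial al : mcomplex (fun p : T => monomial (cvec p) al).
Proof.
under eq_fun do rewrite monomial_cvec.
apply: mcomplex_prod => i; apply: mcomplexX; have [h1 h2] := mcomplex_zc R.
by split; [apply: measurableT_comp h1 _|apply: measurableT_comp h2 _]; exact: measurable_tnth.
Qed.

Lemma mcomplex_mpartial a N : mcomplex (fun p : T => mpartial a N (cvec p)).
Proof.
by apply: mcomplex_sum => be; apply: mcomplexM; [exact: mcomplex_cst|exact: mcomplex_monomial].
Qed.

Lemma mcomplex_series f a : power_series f a -> mcomplex (fun p : T => f (cvec p)).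
Proof.
move=> fa; apply: (mcomplex_lim (mcomplex_mpartial a)) => p; exact: cvg_mpartial.
Qed.

Lemma mcomplex_gpair W f g : measurable_fun setT W -> mcomplex (fun p : T => f (cvec p)) ->
  mcomplex (fun p : T => g (cvec p)) -> mcomplex (gpair W f g).
Proof.
move=> mW mf mg; apply: mcomplexM; last exact: mcomplex_real.
by apply: mcomplexM => //; exact: mcomplex_conj.
Qed.

Lemma rnorm_gpair (W : T -> R) f g p : 0 <= W p ->
  rnorm (gpair W f g p) = rnorm (f (cvec p)) * rnorm (g (cvec p)) * W p.
Proof. by move=> W0; rewrite /gpair !rnormCM rnorm_conj rnorm_real ger0_norm. Qed.

Definition sq_integrable f :=
  rintegrable lebd (fun p => rnorm (f (cvec p)) ^+ 2 * gd (cvec p)).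

Lemma fock_carrierP f : carrier fock f <-> entire f /\ sq_integrable f.
Proof.
have eqI : entire f -> (sq_integrable f <->
  (\int[lebd]_p (sqnormC (f (cvec p)) * gd (cvec p))%:E < +oo)%E).
  move=> [a fa].
  have mf : measurable_fun setT (fun p : T => rnorm (f (cvec p)) ^+ 2 * gd (cvec p)).
    apply: measurable_funM; last exact: measurable_gauss_density.
    by apply: measurable_funX; apply: measurable_rnorm; exact: mcomplex_series fa.
  have absE (p : T) : `|(rnorm (f (cvec p)) ^+ 2 * gd (cvec p))%:E|%E =
      (sqnormC (f (cvec p)) * gd (cvec p))%:E.
    by rewrite -rnormC2 abse_EFin ger0_norm// mulr_ge0 ?sqr_ge0 ?gauss_density_ge0.
  split=> [/integrableP[_]|h]; first by under eq_integral do rewrite absE.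
  apply/integrableP; split; first exact/measurable_EFinP.
  by under eq_integral do rewrite absE.
by split=> [[ef /(eqI ef)]|[ef /(eqI ef)]].
Qed.

Lemma gpair_fock_int f g : (exists a, power_series f a) -> (exists b, power_series g b) ->
  sq_integrable f -> sq_integrable g -> cintegrable lebd (gpair (gd \o @cvec R d) f g).
Proof.
move=> [a fa] [b gb] sf sg; apply: (cintegrable_le _ (rintegrableD sf sg)).
  apply: mcomplex_gpair; first exact: measurable_gauss_density.
    exact: mcomplex_series fa.
  exact: mcomplex_series gb.
move=> p; have g0 := gauss_density_ge0 p; rewrite rnorm_gpair//= -mulrDl ler_wpM2r//.
by move: (rnorm (f _)) (rnorm (g _)) (rnorm_ge0 (f (cvec p))) (rnorm_ge0 (g (cvec p))) => x y; nra.
Qed.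

Lemma sq_integrable_exp b M c g : exp_bound b M c -> power_series g b -> sq_integrable g.
Proof.
move=> hb gb; have M0 := exp_bound_ge0 hb.
apply: rintegrable_le (rintegrableZ (M ^+ 2) (@rintegrable_exp_gauss R d (2 * c))) _.
  apply: measurable_funM; last exact: measurable_gauss_density.
  by apply: measurable_funX; apply: measurable_rnorm; exact: mcomplex_series gb.
move=> p; have g0 := gauss_density_ge0 p.
rewrite ger0_norm; last by rewrite mulr_ge0 ?sqr_ge0.
rewrite mulrA ler_wpM2r//.
have := exp_bound_le (cvec p) hb gb; have := rnorm_ge0 (g (cvec p)).
rewrite -[2 * c * _]mulrA expRM_natl -exprMn.
by move: (rnorm _) (M * _) => u v u0 uv; apply: lerXn2r; rewrite ?nnegrE// (le_trans u0).
Qed.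

Lemma exp_bound_monomial al : exp_bound (fun be => (be == al)%:R : C) (mnm_fact al)%:R 1.
Proof.
split=> // be; rewrite expr1n mulr1; have [->|_] := eqVneq be al.
  rewrite divff ?pnatr_eq0 -?lt0n ?mnm_fact_gt0//.
  by have := rnorm_real (1 : R); rewrite normr1 => ->.
by rewrite rnorm0 divr_ge0.
Qed.

Lemma power_series_monomial al :
  power_series (fun z : Cd => monomial z al) (fun be => (be == al)%:R : C).
Proof.
move=> z; apply: cvg_near_cst; exists [fset al]%fset => // A /= /fsubsetP hA.
rewrite partial_sumE (big_fsetD1 al) ?hA ?inE//= eqxx mul1r big1_fset ?addr0// => be.
by rewrite !inE => /andP[/negbTE -> _] _; rewrite mul0r.
Qed.

Lemma sq_integrable_monomial al : sq_integrable (fun z : Cd => monomial z al).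
Proof. exact: sq_integrable_exp (exp_bound_monomial al) (@power_series_monomial al). Qed.

(* On a polydisc the power series converges uniformly, and the monomials are
   orthogonal by rotation invariance. *)
Lemma cint_gpair_truncd f a al (r : R) : power_series f a ->
  cint lebd (gpair (truncd r) f (fun z => monomial z al)) =
  a al * cint lebd (mpair al al (truncd r)).
Proof.
move=> fa; have sr0 := sqrtr_ge0 r.
have [M hM] := power_series_bound sr0 fa.
(* On the support of [truncd r] every coordinate has modulus at most [Num.sqrt r], so all partial
   sums of [f] are bounded by [M] there; [mpair al 0%MM] is the monomial times the weight. *)
have dom : rintegrable lebd (fun p => M * rnorm (mpair al 0%MM (truncd r) p)).
  by apply: rintegrableZ; apply: cintegrable_rnorm; exact: mpair_trunc_int.
pose h N := gpair (truncd r) (mpartial a N) (fun z => monomial z al).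
have W0 p : 0 <= @truncd R d r p by case/andP: (truncd_le r p).
have [|||_ lim1] := @cint_dct R _ T lebd h (gpair (truncd r) f (fun z => monomial z al)) _ _ _ dom.
- move=> N; apply: mcomplex_gpair; [exact: measurable_truncd|exact: mcomplex_mpartial|].
  exact: mcomplex_monomial.
- move=> p; apply: cvgMl; apply: cvgMl; exact: cvg_mpartial.
- move=> N p; rewrite rnorm_gpair// /mpair monomial0 conjC1 mulr1 rnormCM rnorm_real.
  rewrite ger0_norm// -mulrA.
  have [->|t0] := eqVneq (truncd r p) 0; first by rewrite !mulr0.
  rewrite ler_wpM2r ?mulr_ge0 ?rnorm_ge0//.
  apply: le_trans (rnorm_sum _ _ _) _; apply: le_trans (hM (mnm_box d N)).
  apply: ler_sum => be _; rewrite !rnormCM ler_wpM2l ?rnorm_ge0//.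
  rewrite rnorm_real ger0_norm ?exprn_ge0// rnorm_monomial mdegE -prodrXr.
  apply: ler_prod => i _; rewrite exprn_ge0 ?rnorm_ge0//=.
  apply: lerXn2r; rewrite ?nnegrE ?rnorm_ge0// cvecE rnorm_zc ler_wsqrtr//.
  exact: truncd_neq0 t0.
apply: (@cvg_unique _ _ _ _ _ _ lim1); first exact: norm_hausdorff.
(* Once the box contains [al], only the term of index [al] survives and the integral no longer
   depends on [N]. *)
apply: cvg_near_cst; have [N0 _ hN0] := mnm_box_exhaust [fset al]%fset.
exists N0 => // N /= /hN0 /= /fsubsetP alN; have {}alN := alN al (fset11 al).
have hE p : h N p = \sum_(be <- mnm_box d N) a be * mpair be al (truncd r) p.
  rewrite /h /gpair /mpartial !mulr_suml; apply: eq_bigr => be _.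
  by rewrite /mpair !mulrA.
rewrite (_ : h N = fun p => \sum_(be <- mnm_box d N) a be * mpair be al (truncd r) p); last exact/funext.
rewrite cint_sum => [|be]; last by apply: cintegrableZ; exact: mpair_trunc_int.
rewrite (big_fsetD1 al)//= cintZ; last exact: mpair_trunc_int.
rewrite big1_fset ?addr0// => be.
rewrite !inE => /andP[bal _] _; rewrite cintZ; last exact: mpair_trunc_int.
by rewrite mpair_trunc0// mulr0.
Qed.

Lemma cvg_cint_truncd f g : (exists a, power_series f a) -> (exists b, power_series g b) ->
  sq_integrable f -> sq_integrable g ->
  (fun n => cint lebd (gpair (truncd n%:R) f g)) @ \oo --> cint lebd (gpair (gd \o @cvec R d) f g).
Proof.
move=> ef eg sf sg; have [a fa] := ef; have [b gb] := eg.
have := cintegrable_rnorm (gpair_fock_int ef eg sf sg) => dom.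
have [|||_ //] := @cint_dct R _ T lebd (fun n => gpair (truncd n%:R) f g)
  (gpair (gd \o @cvec R d) f g) _ _ _ dom.
- move=> n; apply: mcomplex_gpair; [exact: measurable_truncd|exact: mcomplex_series fa|].
  exact: mcomplex_series gb.
- move=> p; apply: cvgMr; apply/cvg_complexP; split; last exact: cvg_cst.
  exact: cvg_truncd.
- move=> n p; have /andP[t0 tg] := truncd_le n%:R p.
  by rewrite !rnorm_gpair ?gauss_density_ge0// ler_wpM2l// mulr_ge0 ?rnorm_ge0.
Qed.

(** The cut-off is removed on both sides of [cint_gpair_truncd]; on the right, the squared norm of
    the monomial for the truncated weight tends to the full one, [mnm_fact al]. *)
Lemma cint_gpair_monomial f a al : power_series f a -> sq_integrable f ->
  cint lebd (gpair (gd \o @cvec R d) f (fun z => monomial z al)) = a al * (mnm_fact al)%:R.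
Proof.
move=> fa sf.
have ef : exists a, power_series f a by exists a.
have em : exists b, power_series (fun z : Cd => monomial z al) b.
  by eexists; exact: power_series_monomial.
have lim1 := cvg_cint_truncd ef em sf (sq_integrable_monomial al).
have lim2 := cvg_cint_truncd em em (sq_integrable_monomial al) (sq_integrable_monomial al).
apply: (@cvg_unique _ _ _ _ _ _ lim1); first exact: norm_hausdorff.
rewrite (_ : (fun n => _) = fun n => a al * cint lebd (mpair al al (truncd n%:R))).
  by apply: cvgMr; rewrite -mpair_gauss; exact: lim2.
by apply/funext => n; exact: cint_gpair_truncd.
Qed.

(** The expansion is that of [g], whose partial sums are dominated by a single exponential that is
    square integrable for the Gaussian. Dominated convergence then reduces the pairing to that of
    [f] with monomials. *)
Lemma fock_pairing f g a b M c : carrier fock f -> power_series f a ->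
  power_series g b -> exp_bound b M c ->
  partial_sum (fun be => (mnm_fact be)%:R * a be * (b be)^*) @ totally --> fock_ip f g.
Proof.
move=> /fock_carrierP[ef sf] fa gb hb.
have M0 := exp_bound_ge0 hb; have [c0 bM] := hb.
pose x be := (mnm_fact be)%:R * a be * (b be)^*.
have [K hK] := power_series_bound c0 fa.
(* The factorial cancels against the bound on [b], leaving the series of [f] at the point with all
   coordinates [c]. *)
have xK : abs_le x (M * K).
  move=> A; apply: (@le_trans _ _ (M * \sum_(be <- A) rnorm (a be * (c ^+ mdeg be)%:C%C))).
    rewrite mulr_sumr; apply: ler_sum => be _; rewrite /x !rnormCM rnorm_conj rnorm_real.
    rewrite ger0_norm ?exprn_ge0//.
    have -> : rnorm ((mnm_fact be)%:R : C) = (mnm_fact be)%:R.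
      by rewrite -(rmorph_nat (real_complex R)) rnorm_real ger0_norm.
    rewrite mulrAC [leRHS]mulrCA mulrC ler_wpM2l ?rnorm_ge0//.
    by rewrite mulrC -ler_pdivlMr ?ltr0n ?mnm_fact_gt0.
  by rewrite ler_wpM2l.
have [l xl] := abs_le_cvg xK.
suff -> : fock_ip f g = l by [].
have lim1 := cvg_exhaust (@mnm_box_exhaust d) xl.
(* By u v <= u^2 + v^2, where u is the modulus of [f] and v the exponential bound on the partial
   sums of [g]. *)
have dom : rintegrable lebd (fun p => rnorm (f (cvec p)) ^+ 2 * gd (cvec p) +
    M ^+ 2 * (expR (2 * c * \sum_(i < d) rnorm (cvec p 0 i)) * gd (cvec p))).
  by apply: rintegrableD => //; apply: rintegrableZ; exact: rintegrable_exp_gauss.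
have [|||_ lim2] := @cint_dct R _ T lebd (fun N => gpair (gd \o @cvec R d) f (mpartial b N))
  (gpair (gd \o @cvec R d) f g) _ _ _ dom.
- move=> n; apply: mcomplex_gpair; [exact: measurable_gauss_density|exact: mcomplex_series fa|].
  exact: mcomplex_mpartial.
- by move=> p; apply: cvgMl; apply: cvgMr; apply: cvg_conjC; exact: cvg_mpartial.
- move=> N p; have g0 := gauss_density_ge0 p; rewrite rnorm_gpair//= mulrA -mulrDl ler_wpM2r//.
  have := exp_bound_mpartial (cvec p) N hb.
  rewrite -[2 * c * _]mulrA expRM_natl.
  have w0 := expR_ge0 (c * \sum_(i < d) rnorm (cvec p 0 i)).
  have u0 := rnorm_ge0 (mpartial b N (cvec p)); have v0 := rnorm_ge0 (f (cvec p)).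
  rewrite -exprMn; move: (mulr_ge0 M0 w0); set t := M * _; clearbody t.
  move: u0 v0; set u := rnorm (mpartial _ _ _); set v := rnorm (f _).
  clearbody u v; move=> u0 v0 t0 ut; have := ler_wpM2l v0 ut.
  by have := sqr_ge0 (v - t); have := sqr_ge0 v; have := sqr_ge0 t; rewrite sqrrB; lra.
have gi be : cintegrable lebd (gpair (gd \o @cvec R d) f (fun z => monomial z be)).
  exact: gpair_fock_int ef (ex_intro _ _ (@power_series_monomial be)) sf (sq_integrable_monomial be).
rewrite fock_ipE; apply: (@cvg_unique _ _ _ _ _ _ lim2); first exact: norm_hausdorff.
apply: cvg_trans lim1; apply: near_eq_cvg; apply: nearW => N.
rewrite (_ : gpair _ f _ = fun p => \sum_(be <- mnm_box d N)
   (b be)^* * gpair (gd \o @cvec R d) f (fun z => monomial z be) p).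
  rewrite cint_sum => [|be]; last exact: cintegrableZ (gi be).
  apply: eq_bigr => be _; rewrite (cintZ _ (gi be)).
  by rewrite (cint_gpair_monomial be fa sf) /x; ring.
apply/funext => p; rewrite /gpair /mpartial rmorph_sum mulr_sumr mulr_suml.
by apply: eq_bigr => be _; rewrite rmorphM; ring.
Qed.

End FockPairing.

Lemma cvg_rnorm_unique (R : realType) (V : normedModType R[i]) (T : Type)
    (F : set_system T) {FF : ProperFilter F} (u : T -> V) (l l' : V) :
  u @ F --> l -> u @ F --> l' -> l = l'.
Proof. by move=> h h'; apply: (cvg_unique _ h h'); exact: norm_hausdorff. Qed.

(** * The Fock space as a pre-Hilbert space and its reproducing kernel *)

Section FockSpace.
Variables (R : realType) (d : nat).
Local Notation C := R[i].
Local Notation Cd := 'rV[C]_d.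
Local Notation plane := (measurableTypeR R * measurableTypeR R)%type.
Local Notation lebd := (@lebesgueC R d).
Local Notation gd := (@gauss_density R d).
Local Notation fock := (fock R d).
Implicit Types (f g : Cd -> C) (a b : 'X_{1..d} -> C) (al be : 'X_{1..d}).

Lemma power_series_eq f g a : power_series f a -> power_series g a -> f = g.
Proof.
move=> fa ga; apply/funext => z.
exact: cvg_rnorm_unique (fa z) (ga z).
Qed.

Lemma taylorP f : entire f -> power_series f (taylor f).
Proof. by move=> ef; rewrite /taylor; exact: (@xgetPex _ _ [set a | power_series f a]). Qed.

Lemma cint_conj (m : {measure set (d.-tuple plane) -> \bar R}) (f : d.-tuple plane -> C) :
  cintegrable m f -> cint m (fun t => (f t)^*) = (cint m f)^*.
Proof.
move=> [_ i2]; rewrite /cint [RHS]conjCE /=; congr Complex.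
  by congr fine; apply: eq_integral => t _; rewrite conjCE.
have := @rint_lin _ _ _ m (-1) _ _ i2 (integrable0 m setT).
rewrite integral0 addr0 mulN1r => <-; congr fine; apply: eq_integral => t _.
by rewrite conjCE /=; congr EFin; rewrite mulN1r addr0.
Qed.

Lemma fock_entire f : carrier fock f -> entire f.
Proof. by case. Qed.

Lemma fock_gpair_int f g : carrier fock f -> carrier fock g ->
  cintegrable lebd (gpair (gd \o @cvec R d) f g).
Proof.
move=> /fock_carrierP[ef sf] /fock_carrierP[eg sg].
exact: (gpair_fock_int ef eg sf sg).
Qed.

Lemma fock_pre : is_prehilbert fock.
Proof.
have zero : power_series (0 : Cd -> C) (fun=> 0).
  move=> z; apply: cvg_near_cst; apply: nearW => A; rewrite partial_sumE big1// => i _.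
  by rewrite mul0r.
split.
- apply/fock_carrierP; split; first by exists (fun=> 0).
  rewrite /sq_integrable; under eq_fun do rewrite rnorm0 expr0n mul0r.
  exact: integrable0.
- move=> c f g /fock_carrierP[[a fa] sf] /fock_carrierP[[b gb] sg].
  have fgab := @power_series_lin _ _ f g a b c fa gb.
  apply/fock_carrierP; split; first by eexists; exact: fgab.
  apply: rintegrable_le (rintegrableD (rintegrableZ (2 * rnorm c ^+ 2) sf) (rintegrableZ 2 sg)) _.
    apply: measurable_funM; last exact: measurable_gauss_density.
    by apply: measurable_funX; apply: measurable_rnorm; exact: mcomplex_series fgab.
  move=> p; have g0 := gauss_density_ge0 p.
  rewrite ger0_norm; last by rewrite mulr_ge0 ?sqr_ge0.
  rewrite (_ : 2 * rnorm c ^+ 2 * _ + _ = (2 * (rnorm c * rnorm (f (cvec p))) ^+ 2 +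
    2 * rnorm (g (cvec p)) ^+ 2) * gd (cvec p)); last by ring.
  rewrite ler_wpM2r//.
  have := rnormD (c * f (cvec p)) (g (cvec p)); rewrite rnormCM.
  have := rnorm_ge0 (c * f (cvec p) + g (cvec p)).
  move: (rnorm c * rnorm (f (cvec p))) (rnorm (g (cvec p))) => x y.
  rewrite -[(c *: f + g) _]/(c * f (cvec p) + g (cvec p)); move: (rnorm _) => u u0 uxy.
  have : u ^+ 2 <= (x + y) ^+ 2 by apply: lerXn2r; rewrite ?nnegrE// (le_trans u0).
  by have := sqr_ge0 (x - y); rewrite sqrrB sqrrD; lra.
- move=> c f g k cf cg ck; rewrite /= !fock_ipE -cint_lin; try exact: fock_gpair_int.
  congr cint; apply/funext => p; rewrite /gpair.
  by rewrite -[(c *: f + g) _]/(c * f (cvec p) + g (cvec p)); ring.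
- move=> f g cf cg; rewrite /= !fock_ipE -cint_conj; last exact: fock_gpair_int.
  congr cint; apply/funext => p; rewrite /gpair.
  have conjE (u v : C) (w : R) : (u * v^* * w%:C%C)^* = v * u^* * w%:C%C.
    rewrite !rmorphM /= conjCK [(w%:C%C)^*]conjCE /= oppr0.
    by rewrite [v * _]mulrC.
  by rewrite conjE.
- move=> f cf; rewrite /= fine_ge0//; apply: integral_ge0 => p _.
  rewrite lee_fin mulr_ge0 ?gauss_density_ge0// conjCE Re_mul /= mulrN opprK.
  by rewrite addr_ge0// -expr2 sqr_ge0.
Qed.

Lemma fock_exp g b M c : exp_bound b M c -> power_series g b -> carrier fock g.
Proof.
move=> hb gb; apply/fock_carrierP; split; first by exists b.
exact: sq_integrable_exp hb gb.
Qed.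

(** These are the Taylor coefficients of z |-> exp <z, w>; each coordinate of [w] has modulus at
    most the sum of all of them, which serves as [c]. *)
Lemma exp_bound_kernel (w : Cd) :
  exp_bound (fun be => (monomial w be)^* / (mnm_fact be)%:R) 1 (\sum_(i < d) rnorm (w 0 i)).
Proof.
split=> [|be]; first by rewrite sumr_ge0// => i _; exact: rnorm_ge0.
rewrite mul1r rnormCM rnorm_conj -(rmorph_nat (real_complex R)) -fmorphV rnorm_real.
rewrite ger0_norm ?invr_ge0// ler_wpM2r ?invr_ge0// rnorm_monomial mdegE -prodrXr.
apply: ler_prod => i _; rewrite exprn_ge0 ?rnorm_ge0//=.
apply: lerXn2r; rewrite ?nnegrE ?rnorm_ge0 ?sumr_ge0//; last first.
  by rewrite (bigD1 i)//= lerDl sumr_ge0// => j _; exact: rnorm_ge0.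
by move=> j _; exact: rnorm_ge0.
Qed.

(** In [fock_pairing] the factorial cancels and the sum becomes the Taylor series of [f] at [w]. *)
Lemma fock_reproducing (w : Cd) : exists2 k, carrier fock k &
  forall f, carrier fock f -> fock_ip f k = f w.
Proof.
have hb := exp_bound_kernel w; have [k kb] := exp_bound_entire hb.
exists k; first exact: fock_exp hb kb.
move=> f cf; have fa := taylorP (fock_entire cf).
have := fock_pairing cf fa kb hb.
rewrite (_ : partial_sum _ = partial_sum (fun be => taylor f be * monomial w be)).
  by move=> l1; exact: cvg_rnorm_unique l1 (fa w).
apply/funext => A; rewrite !partial_sumE; apply: eq_bigr => be _.
rewrite rmorphM /= conjCK fmorphV /= conjC_nat; field.
by rewrite pnatr_eq0 -lt0n mnm_fact_gt0.
Qed.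

End FockSpace.

(** * The model map of a cyclic commuting tuple *)

Section DotHilbert.
Variables (R : realType) (H : completeNormedModType R[i]).
Local Notation C := R[i].
Variable dot : {dot H for conjC}.
Hypothesis dot_norm : forall x, `|x| ^+ 2 = dot x x.

Lemma hnorm_full x : hnorm (hfull dot) x = rnorm x.
Proof.
rewrite /hnorm /= -dot_norm normE -rmorphXn /= sqrtr_sqr ger0_norm//.
exact: rnorm_ge0.
Qed.

Lemma hfull_hilbert : is_hilbert (hfull dot).
Proof.
split=> //=.
- by move=> a x y z _ _ _; rewrite linearDl linearZl_LR.
- by move=> x y _ _; rewrite (hermitian_subproof y x) expr0 mul1r.
- by move=> x _ /eqP x0; exact: neq0_dnorm_gt0.
move=> u _ hu.
have : cvg (u @ \oo).
  apply/cauchy_cvgP/cauchy_exP => e; rewrite ltcE /= => /andP[/eqP e1 e0].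
  have -> : e = (complex.Re e)%:C%C by case: e e1 {e0} => a b /= ->.
  have [N hN] := hu _ e0; exists (u N); exists N => // n /= Nn.
  by rewrite -ball_normE /ball_ /= normE ltcR -hnorm_full; exact: hN.
move=> /cvg_ex [l ul]; exists l => //; rewrite /hcvg.
under eq_fun do rewrite hnorm_full.
by apply/cvg_rnorm0P.
Qed.

Lemma continuous_rnorm_bound (A : {linear H -> H}) : continuous A ->
  exists2 M, 0 <= M & forall x, rnorm (A x) <= M * rnorm x.
Proof.
move=> /linear_bounded_continuous/linear_boundedP/pinfty_ex_gt0[r r0 hr].
have rE : r = (complex.Re r)%:C%C.
  by move: r0; rewrite ltcE /= => /andP[/eqP r1 _]; case: r r1 {hr} => a b /= ->.
exists (complex.Re r) => [|x]; first by rewrite -ler0c -rE ltW.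
by have := hr x; rewrite !normE {1}rE -rmorphM /= lecR.
Qed.

End DotHilbert.

Section Tuple.
Variables (R : realType) (d : nat) (H : completeNormedModType R[i]).
Local Notation C := R[i].
Local Notation Cd := 'rV[C]_d.
Variables (dot : {dot H for conjC}) (T : 'I_d -> {linear H -> H}) (h : H).
Hypothesis dot_norm : forall x, `|x| ^+ 2 = dot x x.
Hypothesis cT : cyclic_commuting_tuple T h.
Local Notation fock := (fock R d).
Local Notation "T^ al" := (op_monomial T al h) (at level 3, format "T^ al").
Implicit Types (al be : 'X_{1..d}) (x y : H) (f g : Cd -> C).

Let hH := hfull_hilbert dot_norm.
Let pH := hilbert_pre hH.

Lemma op_monomialD1 i al x : op_monomial T (U_(i) + al)%MM x = T i (op_monomial T al x).
Proof.
have iterC j k m y : iter m (T j) (T k y) = T k (iter m (T j) y).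
  by elim: m => //= m ->; exact: tuple_commute cT _ _ _.
rewrite /op_monomial.
have foldC (s : seq 'I_d) y : foldr (fun j z => iter (al j) (T j) z) (T i y) s =
    T i (foldr (fun j z => iter (al j) (T j) z) y s).
  by elim: s => //= j s ->; rewrite iterC.
(* Only the factor of index [i] changes. The induction runs over an arbitrary list without
   repetition, where that factor occurs at most once. *)
suff key (s : seq 'I_d) : uniq s ->
    foldr (fun j z => iter ((U_(i) + al)%MM j) (T j) z) x s =
    (if i \in s then T i (foldr (fun j z => iter (al j) (T j) z) x s)
     else foldr (fun j z => iter (al j) (T j) z) x s).
  by rewrite key ?enum_uniq// mem_enum.
elim: s => //= j s ih /andP[js us]; rewrite ih// inE mnmDE mnm1E.
case: (eqVneq i j) => [ij|ij] /=.
  by rewrite ij (negbTE js).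
by case: ifP => // _; rewrite iterC.
Qed.

Lemma op_monomial_bound : exists2 c, 0 <= c &
  forall al, rnorm (T^al) <= c ^+ mdeg al * rnorm h.
Proof.
have /choice [M hM] : forall i, exists M, 0 <= M /\ forall x, rnorm (T i x) <= M * rnorm x.
  by move=> i; have [M M0 hM] := continuous_rnorm_bound (tuple_bounded cT (i := i)); exists M.
have M0 i : 0 <= M i by case: (hM i).
pose c := \sum_i M i.
have c0 : 0 <= c by apply: sumr_ge0.
exists c => // al.
have Tc i x : rnorm (T i x) <= c * rnorm x.
  apply: le_trans ((hM i).2 x) _; rewrite ler_wpM2r ?rnorm_ge0//.
  by rewrite /c (bigD1 i)//= lerDl sumr_ge0.
have iterc i n x : rnorm (iter n (T i) x) <= c ^+ n * rnorm x.
  elim: n => [|n ih]; first by rewrite mul1r.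
  by rewrite exprS -mulrA; apply: le_trans (Tc _ _) _; rewrite ler_wpM2l.
rewrite mdegE -big_enum /op_monomial; elim: (enum _) => [|i s ih] /=.
  by rewrite big_nil mul1r.
rewrite big_cons exprD -mulrA; apply: le_trans (iterc _ _ _) _.
by rewrite ler_wpM2l// exprn_ge0.
Qed.

Definition adj_coef x be : C := dot x (T^be) / (mnm_fact be)%:R.

Lemma dot_suml (J : Type) (s : seq J) (F : J -> H) x :
  dot (\sum_(j <- s) F j) x = \sum_(j <- s) dot (F j) x.
Proof. exact: (ip_suml pH s (P := xpredT) (F := F) (fun _ _ => I) I). Qed.

Lemma rnorm_dot x y : rnorm (dot x y) <= rnorm x * rnorm y.
Proof. by have := ip_cauchy pH (x := x) (y := y) I I; rewrite !(hnorm_full dot_norm). Qed.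

Lemma rnorm_invn n : rnorm ((n%:R)^-1 : C) = n%:R^-1.
Proof. by rewrite -(rmorph_nat (real_complex R)) -fmorphV rnorm_real ger0_norm ?invr_ge0. Qed.

Lemma adj_coef_bound : exists c, forall x, exp_bound (adj_coef x) (rnorm x * rnorm h) c.
Proof.
have [c c0 hc] := op_monomial_bound; exists c => x; split=> // be.
rewrite /adj_coef rnormCM rnorm_invn ler_wpM2r ?invr_ge0//.
apply: le_trans (rnorm_dot _ _) _; rewrite -mulrA ler_wpM2l ?rnorm_ge0//.
by rewrite mulrC.
Qed.

Lemma adj_exists : exists U : H -> Cd -> C, forall x, power_series (U x) (adj_coef x).
Proof.
have [c hc] := adj_coef_bound.
have /choice [U hU] : forall x, exists g : Cd -> C, power_series g (adj_coef x).
  by move=> x; exact: exp_bound_entire (hc x).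
by exists U.
Qed.

Variable U : H -> Cd -> C.
Hypothesis hU : forall x, power_series (U x) (adj_coef x).

Lemma U_fock x : carrier fock (U x).
Proof. by have [c hc] := adj_coef_bound; exact: fock_exp (hc x) (@hU x). Qed.

Lemma U_lin a x y : U (a *: x + y) = a *: U x + U y.
Proof.
apply: power_series_eq (@hU _) _.
suff -> : adj_coef (a *: x + y) = (fun be => a * adj_coef x be + adj_coef y be).
  exact: (power_series_lin (@hU x) (@hU y)).
apply/funext => be.
by rewrite /adj_coef linearDl linearZl_LR mulrDl mulrA.
Qed.

(** The norm of [T^al] grows at most like [c ^+ mdeg al], and the coefficients of an entire function
    are absolutely summable against such powers. *)
Lemma op_series_cvg f a : power_series f a ->
  exists l : H, partial_sum (fun al => a al *: T^al) @ totally --> l.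
Proof.
move=> fa; have [c c0 hc] := op_monomial_bound.
have [M hM] := power_series_bound c0 fa.
apply: (@abs_le_cvg _ _ _ _ (M * rnorm h)) => A.
apply: (@le_trans _ _ (\sum_(al <- A) rnorm (a al * (c ^+ mdeg al)%:C%C) * rnorm h)).
  apply: ler_sum => al _; rewrite rnormZ rnormCM rnorm_real ger0_norm ?exprn_ge0//.
  by rewrite -mulrA ler_wpM2l ?rnorm_ge0.
by rewrite -mulr_suml ler_wpM2r ?rnorm_ge0.
Qed.

Lemma dot_cvg (X : Type) (F : set_system X) {FF : Filter F} (u : X -> H) l x :
  u @ F --> l -> (fun t => dot (u t) x : C) @ F --> (dot l x : C).
Proof.
move=> /cvg_rnormP ul; apply/cvg_rnormP => e e0.
have e1 : 0 < e / (rnorm x + 1) by rewrite divr_gt0// ltr_wpDl// rnorm_ge0.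
near=> t; rewrite -(ipBl pH (x := u t) (y := l) (z := x) I I I).
apply: le_lt_trans (rnorm_dot _ _) _.
apply: (@le_lt_trans _ _ (rnorm (u t - l) * (rnorm x + 1))).
  by rewrite ler_wpM2l ?rnorm_ge0// lerDl.
rewrite -ltr_pdivlMr; last by rewrite ltr_wpDl// rnorm_ge0.
by near: t; exact: ul.
Unshelve. all: by end_near.
Qed.

(** Both sides are the sum over [be] of [a be] times [dot (T^be) x]. The coefficients [a] are
    arbitrary, so that a monomial can be used with its evident ones as well as an entire function
    with [taylor]. *)
Lemma pairing_series f a l x : carrier fock f -> power_series f a ->
  partial_sum (fun al => a al *: T^al) @ totally --> l -> dot l x = fock_ip f (U x).
Proof.
move=> cf fa al_l; have [c hc] := adj_coef_bound.
have l1 := fock_pairing cf fa (@hU x) (hc x).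
have l2 : (fun A => dot (partial_sum (fun al => a al *: T^al) A) x : C) @ totally -->
  (dot l x : C) by exact: dot_cvg.
apply: (cvg_rnorm_unique l2).
suff -> : (fun A => dot (partial_sum (fun al => a al *: T^al) A) x) =
  partial_sum (fun be => (mnm_fact be)%:R * a be * (adj_coef x be)^*) by exact l1.
apply/funext => A; rewrite !partial_sumE.
rewrite dot_suml.
apply: eq_bigr => be _; rewrite /= linearZl_LR /adj_coef rmorphM fmorphV /= conjC_nat.
rewrite (hermitian_subproof (T^be) x) expr0 mul1r; field.
by rewrite pnatr_eq0 -lt0n mnm_fact_gt0.
Qed.

Lemma iotaP f : entire f ->
  partial_sum (fun al => taylor f al *: T^al) @ totally --> iota_op T h f.
Proof.
move=> ef; have [l hl] := op_series_cvg (taylorP ef).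
rewrite /iota_op /op_entire /summability.sum.
by rewrite (cvg_lim _ hl)//; exact: norm_hausdorff.
Qed.

Lemma pairing f x : carrier fock f -> dot (iota_op T h f) x = fock_ip f (U x).
Proof.
move=> cf; have ef := fock_entire cf.
exact: pairing_series x cf (taylorP ef) (iotaP ef).
Qed.

Lemma pairing_monomial al x : dot (T^al) x = fock_ip (fun z => monomial z al) (U x).
Proof.
have pm := @power_series_monomial R d al.
apply: (pairing_series x (fock_exp (exp_bound_monomial R al) pm) pm).
apply: cvg_near_cst; exists [fset al]%fset => // A /= /fsubsetP hA.
rewrite partial_sumE (big_fsetD1 al) ?hA ?inE//= eqxx scale1r big1_fset ?addr0// => be.
by rewrite !inE => /andP[/negbTE -> _] _; rewrite scale0r.
Qed.

Lemma U_inj0 x : U x = 0 -> x = 0.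
Proof.
move=> Ux0.
have ort p : dot (op_poly T p h) x = 0.
  rewrite /op_poly dot_suml big1// => al _.
  have cm := fock_exp (exp_bound_monomial R al) (@power_series_monomial R d al).
  have e0 : fock_ip (fun z => monomial z al) 0 = 0 := ip0r (fock_pre R d) cm.
  by rewrite linearZl_LR /= pairing_monomial Ux0 e0 mulr0.
apply: rnorm_eq0; apply/eqP; rewrite eq_le rnorm_ge0 andbT.
apply/ler_addgt0Pr => e e0; rewrite add0r.
have [y [xy [p _ pE]]] : ball x e%:C%C `&` [set op_poly T p h | p in setT] !=set0.
  apply: (tuple_cyclic cT); last exact: ball_open.
  by exists x; apply: ballxx; rewrite ltcR.
have := ort p; rewrite pE => yx0.
(* Since [y] is orthogonal to [x], the squared norm of [x] is the product of [x - y] with [x]; hence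
   [x] is no longer than its distance to [y]. *)
have : rnorm x * rnorm x <= rnorm (x - y) * rnorm x.
  apply: le_trans (rnorm_dot (x - y) x).
  have -> : dot (x - y) x = dot x x - dot y x := ipBl pH (x := x) (y := y) (z := x) I I I.
  rewrite yx0 subr0 -dot_norm normE.
  by rewrite -rmorphXn rnorm_real ger0_norm ?sqr_ge0.
have := rnorm_ge0 x; rewrite le_eqVlt => /predU1P[<- _|x0]; first exact: ltW.
rewrite ler_pM2r// => /le_trans; apply; apply/ltW.
by move: xy; rewrite -ball_normE /ball_ /= normE ltcR.
Qed.

End Tuple.

(** * Termwise differentiation of power series *)

Lemma cvg_rnorm (R : realType) (V : normedModType R[i]) (T : Type) (F : set_system T)
    {FF : Filter F} (u : T -> V) (l : V) :
  u @ F --> l -> (fun t => rnorm (u t)) @ F --> rnorm l.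
Proof.
move=> /cvg_rnormP h; apply/cvgrPdist_lt => e e0; near=> t.
apply: (@le_lt_trans _ _ (rnorm (u t - l))); last by near: t; exact: h.
rewrite ler_norml; have := rnormD (u t - l) l; have := rnormD (l - u t) (u t).
by rewrite !subrK rnormB; lra.
Unshelve. all: by end_near.
Qed.

Section PartialDerivative.
Variables (R : realType) (d : nat).
Local Notation C := R[i].
Local Notation Cd := 'rV[C]_d.
Implicit Types (g : Cd -> C) (b : 'X_{1..d} -> C) (al be : 'X_{1..d}).

(** A crude second order Taylor bound. The factor [2 ^+ n] absorbs the [n] produced by the induction
    step, so the bound is geometric in [n] and can be summed against the coefficients of an entire
    function. *)
Lemma pow_taylor2 (w t : C) (rho : R) n : 1 <= rho -> rnorm w + rnorm t <= rho ->
  rnorm ((w + t) ^+ n - w ^+ n - n%:R * t * w ^+ n.-1) <= rnorm t ^+ 2 * (2 * rho) ^+ n.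
Proof.
move=> rho1 wt; have rho0 : 0 <= rho by rewrite (le_trans ler01).
have wr : rnorm w <= rho by apply: le_trans wt; rewrite lerDl rnorm_ge0.
elim: n => [|n ih].
  rewrite !expr0 subrr sub0r mul0r mul0r rnormN rnorm0 mulr1.
  exact: sqr_ge0.
have -> : (w + t) ^+ n.+1 - w ^+ n.+1 - n.+1%:R * t * w ^+ n =
    (w + t) * ((w + t) ^+ n - w ^+ n - n%:R * t * w ^+ n.-1) + n%:R * (t ^+ 2 * w ^+ n.-1).
  case: n {ih} => [|n] /=; first by rewrite !expr1 !expr0; ring.
  by rewrite -!natr1 !exprS; ring.
apply: le_trans (rnormD _ _) _; rewrite !rnormCM.
have -> : rnorm (n%:R : C) = n%:R by rewrite -(rmorph_nat (real_complex R)) rnorm_real ger0_norm.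
rewrite !rnormCX.
have h1 : rnorm (w + t) * rnorm ((w + t) ^+ n - w ^+ n - n%:R * t * w ^+ n.-1) <=
    rho * (rnorm t ^+ 2 * (2 * rho) ^+ n).
  by apply: ler_pM; rewrite ?rnorm_ge0// (le_trans (rnormD _ _)).
have h2 : n%:R * (rnorm t ^+ 2 * rnorm w ^+ n.-1) <= rho * (rnorm t ^+ 2 * (2 * rho) ^+ n).
  rewrite mulrCA [leRHS]mulrCA ler_wpM2l ?sqr_ge0// exprMn mulrCA.
  apply: ler_pM; rewrite ?exprn_ge0 ?rnorm_ge0//.
    by rewrite -natrX ler_nat ltnW// ltn_expl.
  rewrite -exprS; apply: (@le_trans _ _ (rho ^+ n.-1)).
    by apply: lerXn2r; rewrite ?nnegrE ?rnorm_ge0.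
  by apply: ler_weXn2l => //; rewrite (leq_trans (leq_pred n)).
apply: le_trans (lerD h1 h2) _; rewrite [(2 * rho) ^+ n.+1]exprS le_eqVlt; apply/orP; left.
by apply/eqP; ring.
Qed.

Variables (i : 'I_d) (g g' : Cd -> C) (b : 'X_{1..d} -> C).
Definition deriv_coef (b : 'X_{1..d} -> C) be : C := (be i).+1%:R * b (U_(i) + be)%MM.

Hypothesis gb : power_series g b.
Hypothesis gb' : power_series g' (deriv_coef b).

Let rest (z : Cd) al : C := \prod_(j < d | j != i) z 0 j ^+ al j.

Let monomialD1 z al : monomial z al = z 0 i ^+ al i * rest z al.
Proof. by rewrite /monomial (bigD1 i). Qed.

Let dcoef (z : Cd) al : C := (al i)%:R * b al * z 0 i ^+ (al i).-1 * rest z al.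

Let dcoef_shift z be : dcoef z (U_(i) + be)%MM = deriv_coef b be * monomial z be.
Proof.
rewrite /dcoef /deriv_coef mnmDE mnm1E eqxx add1n /= monomialD1 mulrA; congr (_ * _).
apply: eq_bigr => j ji; rewrite mnmDE mnm1E eq_sym (negbTE ji).
by rewrite add0n.
Qed.

(* Multi-indices with vanishing i-th entry contribute nothing to the derivative. *)
Let E n : {fset 'X_{1..d}} :=
  ([fset (U_(i) + be)%MM | be in mnm_box d n] `|` [fset al in mnm_box d n | al i == 0%N])%fset.

Let E_exhaust (A : {fset 'X_{1..d}}) : \forall n \near \oo, (A `<=` E n)%fset.
Proof.
have := mnm_box_exhaust A; apply: filterS => n /fsubsetP hA.
apply/fsubsetP => al /hA aln; rewrite !inE /= aln /=.
have [_|ai] := eqVneq (al i) 0%N; first by rewrite orbT.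
rewrite orbF; apply/imfsetP; exists (al - U_(i))%MM => /=; last first.
  apply/mnmP => j; rewrite mnmDE mnmBE mnm1E.
  case: (eqVneq i j) ai => [->|_ _] /=; last by rewrite subn0.
  by move=> aj; rewrite add1n subn1 prednK ?lt0n.
move: aln; rewrite !mem_mnm_box => /forallP h; apply/forallP => j.
by rewrite mnmBE; apply: leq_ltn_trans (h j); exact: leq_subr.
Qed.

Let E_dcoef z n : \sum_(al <- E n) dcoef z al = mpartial (deriv_coef b) n z.
Proof.
rewrite /E (big_fset_sub _ (fsubsetUl _ _)) [X in _ + X]big1_seq ?addr0 => [|al]; last first.
  rewrite in_fsetU => /andP[/negbTE ->]; rewrite !inE /= => /andP[_ /eqP a0].
  by rewrite /dcoef a0 !mul0r.
rewrite big_imfset /=; last first.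
  move=> be be' _ _ /mnmP e; apply/mnmP => j; have := e j.
  by rewrite !mnmDE => /addnI.
by apply: eq_bigr => be _; rewrite dcoef_shift.
Qed.

Lemma partial_remainder (z : Cd) : exists2 K, 0 <= K & forall t : C, rnorm t <= 1 ->
  rnorm (g (t *: delta_mx 0 i + z) - g z - t * g' z) <= K * rnorm t ^+ 2.
Proof.
(* The polydisc of radius [rho] contains [z] and its displacements by at most 1 along the axis [i].
   The coefficients are summed at radius [2 * rho], the ratio in [pow_taylor2]. *)
pose rho := 1 + \sum_j rnorm (z 0 j).
have s0 : 0 <= \sum_j rnorm (z 0 j) by apply: sumr_ge0 => j _; exact: rnorm_ge0.
have rho1 : 1 <= rho by rewrite lerDl.
have rho0 : 0 <= 2 * rho by rewrite mulr_ge0// (le_trans ler01).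
have zr j : rnorm (z 0 j) + 1 <= rho.
  by rewrite /rho addrC lerD2l (bigD1 j)//= lerDl sumr_ge0// => k _; exact: rnorm_ge0.
have [K hK] := power_series_bound rho0 gb.
have K0 : 0 <= K by have := hK fset0; rewrite big_seq_fset0.
exists K => // t t1.
pose w := t *: delta_mx 0 i + z.
have wi : w 0 i = z 0 i + t by rewrite !mxE !eqxx mulr1 addrC.
have wj j : j != i -> w 0 j = z 0 j.
  by move=> ji; rewrite !mxE eqxx (negbTE ji) mulr0 add0r.
have lim1 : (fun n => \sum_(al <- E n) (b al * monomial w al - b al * monomial z al - t * dcoef z al))
    @ \oo --> g w - g z - t * g' z.
  rewrite (_ : (fun n => _) = fun n => \sum_(al <- E n) b al * monomial w al -
      \sum_(al <- E n) b al * monomial z al - t * mpartial (deriv_coef b) n z).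
    apply: cvgB; first apply: cvgB.
    - exact: (cvg_exhaust E_exhaust (@gb w)).
    - exact: (cvg_exhaust E_exhaust (@gb z)).
    - by apply: cvgMr; exact: cvg_mpartial.
  by apply/funext => n; rewrite -E_dcoef mulr_sumr !sumrB.
have bnd n : rnorm (\sum_(al <- E n) (b al * monomial w al - b al * monomial z al - t * dcoef z al))
    <= K * rnorm t ^+ 2.
  apply: le_trans (rnorm_sum _ _ _) _.
  apply: (@le_trans _ _ (\sum_(al <- E n) rnorm (b al * ((2 * rho) ^+ mdeg al)%:C%C) * rnorm t ^+ 2)).
    apply: ler_sum => al _; rewrite !monomialD1 wi.
    have -> : rest w al = rest z al by apply: eq_bigr => j ji; rewrite wj.
    rewrite (_ : _ - _ - _ = b al * (((z 0 i + t) ^+ al i - z 0 i ^+ al i -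
        (al i)%:R * t * z 0 i ^+ (al i).-1) * rest z al)); last by rewrite /dcoef; ring.
    rewrite !rnormCM rnorm_real ger0_norm ?exprn_ge0// -[leRHS]mulrA ler_wpM2l ?rnorm_ge0//.
    have -> : (2 * rho) ^+ mdeg al = (2 * rho) ^+ al i * \prod_(j < d | j != i) (2 * rho) ^+ al j.
      by rewrite mdegE -prodrXr (bigD1 i).
    rewrite [leRHS]mulrC mulrA; apply: ler_pM; rewrite ?rnorm_ge0//.
      by apply: pow_taylor2 => //; apply: le_trans (zr i); rewrite lerD2l.
    rewrite /rest -big_filter rnorm_prod big_filter -[leRHS]big_filter -[leLHS]big_filter.
    apply: ler_prod => j _; rewrite rnorm_ge0 rnormCX /=.
    apply: lerXn2r; rewrite ?nnegrE ?rnorm_ge0//.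
    have := zr j; have := rho1; lra.
  by rewrite -mulr_suml ler_wpM2r ?sqr_ge0.
have lim2 : (fun n => K * rnorm t ^+ 2 - rnorm (\sum_(al <- E n)
    (b al * monomial w al - b al * monomial z al - t * dcoef z al)))
    @ \oo --> K * rnorm t ^+ 2 - rnorm (g w - g z - t * g' z).
  apply: cvgB; first exact: cvg_cst.
  exact: cvg_rnorm.
by rewrite -subr_ge0; apply: (cvg_ge lim2) => n; rewrite subr_ge0.
Qed.

Lemma partial_cvg (z : Cd) :
  (fun t : C => t^-1 *: (g (t *: delta_mx 0 i + z) - g z)) @ 0^' --> g' z.
Proof.
have [K K0 hK] := partial_remainder z.
apply/cvg_rnormP => e e0.
pose del := Num.min 1 (e / (K + 1)).
have K1 : 0 < K + 1 by rewrite ltr_wpDl.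
have del0 : 0 < del by rewrite lt_min ltr01 divr_gt0.
near=> t.
have t0 : t != 0 by near: t; exact: nbhs_dnbhs_neq.
have td : rnorm t < del.
  rewrite -ltcR -normE; near: t; apply: dnbhs0_lt; by rewrite ltcR.
have rt0 : 0 < rnorm t.
  by rewrite lt_neqAle rnorm_ge0 andbT eq_sym; apply: contra_neq t0; exact: rnorm_eq0.
have t1 : rnorm t <= 1 by apply: le_trans (ltW td) _; rewrite ge_min lexx.
have te : rnorm t < e / (K + 1) by apply: lt_le_trans td _; rewrite ge_min lexx orbT.
have -> : t^-1 *: (g (t *: delta_mx 0 i + z) - g z) - g' z =
    t^-1 * (g (t *: delta_mx 0 i + z) - g z - t * g' z).
  by rewrite mulrBr mulKf.
rewrite rnormCM.
have -> : rnorm (t^-1 : C) = (rnorm t)^-1.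
  apply: (mulfI (lt0r_neq0 rt0)); rewrite -rnormCM (mulfV t0) mulfV ?lt0r_neq0//.
  by have := rnorm_real (1 : R); rewrite normr1.
rewrite mulrC ltr_pdivrMr//; apply: le_lt_trans (hK t t1) _.
rewrite expr2 mulrA ltr_pM2r//; move: te; rewrite ltr_pdivlMr//.
by move: rt0; move: (rnorm t) => u u0; nra.
Unshelve. all: by end_near.
Qed.

Lemma partial_derivable (z : Cd) : derivable g z (delta_mx 0 i).
Proof. by apply/cvg_ex; exists (g' z); exact: partial_cvg. Qed.

Lemma partialE : partial i g = g'.
Proof.
apply/funext => z; rewrite /partial /derive.
by apply: cvg_lim; [exact: norm_hausdorff|exact: partial_cvg].
Qed.

End PartialDerivative.

(** * The model space *)

(** [adjoint] is a choice among the solutions of [is_adjoint], so it suffices to exhibit one. *)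
Lemma adjointP (R : realType) (V W : lmodType R[i]) (S : hspace V) (S' : hspace W)
    (A : V -> W) (B : W -> V) :
  is_adjoint S S' A B -> is_adjoint S S' A (adjoint S S' A).
Proof. by move=> h; rewrite /adjoint; apply: (@xgetPex _ _ [set B | is_adjoint S S' A B]); exists B. Qed.

Lemma sum_fct (X : Type) (V : zmodType) (J : Type) (s : seq J) (P : pred J)
    (F : J -> X -> V) z :
  (\sum_(j <- s | P j) F j) z = \sum_(j <- s | P j) F j z.
Proof. exact: (big_morph (fun g : X -> V => g z)). Qed.

Section Model.
Variables (R : realType) (d : nat) (H : completeNormedModType R[i]).
Local Notation C := R[i].
Local Notation Cd := 'rV[C]_d.
Variables (dot : {dot H for conjC}) (T : 'I_d -> {linear H -> H}) (h : H).
Hypothesis dot_norm : forall x, `|x| ^+ 2 = dot x x.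
Hypothesis cT : cyclic_commuting_tuple T h.
Variables (lam : nat -> R) (f : nat -> Cd -> C).
Hypothesis spec : spectral_decomposition (fock R d) (L_op T dot h) lam f.
Variable U : H -> Cd -> C.
Hypothesis hU : forall x, power_series (U x) (adj_coef dot T h x).
Local Notation fock := (fock R d).
Local Notation iota := (iota_op T h).
Implicit Types (x y : H).

Let hH := hfull_hilbert dot_norm.
Let pH := hilbert_pre hH.
Let pF := fock_pre R d.

Let Ufock x : carrier fock (U x) := U_fock dot_norm cT hU x.
Let pair g x : carrier fock g -> dot (iota g) x = fock_ip g (U x).
Proof. by move=> cg; exact: (pairing dot_norm cT hU). Qed.

Lemma dot_inj y y' : (forall x, dot y x = dot y' x) -> y = y'.
Proof.
move=> e; apply/eqP; rewrite -subr_eq0; apply/negPn/negP => n0.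
have := neq0_dnorm_gt0 (s := dot) _ n0.
have -> : dot (y - y') (y - y') = dot y (y - y') - dot y' (y - y') :=
  ipBl pH (x := y) (y := y') (z := y - y') I I I.
by rewrite e subrr ltxx.
Qed.

Lemma dotC x y : dot y x = (dot x y)^*.
Proof. by rewrite (hermitian_subproof y x) expr0 mul1r. Qed.

Lemma dot_inj_r y y' : (forall x, dot x y = dot x y') -> y = y'.
Proof. by move=> e; apply: dot_inj => x; rewrite dotC e -dotC. Qed.

(** [iota] is defined through chosen Taylor coefficients; pairing with every [U x] identifies its
    values from the function [g] alone. The linearity of [iota] is obtained in this way. *)
Lemma iota_eq g y : carrier fock g -> (forall x, dot y x = fock_ip g (U x)) -> iota g = y.
Proof. by move=> cg e; apply: dot_inj => x; rewrite pair// e. Qed.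

Lemma U0 : U 0 = 0.
Proof.
have := U_lin hU 1 0 0; rewrite scale1r addr0 scale1r -[X in X = _]addr0.
by move/addrI.
Qed.

Lemma UZ a x : U (a *: x) = a *: U x.
Proof. by have := U_lin hU a x 0; rewrite !addr0 U0 addr0. Qed.

Lemma UB x y : U (x - y) = U x - U y.
Proof. by rewrite addrC -scaleN1r (U_lin hU) scaleN1r addrC. Qed.

Lemma U_inj : injective U.
Proof.
move=> x y e; apply/eqP; rewrite -subr_eq0; apply/eqP.
by apply: (U_inj0 dot_norm cT hU); rewrite UB e subrr.
Qed.

Lemma U_sum (J : Type) (s : seq J) (F : J -> H) :
  U (\sum_(j <- s) F j) = \sum_(j <- s) U (F j).
Proof.
elim: s => [|j s ih]; first by rewrite !big_nil U0.
by rewrite !big_cons -[F j]scale1r (U_lin hU) ih !scale1r.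
Qed.

Let k_ex : exists k : Cd -> Cd -> C, forall w, carrier fock (k w) /\
  forall g, carrier fock g -> fock_ip g (k w) = g w.
Proof.
have /choice [k hk] : forall w, exists kw, carrier fock kw /\
    forall g, carrier fock g -> fock_ip g kw = g w.
  by move=> w; have [kw ck hk] := fock_reproducing w; exists kw.
by exists k.
Qed.

(** [U] is an adjoint of [iota], while [L_op] uses the chosen one. Both give the same products with
    the Fock kernel functions, hence the same values at every point. *)
Lemma L_opE g : L_op T dot h g = U (iota g).
Proof.
have aU : is_adjoint fock (hfull dot) iota U.
  by split=> [y _|g' x cg _]; [exact: Ufock|exact: pair].
have [ca ea] := adjointP aU; have [k hk] := k_ex.
rewrite /L_op; apply/funext => w; have [ck rk] := hk w.
set B := adjoint _ _ _; have cB : carrier fock (B (iota g)) := ca (iota g) I.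
have cU := Ufock (iota g).
transitivity (fock_ip (B (iota g)) (k w)); first by rewrite (rk _ cB).
rewrite -(rk _ cU).
have -> : fock_ip (B (iota g)) (k w) = (fock_ip (k w) (B (iota g)))^* := ipC pF ck cB.
have -> : fock_ip (U (iota g)) (k w) = (fock_ip (k w) (U (iota g)))^* := ipC pF ck cU.
have eB : dot (iota (k w)) (iota g) = fock_ip (k w) (B (iota g)) := ea (k w) (iota g) ck I.
by rewrite -pair// eB.
Qed.

(** [kk w] is [iota] of the Fock kernel function at [w]. The spectral series applied to that
    function converges in norm; its product with the kernel function at [z] is the series that
    defines [spectral_kernel]. *)
Lemma U_kernel : exists kk : Cd -> H, (forall x w, U x w = dot x (kk w)) /\
  forall w, (fun z => spectral_kernel lam f z w) = U (kk w).
Proof.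
have [k hk] := k_ex; exists (fun w => iota (k w)); split=> [x w|w].
  have [ck rk] := hk w; have cU := Ufock x; rewrite -(rk _ cU).
  have -> : fock_ip (U x) (k w) = (fock_ip (k w) (U x))^* := ipC pF ck cU.
  by rewrite -pair// -dotC.
apply/funext => z; have [ck rk] := hk w; have [cz rz] := hk z.
have cf j : lam j != 0 -> carrier fock (f j) by apply: (spectral_orthonormal spec).1.
have ss := spectral_sum spec ck.
rewrite L_opE in ss.
set S := (fun n : nat => _) in ss.
have cS n : carrier fock (S n).
  by apply: (car_sum pF) => j /cf cj; apply: (carZ pF); exact: (carZ pF).
have := hcvg_ip pF cS (Ufock (iota (k w))) cz ss; rewrite /= rz// => ev.
rewrite /spectral_kernel; apply: cvg_lim; first exact: norm_hausdorff.
suff -> : series (fun j => (lam j)%:C%C * f j z * (f j w)^*) =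
  (fun n => fock_ip (S n) (k z)) by exact ev.
apply/funext => n; rewrite rz// /S /series /= big_mkord sum_fct [RHS]big_mkcond /=.
(* The padding indices, skipped in [S], contribute zero terms to the series. *)
apply: eq_bigr => j _; case: ifPn => [lj|]; last first.
  by rewrite negbK => /eqP ->; rewrite !mul0r.
have cj := cf _ lj; rewrite -(rk _ cj).
have -> : (fock_ip (f j) (k w))^* = fock_ip (k w) (f j) := esym (ipC pF cj ck).
by rewrite /rank_one -mulrA; congr (_ * _); rewrite mulrC.
Qed.

Definition Uinv (g : Cd -> C) : H := xget 0 [set x | U x = g].

Lemma UinvK x : Uinv (U x) = x.
Proof. by apply: U_inj; rewrite /Uinv; exact: (@xgetPex _ 0 [set y | U y = U x]) (ex_intro _ x erefl). Qed.

Definition range_space : hspace (Cd -> C) :=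
  HSpace (range U) (fun g g' => dot (Uinv g) (Uinv g')).

Lemma hnorm_range x : hnorm range_space (U x) = rnorm x.
Proof. by rewrite -(hnorm_full dot_norm) /hnorm /= UinvK. Qed.

Lemma range_space_rkhs : is_rkhs (spectral_kernel lam f) range_space.
Proof.
have [kk [Uk Fk]] := U_kernel; split.
- split => /=.
  + by exists 0 => //; exact: U0.
  + by move=> a _ _ [x _ <-] [y _ <-]; exists (a *: x + y) => //; exact: U_lin.
  + move=> a _ _ _ [x _ <-] [y _ <-] [z _ <-].
    by rewrite -(U_lin hU) !UinvK; exact: (ip_linearl hH a (x := x) (y := y) (z := z) I I I).
  + by move=> _ _ [x _ <-] [y _ <-]; rewrite !UinvK dotC.
  + move=> _ [x _ <-] Ux0; rewrite UinvK; apply: neq0_dnorm_gt0.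
    by apply/eqP => x0; apply: Ux0; rewrite x0 U0.
  + move=> u cu hu.
    have /choice [v hv] : forall n, exists x, U x = u n by move=> n; have [x _ <-] := cu n; exists x.
    have [|x _ vx] := hilbert_complete hH (u := v) (fun _ => I).
      move=> e e0; have [N hN] := hu e e0; exists N => m n Nm Nn.
      by have := hN m n Nm Nn; rewrite -!hv -UB hnorm_range (hnorm_full dot_norm).
    exists (U x); first by exists x.
    rewrite /hcvg; have := vx; rewrite /hcvg.
    suff -> : (fun n => hnorm range_space (u n - U x)) = (fun n => hnorm (hfull dot) (v n - x)) by [].
    by apply/funext => n; rewrite -hv -UB hnorm_range (hnorm_full dot_norm).
- by move=> w; rewrite Fk; exists (kk w).
- by move=> _ w [x _ <-]; rewrite Fk /= !UinvK Uk.
Qed.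

Local Notation HF := (rkhs (spectral_kernel lam f)).

(** [rkhs] is a choice among the solutions of [is_rkhs]. As [range_space] is one of them, the choice
    is a solution too, and uniqueness identifies the two on their common carrier. *)
Lemma HF_rkhs : is_rkhs (spectral_kernel lam f) HF.
Proof.
apply: (@xgetPex _ _ [set S | is_rkhs (spectral_kernel lam f) S]).
by exists range_space; exact: range_space_rkhs.
Qed.

Lemma HF_carrier : carrier HF = range U.
Proof. by rewrite (rkhs_carrier_unique HF_rkhs range_space_rkhs). Qed.

Lemma HF_U x : carrier HF (U x).
Proof. by rewrite HF_carrier; exists x. Qed.

Lemma HF_ip x y : ip HF (U x) (U y) = dot x y.
Proof.
by rewrite (rkhs_ip_unique HF_rkhs range_space_rkhs (HF_U x) (HF_U y)) /= !UinvK.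
Qed.

Lemma HF_hnorm x : hnorm HF (U x) = rnorm x.
Proof. by rewrite /hnorm HF_ip -(hnorm_full dot_norm). Qed.

Lemma HF_sub_fock : carrier HF `<=` carrier fock.
Proof. by rewrite HF_carrier => _ [x _ <-]; exact: Ufock. Qed.

Section Eigen.
Let cf j : lam j != 0 -> carrier fock (f j).
Proof. by apply: (spectral_orthonormal spec).1. Qed.

Let sq j : C := (Num.sqrt (lam j))%:C%C.

Let sq_neq0 j : lam j != 0 -> sq j != 0.
Proof.
move=> lj; apply/negP => /eqP /complexI /eqP; rewrite sqrtr_eq0 => l0.
by move: lj; rewrite eq_le l0 (spectral_ge0 spec).
Qed.

Let sq2 j : sq j * sq j = (lam j)%:C%C.
Proof. by rewrite /sq -rmorphM -expr2 sqr_sqrtr// (spectral_ge0 spec). Qed.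

(** The left singular vectors of [iota]; [U] maps them to the asserted basis vectors. *)
Let v j := (sq j)^-1 *: iota (f j).

Let UiotaE j : lam j != 0 -> U (iota (f j)) = (lam j)%:C%C *: f j.
Proof. by move=> lj; rewrite -L_opE (spectral_eigen spec). Qed.

Let UvE j : lam j != 0 -> U (v j) = sq j *: f j.
Proof.
move=> lj; rewrite /v UZ UiotaE// scalerA -sq2 mulKf//; exact: sq_neq0.
Qed.

Let dot_v j l : lam j != 0 -> lam l != 0 -> dot (v j) (v l) = (j == l)%:R.
Proof.
move=> lj ll.
have e1 : dot (v j) (v l) = (sq j)^-1 * ((sq l)^-1)^* * dot (iota (f j)) (iota (f l)).
  rewrite -mulrA; transitivity ((sq j)^-1 * dot (iota (f j)) (v l)).
    exact: (ipZl pH (x := iota (f j)) (z := v l) (sq j)^-1 I I).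
  congr (_ * _); exact: (ipZr pH (x := iota (f l)) (z := iota (f j)) (sq l)^-1 I I).
have e2 : fock_ip (f j) ((lam l)%:C%C *: f l) = ((lam l)%:C%C)^* * fock_ip (f j) (f l) :=
  ipZr pF (lam l)%:C%C (cf ll) (cf lj).
have e3 : fock_ip (f j) (f l) = (j == l)%:R := (spectral_orthonormal spec).2 j l lj ll.
have cr (t : R) : (t%:C%C : C)^* = t%:C%C by rewrite conjCE /= oppr0.
rewrite e1 (pair _ (cf lj)) UiotaE// e2 e3.
have [->|_] := eqVneq j l; last by rewrite !mulr0.
rewrite mulr1 cr fmorphV /= /sq cr -/(sq l) -sq2.
by field; exact: sq_neq0.
Qed.

(* Applying [iota] to [G] minus its expansion along the [f j] has small norm:
   |iota G_n|^2 = <G_n, L G_n>, where |G_n| <= |G| and L G_n -> 0. *)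
Let iota_approx G (e : R) : carrier fock G -> 0 < e -> exists n,
  rnorm (iota G - \sum_(j < n | lam j != 0) fock_ip G (f j) *: iota (f j)) < e.
Proof.
move=> cG e0.
pose P n := \sum_(j < n | lam j != 0) fock_ip G (f j) *: f j.
pose s n := \sum_(j < n | lam j != 0) fock_ip G (f j) *: iota (f j).
have cP n : carrier fock (P n).
  by apply: (car_sum pF) => j /cf cj; exact: (carZ pF).
have cGn n : carrier fock (G - P n) := carB pF cG (cP n).
have iotaE n : iota (G - P n) = iota G - s n.
  apply: iota_eq => // x.
  have -> : dot (iota G - s n) x = dot (iota G) x - dot (s n) x :=
    ipBl pH (x := iota G) (y := s n) (z := x) I I I.
  have -> : fock_ip (G - P n) (U x) = fock_ip G (U x) - fock_ip (P n) (U x) :=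
    ipBl pF cG (cP n) (Ufock x).
  rewrite pair//; congr (_ - _).
  have -> : fock_ip (P n) (U x) = \sum_(j < n | lam j != 0) fock_ip (fock_ip G (f j) *: f j) (U x).
    by apply: (ip_suml pF) => // j /cf cj; exact: (carZ pF).
  have -> : dot (s n) x = \sum_(j < n | lam j != 0) dot (fock_ip G (f j) *: iota (f j)) x.
    exact: (ip_suml pH (z := x) (index_enum 'I_n) (P := fun j => lam j != 0)
      (F := fun j : 'I_n => fock_ip G (f j) *: iota (f j)) (fun _ _ => I) I).
  apply: eq_bigr => j lj; rewrite linearZl_LR /= pair; last exact: cf.
  exact: esym (ipZl pF (fock_ip G (f j)) (cf lj) (Ufock x)).
have ortP n j : (j < n)%N -> lam j != 0 -> fock_ip (G - P n) (f j) = 0.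
  move=> jn lj; have cj := cf lj.
  have -> : fock_ip (G - P n) (f j) = fock_ip G (f j) - fock_ip (P n) (f j) :=
    ipBl pF cG (cP n) cj.
  have -> : fock_ip (P n) (f j) = \sum_(i < n | lam i != 0) fock_ip (fock_ip G (f i) *: f i) (f j).
    by apply: (ip_suml pF) => // i /cf ci; exact: (carZ pF).
  rewrite (bigD1 (Ordinal jn))//= [\sum_(i < n | _ && _) _]big1 => [|i /andP[li ij]].
    have -> : fock_ip (fock_ip G (f j) *: f j) (f j) = fock_ip G (f j) * fock_ip (f j) (f j) :=
      ipZl pF _ cj cj.
    have -> : fock_ip (f j) (f j) = (j == j)%:R := (spectral_orthonormal spec).2 j j lj lj.
    by rewrite eqxx mulr1 addr0 subrr.
  have -> : fock_ip (fock_ip G (f i) *: f i) (f j) = fock_ip G (f i) * fock_ip (f i) (f j) :=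
    ipZl pF _ (cf li) cj.
  have -> : fock_ip (f i) (f j) = (val i == j)%:R := (spectral_orthonormal spec).2 i j li lj.
  by rewrite -val_eqE /= in ij; rewrite (negbTE ij) mulr0.
(* Pythagoras: [G] is the sum of the orthogonal vectors [G - P n] and [P n]. *)
have nG n : hnorm fock (G - P n) <= hnorm fock G.
  rewrite -(@ler_pXn2r _ 2)// ?nnegrE ?hnorm_ge0//.
  have := hnorm2_lin pF 1 (cGn n) (cP n); rewrite scale1r subrK => ->.
  have -> : ip fock (G - P n) (P n) = 0.
    transitivity (\sum_(j < n | lam j != 0) fock_ip (G - P n) (fock_ip G (f j) *: f j)).
      by apply: (ip_sumr pF) => // j /cf cj; exact: (carZ pF).
    apply: big1 => j lj.
    have -> : fock_ip (G - P n) (fock_ip G (f j) *: f j) =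
      (fock_ip G (f j))^* * fock_ip (G - P n) (f j) := ipZr pF _ (cf lj) (cGn n).
    by rewrite ortP ?mulr0.
  by rewrite mulr0 mulr0 addr0 lerDl mulr_ge0// sqr_ge0.
have LE n : U (iota (G - P n)) = L_op T dot h G -
    \sum_(j < n | lam j != 0) (lam j)%:C%C *: rank_one fock (f j) (f j) G.
  rewrite iotaE UB L_opE; congr (_ - _); rewrite /s -big_filter U_sum big_filter.
  by apply: eq_bigr => j lj; rewrite UZ UiotaE// !scalerA mulrC.
have lim0 : (fun n => hnorm fock (U (iota (G - P n)))) @ \oo --> (0 : R).
  have := spectral_sum spec cG; rewrite /hcvg.
  suff -> : (fun n => hnorm fock (U (iota (G - P n)))) = (fun n => hnorm fock
     (\sum_(j < n | lam j != 0) (lam j)%:C%C *: rank_one fock (f j) (f j) G - L_op T dot h G)) by [].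
  apply/funext => n; rewrite LE (hnormBC pF)//; last first.
    by apply: (car_sum pF) => j /cf cj; apply: (carZ pF); exact: (carZ pF).
  by rewrite L_opE; exact: Ufock.
have G0 := hnorm_ge0 fock G.
have e1 : 0 < e ^+ 2 / (hnorm fock G + 1) by rewrite divr_gt0 ?exprn_gt0// ltr_wpDl.
have /cvgrPdist_lt /(_ _ e1) [n _ /(_ n (leqnn n))] := lim0.
rewrite /= sub0r normrN ger0_norm ?hnorm_ge0// => hn; exists n.
rewrite -/(s n) -iotaE -(@ltr_pXn2r _ 2)// ?nnegrE ?rnorm_ge0 ?ltW//.
have -> : rnorm (iota (G - P n)) ^+ 2 = complex.Re (fock_ip (G - P n) (U (iota (G - P n)))).
  by rewrite -pair// -(hnorm_full dot_norm) (hnorm2 pH (x := iota (G - P n)) I).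
apply: le_lt_trans (le_trans (ler_norm _) (Re_le_rnorm _)) _.
apply: le_lt_trans (ip_cauchy pF (cGn n) (Ufock _)) _.
apply: (@le_lt_trans _ _ ((hnorm fock G + 1) * hnorm fock (U (iota (G - P n))))).
  by rewrite ler_wpM2r ?hnorm_ge0// (le_trans (nG n))// lerDl.
by rewrite mulrC -ltr_pdivlMr// ltr_wpDl.
Qed.

(** A polynomial belongs to the Fock space and [iota] maps it to [op_poly], so this is cyclicity. *)
Let iota_dense x (e : R) : 0 < e -> exists2 G, carrier fock G & rnorm (x - iota G) < e.
Proof.
move=> e0.
have [y [xy [p _ pE]]] : ball x e%:C%C `&` [set op_poly T p h | p in setT] !=set0.
  apply: (tuple_cyclic cT); last exact: ball_open.
  by exists x; apply: ballxx; rewrite ltcR.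
have cm al : carrier fock (fun z : Cd => monomial z al).
  exact: (fock_exp (exp_bound_monomial R al) (@power_series_monomial R d al)).
pose G : Cd -> C := \sum_(al <- msupp p) p@_al *: (fun z : Cd => monomial z al).
have cG : carrier fock G by apply: (car_sum pF) => al _; exact: (carZ pF).
exists G => //; rewrite (iota_eq (y := y))//.
  by move: xy; rewrite -ball_normE /ball_ /= normE ltcR.
move=> x'; rewrite -pE /op_poly dot_suml//.
have -> : fock_ip G (U x') = \sum_(al <- msupp p) fock_ip (p@_al *: (fun z : Cd => monomial z al)) (U x').
  by apply: (ip_suml pF) => // al _; exact: (carZ pF).
apply: eq_bigr => al _; rewrite linearZl_LR /= (pairing_monomial dot_norm cT hU).
exact: esym (ipZl pF _ (cm al) (Ufock x')).
Qed.

Lemma HF_onb : is_onb HF [set k | lam k != 0] (fun k => (Num.sqrt (lam k))%:C%C *: f k).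
Proof.
split.
  split=> [j lj|j l lj ll] /=; first by rewrite -/(sq j) -UvE//; exact: HF_U.
  by rewrite -/(sq j) -/(sq l) -!UvE// HF_ip dot_v.
rewrite HF_carrier => _ [x _ <-] e e0.
have e2 : 0 < e / 2 by rewrite divr_gt0.
have [G cG xG] := iota_dense x e2.
have [n hn] := iota_approx cG e2.
(* The extra factor [sq j] appears because [U (iota (f j))] is [lam j] times [f j], that is, [sq j]
   times the basis vector. *)
exists [seq j <- index_iota 0 n | lam j != 0], (fun j => fock_ip G (f j) * sq j).
split=> [j|]; first by rewrite mem_filter => /andP[].
have -> : \sum_(j <- [seq j <- index_iota 0 n | lam j != 0])
      (fock_ip G (f j) * sq j) *: ((Num.sqrt (lam j))%:C%C *: f j) =
    U (\sum_(j < n | lam j != 0) fock_ip G (f j) *: iota (f j)).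
  rewrite big_filter -[in RHS]big_filter U_sum big_filter big_mkord.
  apply: eq_bigr => j lj; rewrite UZ UiotaE// !scalerA -mulrA.
  by rewrite -/(sq j) sq2.
rewrite -UB HF_hnorm [e]splitr.
rewrite (_ : x - _ = (x - iota G) + (iota G - \sum_(j < n | lam j != 0) fock_ip G (f j) *: iota (f j))).
  by apply: le_lt_trans (rnormD _ _) _; exact: ltrD.
by rewrite addrA subrK.
Qed.

End Eigen.

(** Riesz representation of the functionals [dot (A z) x] in [z] yields one adjoint together with
    its bound. The chosen adjoint agrees with it everywhere, the carrier being all of [H]. *)
Lemma adjoint_bounded (A : {linear H -> H}) : continuous A -> exists2 M, 0 <= M &
  is_adjoint (hfull dot) (hfull dot) A (adjoint (hfull dot) (hfull dot) A) /\
  forall x, rnorm (adjoint (hfull dot) (hfull dot) A x) <= M * rnorm x.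
Proof.
move=> /continuous_rnorm_bound[M M0 hM].
have /choice [B hB] : forall x, exists y, (forall z, dot (A z) x = dot z y) /\ rnorm y <= M * rnorm x.
  move=> x.
  have [|||y [_ hy yM]] := @riesz_on_subspace R H (hfull dot) hH setT (fun z => dot (A z) x)
      (M * rnorm x) I (fun _ _ _ _ _ => I) (fun _ _ => I).
  - by move=> a z z' _ _; rewrite linearP linearDl linearZl_LR.
  - by rewrite mulr_ge0// rnorm_ge0.
  - move=> z _; apply: le_trans (rnorm_dot dot_norm _ _) _.
    by rewrite (hnorm_full dot_norm) mulrAC ler_wpM2r ?rnorm_ge0.
  exists y; split=> [z|]; first exact: hy.
  by move: yM; rewrite (hnorm_full dot_norm).
have aB : is_adjoint (hfull dot) (hfull dot) A B.
  by split=> // z x _ _; exact: (hB x).1.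
have aA := adjointP aB; exists M => //; split=> // x.
rewrite (_ : adjoint _ _ _ x = B x); first exact: (hB x).2.
by apply: dot_inj_r => z; have := aA.2 z x I I; have := aB.2 z x I I => /= -> ->.
Qed.

Local Notation Tadj i := (adjoint (hfull dot) (hfull dot) (T i)).

(** The factor [(be i).+1] of the differentiated series cancels against [mnm_fact (U_(i) + be) = (be
    i).+1 * mnm_fact be]. *)
Lemma U_adjoint_coef i x : adj_coef dot T h (Tadj i x) = deriv_coef i (adj_coef dot T h x).
Proof.
have [M M0 [[_ aT] _]] := adjoint_bounded (tuple_bounded cT (i := i)).
apply/funext => be; rewrite /deriv_coef /adj_coef (op_monomialD1 cT).
have e1 : dot (Tadj i x) (op_monomial T be h) = dot x (T i (op_monomial T be h)).
  have e2 : dot (T i (op_monomial T be h)) x = dot (op_monomial T be h) (Tadj i x) :=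
    aT (op_monomial T be h) x I I.
  by rewrite dotC -e2 -dotC.
rewrite e1 /mnm_fact [in RHS](bigD1 i)//= [in LHS](bigD1 i)//= mnmDE mnm1E eqxx add1n factS.
have -> : (\prod_(j < d | j != i) ((U_(i) + be)%MM j)`! = \prod_(j < d | j != i) (be j)`!)%N.
  by apply: eq_bigr => j ji; rewrite mnmDE mnm1E eq_sym (negbTE ji) add0n.
rewrite !natrM; field; rewrite nat1r !pnatr_eq0 -!lt0n fact_gt0 /= ?andbT.
by rewrite prodn_gt0// => j; exact: fact_gt0.
Qed.

Lemma partial_U i x : partial i (U x) = U (Tadj i x).
Proof.
apply: (partialE (b := adj_coef dot T h x)); first exact: hU.
by rewrite -U_adjoint_coef; exact: hU.
Qed.

Lemma derivable_U i x z : derivable (U x) z (delta_mx 0 i).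
Proof.
apply: (@partial_derivable _ _ i (U x) (U (Tadj i x)) (adj_coef dot T h x)); first exact: hU.
by rewrite -U_adjoint_coef; exact: hU.
Qed.

End Model.

Theorem theorem1p5 (R : realType) (d : nat) (H : completeNormedModType R[i])
    (dot : {dot H for conjC}) (T : 'I_d -> {linear H -> H}) (h : H)
    (lam : nat -> R) (f : nat -> 'rV[R[i]]_d -> R[i]) :
  (forall x, `|x| ^+ 2 = dot x x) ->
  cyclic_commuting_tuple T h ->
  spectral_decomposition (fock R d) (L_op T dot h) lam f ->
  let F := spectral_kernel lam f in
  let HF := rkhs F in
  [/\ carrier HF `<=` carrier (fock R d),
      is_onb HF [set k | lam k != 0]
        (fun k => (Num.sqrt (lam k))%:C%C *: f k),
      forall i : 'I_d,
        (forall g, carrier HF g -> forall z, derivable g z (delta_mx 0 i)) /\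
        bounded_operator HF HF (partial i) &
      exists U : H -> ('rV[R[i]]_d -> R[i]),
        unitary_operator (hfull dot) HF U /\
        forall i x,
          adjoint (hfull dot) (hfull dot) (T i) x =
          adjoint (hfull dot) HF U (partial i (U x))].
Proof.
move=> dot_norm cT spec F HF; have [U hU] := adj_exists dot_norm cT.
have HFc : carrier HF = range U := HF_carrier dot_norm cT spec hU.
have HFi x y : ip HF (U x) (U y) = dot x y := HF_ip dot_norm cT spec hU x y.
have HFn x : hnorm HF (U x) = rnorm x := HF_hnorm dot_norm cT spec hU x.
have HFU x : carrier HF (U x) := HF_U dot_norm cT spec hU x.
split.
- exact: (HF_sub_fock dot_norm cT spec hU).
- exact: (HF_onb dot_norm cT spec hU).
- move=> i; split.
    by rewrite HFc => _ [x _ <-] z; exact: (derivable_U dot_norm cT hU).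
  have [M M0 [_ hM]] := adjoint_bounded dot_norm (tuple_bounded cT (i := i)).
  split; rewrite HFc.
  + move=> _ [x _ <-]; rewrite (partial_U dot_norm cT hU).
    by exists (adjoint (hfull dot) (hfull dot) (T i) x).
  (* On the range of [U], linearity of [partial i] is that of the adjoint of [T i], which is tested
     against every [z] in [H]. *)
  + move=> a _ _ [x _ <-] [y _ <-]; rewrite -(U_lin hU) !(partial_U dot_norm cT hU).
    rewrite -(U_lin hU); congr (U _).
    have [M' _ [[_ aT] _]] := adjoint_bounded dot_norm (tuple_bounded cT (i := i)).
    set B := adjoint _ _ _ in aT *; apply: (dot_inj_r dot_norm) => z.
    have aTE w : dot z (B w) = dot (T i z) w := esym (aT z w I I).
    have pH := hilbert_pre (hfull_hilbert dot_norm).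
    rewrite aTE.
    have -> : dot (T i z) (a *: x + y) = dot (T i z) (a *: x) + dot (T i z) y :=
      ipDr pH (x := a *: x) (y := y) (z := T i z) I I I.
    have -> : dot (T i z) (a *: x) = a^* * dot (T i z) x :=
      ipZr pH (x := x) (z := T i z) a I I.
    have -> : dot z (a *: B x + B y) = dot z (a *: B x) + dot z (B y) :=
      ipDr pH (x := a *: B x) (y := B y) (z := z) I I I.
    have -> : dot z (a *: B x) = a^* * dot z (B x) :=
      ipZr pH (x := B x) (z := z) a I I.
    by rewrite !aTE.
  + exists M => _ [x _ <-]; rewrite (partial_U dot_norm cT hU) !HFn.
    exact: hM.
- exists U; split.
    split=> [x _|a x y _ _|x y _ _|y]; [exact: HFU|exact: (U_lin hU)|exact: HFi|].
    by rewrite HFc => -[x _ <-]; exists x.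
  move=> i x; rewrite (partial_U dot_norm cT hU).
  (* The inverse of a unitary is an adjoint of it, so the chosen [U^*] is a true adjoint. The claim
     becomes [U^* (U y) = y] for the vector [y] obtained from [x] by the adjoint of [T i]. *)
  have aU : is_adjoint (hfull dot) HF U (Uinv U).
    split=> // y g _; rewrite HFc => -[x' _ <-].
    by rewrite HFi (UinvK dot_norm cT hU).
  have [_ aA] := adjointP aU; apply: (dot_inj_r dot_norm) => z.
  set y := adjoint _ _ (T i) x.
  have -> : dot z (adjoint (hfull dot) HF U (U y)) = ip HF (U z) (U y) :=
    esym (aA z (U y) I (HFU y)).
  by rewrite HFi.
Qed.
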